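(* Let $M$ be a connected smooth manifold of dimension $n=2$ with a smooth symmetric affine connection $\Gamma$ and a smooth everywhere non-degenerate operator field $\mathbf A$ of type $(1,1)$, and consider the system $$\frac{\partial y^i}{\partial t}=\sum_{j=1}^2A^i_j\Big(\frac{\partial^2y^j}{\partial x^2}+\sum_{r,s=1}^2\Gamma^j_{rs}\frac{\partial y^r}{\partial x}\frac{\partial y^s}{\partial x}\Big),\quad i=1,2.$$ Suppose that the system belongs to the case of general position and that its algebra of point symmetries has the maximal dimension $\dim\mathcal G=\frac{n(n+1)}2=3$. Then (near every point of $M$) there is a point transformation $\tilde y^i=\tilde y^i(y^1,y^2)$, i.e. a change of local coordinates on $M$, bringing the system to the form (tildes omitted) $$\frac{\partial y^1}{\partial t}=a\frac{\partial^2y^1}{\partial x^2}+\sum_{r=1}^2a\frac{\varepsilon_r}f\frac{\partial y^r}{\partial x}\Big(y^1\frac{\partial y^r}{\partial x}-2y^r\frac{\partial y^1}{\partial x}\Big)+b\,\varepsilon_1\frac{\partial^2y^2}{\partial x^2}+\sum_{r=1}^2b\,\varepsilon_1\frac{\varepsilon_r}f\frac{\partial y^r}{\partial x}\Big(y^2\frac{\partial y^r}{\partial x}-2y^r\frac{\partial y^2}{\partial x}\Big),$$ $$\frac{\partial y^2}{\partial t}=a\frac{\partial^2y^2}{\partial x^2}+\sum_{r=1}^2a\frac{\varepsilon_r}f\frac{\partial y^r}{\partial x}\Big(y^2\frac{\partial y^r}{\partial x}-2y^r\frac{\partial y^2}{\partial x}\Big)-b\,\varepsilon_2\frac{\partial^2y^1}{\partial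 x^2}-\sum_{r=1}^2b\,\varepsilon_2\frac{\varepsilon_r}f\frac{\partial y^r}{\partial x}\Big(y^1\frac{\partial y^r}{\partial x}-2y^r\frac{\partial y^1}{\partial x}\Big),$$ where $a=\mathrm{const}$, $b=\mathrm{const}$, $\varepsilon_1=\pm1$, $\varepsilon_2=\pm1$, and $f=\frac12+\frac12\big(\varepsilon_1(y^1)^2+\varepsilon_2(y^2)^2\big)$.
   Context: The coefficients $A^i_j$, $\Gamma^j_{rs}=\Gamma^j_{sr}$ are functions of $y^1,y^2$ only; the $y^i$ are local coordinates on $M$, and under change of coordinates $A^i_j$ transform as a $(1,1)$ tensor and $\Gamma^j_{rs}$ as an affine connection. Point symmetries: a vector field $\boldsymbol\eta=\sum_i\eta^i(y)\,\partial/\partial y^i$ on $M$ whose local flow carries solutions to solutions ($x,t$ unchanged); this is expressed by the determining equations, which (for non-degenerate $\mathbf A$) read: $L_{\boldsymbol\eta}\mathbf A=0$ and $$\sum_k\frac{\partial\eta^i}{\partial y^k}\Gamma^k_{rs}=\frac{\partial^2\eta^i}{\partial y^r\partial y^s}+\sum_k\Big(\frac{\partial\Gamma^i_{rs}}{\partial y^k}\eta^k+\Gamma^i_{ks}\frac{\partial\eta^k}{\partial y^r}+\Gamma^i_{rk}\frac{\partial\eta^k}{\partial y^s}\Big)$$ (i.e. $\boldsymbol\eta$ is an infinitesimal affine transformation of $\Gamma$). $\mathcal G$ is the real Lie algebra of all point symmetries on $M$. Curvature: $R^i_{srk}=\frac{\partial\Gamma^i_{ks}}{\partial y^r}-\frac{\partial\Gamma^i_{rs}}{\partial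 y^k}+\sum_q(\Gamma^q_{ks}\Gamma^i_{rq}-\Gamma^q_{rs}\Gamma^i_{kq})$. Ricci tensor: $R_{ij}=\sum_kR^k_{ikj}$, with symmetric part $\hat R_{ij}=\frac12(R_{ij}+R_{ji})$. The system belongs to the case of general position if the matrix $(\hat R_{ij})$ is non-degenerate everywhere on $M$. *)

(* Defs.v *)
From mathcomp Require Import all_boot all_order all_algebra.
From mathcomp Require Import all_classical all_reals all_analysis.
Set Implicit Arguments.
Unset Strict Implicit.
Unset Printing Implicit Defensive.
Import Order.TTheory GRing.Theory Num.Theory.
Import numFieldNormedType.Exports.
Local Open Scope classical_set_scope.
Local Open Scope ring_scope.

Definition partial (R : realType) (n : nat) (i : 'I_n) (f : 'rV[R]_n -> R)
  (y : 'rV[R]_n) : R := 'D_(delta_mx ord0 i : 'rV[R]_n) f y.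

(* Intended for U open: f is of class C^k on U. *)
Fixpoint Ck (R : realType) (n k : nat) (U : set 'rV[R]_n)
  (f : 'rV[R]_n -> R) : Prop :=
  (forall y, U y -> {for y, continuous f}) /\
  if k is k'.+1 then
    forall i : 'I_n,
      (forall y, U y -> derivable f y (delta_mx ord0 i : 'rV[R]_n)) /\
      Ck k' U (partial i f)
  else True.

Definition smooth (R : realType) (n : nat) (U : set 'rV[R]_n)
  (f : 'rV[R]_n -> R) : Prop := forall k, Ck k U f.

(* coord and point are total functions; only their values on cdom and on
   coord @` cdom are meaningful, where they are inverse homeomorphisms. *)
Record chart (R : realType) (n : nat) (M : topologicalType) := Chart {
  cdom : set M;
  coord : M -> 'rV[R]_n;
  point : 'rV[R]_n -> M;
  open_cdom : open cdom;
  open_cimg : open (coord @` cdom);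
  coordK : forall m, cdom m -> point (coord m) = m;
  coord_continuous : forall m, cdom m -> {for m, continuous coord};
  point_continuous :
    forall y, (coord @` cdom) y -> {for y, continuous point}
}.

Definition cimg (R : realType) (n : nat) (M : topologicalType)
  (c : chart R n M) : set 'rV[R]_n := coord c @` cdom c.

Definition overlap (R : realType) (n : nat) (M : topologicalType)
  (c d : chart R n M) : set 'rV[R]_n := coord c @` (cdom c `&` cdom d).

Definition transition (R : realType) (n : nat) (M : topologicalType)
  (c d : chart R n M) (i : 'I_n) (y : 'rV[R]_n) : R :=
  coord d (point c y) ord0 i.

Definition compatible (R : realType) (n : nat) (M : topologicalType)
  (c d : chart R n M) : Prop :=
  (forall i, smooth (overlap c d) (transition c d i)) /\
  (forall i, smooth (overlap d c) (transition d c i)).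

(* The atlas is maximal, so "a chart of the atlas" means "a system of local
   coordinates on M". *)
Definition smooth_manifold (R : realType) (n : nat) (M : topologicalType)
  (atlas : set (chart R n M)) : Prop :=
  [/\ hausdorff_space M,
      @second_countable M,
      (forall m, exists2 c, atlas c & cdom c m),
      (forall c d, atlas c -> atlas d -> compatible c d)
    & (forall c, (forall d, atlas d -> compatible c d) -> atlas c)].

(* jac c d m i k = d ytilde^i / d y^k at m, with y the coordinates of c and
   ytilde those of d. *)
Definition jac (R : realType) (n : nat) (M : topologicalType)
  (c d : chart R n M) (m : M) (i k : 'I_n) : R :=
  partial k (transition c d i) (coord c m).

(* Fields on M are given by their components in each chart, as functions of
   the coordinates of that chart. In A c y i j the index i is the upper one,
   in Gamma c j r s y the index j is the upper one. *)
Definition vector_components (R : realType) (n : nat) (M : topologicalType) :=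
  chart R n M -> 'rV[R]_n -> 'rV[R]_n.

Definition operator_components (R : realType) (n : nat)
  (M : topologicalType) := chart R n M -> 'rV[R]_n -> 'M[R]_n.

Definition connection_components (R : realType) (n : nat)
  (M : topologicalType) :=
  chart R n M -> 'I_n -> 'I_n -> 'I_n -> 'rV[R]_n -> R.

Definition vector_field (R : realType) (n : nat) (M : topologicalType)
  (atlas : set (chart R n M)) (eta : vector_components R n M) : Prop :=
  (forall c, atlas c ->
     forall i, smooth (cimg c) (fun y => eta c y ord0 i)) /\
  (forall c d m, atlas c -> atlas d -> cdom c m -> cdom d m ->
     forall i, eta d (coord d m) ord0 i =
       \sum_k jac c d m i k * eta c (coord c m) ord0 k).

Definition operator_field (R : realType) (n : nat) (M : topologicalType)
  (atlas : set (chart R n M)) (A : operator_components R n M) : Prop :=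
  (forall c, atlas c -> forall i j, smooth (cimg c) (fun y => A c y i j)) /\
  (forall c d m, atlas c -> atlas d -> cdom c m -> cdom d m ->
     forall i j, A d (coord d m) i j =
       \sum_k \sum_l jac c d m i k * A c (coord c m) k l * jac d c m l j).

Definition affine_connection (R : realType) (n : nat) (M : topologicalType)
  (atlas : set (chart R n M)) (Gamma : connection_components R n M) : Prop :=
  (forall c, atlas c -> forall j r s, smooth (cimg c) (Gamma c j r s)) /\
  (forall c d m, atlas c -> atlas d -> cdom c m -> cdom d m ->
     forall j r s, Gamma d j r s (coord d m) =
       \sum_k jac c d m j k *
         (partial r (partial s (transition d c k)) (coord d m) +
          \sum_p \sum_q jac d c m p r * jac d c m q s *
                        Gamma c k p q (coord c m))).

Definition symmetric_connection (R : realType) (n : nat)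
  (M : topologicalType) (atlas : set (chart R n M))
  (Gamma : connection_components R n M) : Prop :=
  forall c y, atlas c -> cimg c y ->
    forall j r s, Gamma c j r s y = Gamma c j s r y.

Definition nondegenerate_operator (R : realType) (n : nat)
  (M : topologicalType) (atlas : set (chart R n M))
  (A : operator_components R n M) : Prop :=
  forall c y, atlas c -> cimg c y -> A c y \in unitmx.

(* curvature G i s r k = R^i_{srk} *)
Definition curvature (R : realType) (n : nat)
  (G : 'I_n -> 'I_n -> 'I_n -> 'rV[R]_n -> R) (i s r k : 'I_n)
  (y : 'rV[R]_n) : R :=
  partial r (G i k s) y - partial k (G i r s) y +
  \sum_q (G q k s y * G i r q y - G q r s y * G i k q y).

Definition ricci (R : realType) (n : nat)
  (G : 'I_n -> 'I_n -> 'I_n -> 'rV[R]_n -> R) (y : 'rV[R]_n) : 'M[R]_n :=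
  \matrix_(i, j) \sum_k curvature G k i k j y.

Definition ricci_sym (R : realType) (n : nat)
  (G : 'I_n -> 'I_n -> 'I_n -> 'rV[R]_n -> R) (y : 'rV[R]_n) : 'M[R]_n :=
  \matrix_(i, j) (2^-1 * (ricci G y i j + ricci G y j i)).

Definition general_position (R : realType) (n : nat) (M : topologicalType)
  (atlas : set (chart R n M)) (Gamma : connection_components R n M) : Prop :=
  forall c y, atlas c -> cimg c y -> ricci_sym (Gamma c) y \in unitmx.

Definition lie_derivative_operator (R : realType) (n : nat)
  (eta : 'rV[R]_n -> 'rV[R]_n) (A : 'rV[R]_n -> 'M[R]_n) (i j : 'I_n)
  (y : 'rV[R]_n) : R :=
  \sum_k (eta y ord0 k * partial k (fun z => A z i j) y
          - A y k j * partial k (fun z => eta z ord0 i) y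
          + A y i k * partial j (fun z => eta z ord0 k) y).

Definition infinitesimal_affine (R : realType) (n : nat)
  (eta : 'rV[R]_n -> 'rV[R]_n)
  (G : 'I_n -> 'I_n -> 'I_n -> 'rV[R]_n -> R) (i r s : 'I_n)
  (y : 'rV[R]_n) : Prop :=
  \sum_k partial k (fun z => eta z ord0 i) y * G k r s y =
  partial r (partial s (fun z => eta z ord0 i)) y +
  \sum_k (partial k (G i r s) y * eta y ord0 k
          + G i k s y * partial r (fun z => eta z ord0 k) y
          + G i r k y * partial s (fun z => eta z ord0 k) y).

Definition point_symmetry (R : realType) (n : nat) (M : topologicalType)
  (atlas : set (chart R n M)) (A : operator_components R n M)
  (Gamma : connection_components R n M) (eta : vector_components R n M) :
  Prop :=
  vector_field atlas eta /\
  forall c y, atlas c -> cimg c y ->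
    (forall i j, lie_derivative_operator (eta c) (A c) i j y = 0) /\
    (forall i r s, infinitesimal_affine (eta c) (Gamma c) i r s y).

(* Components outside the atlas or outside cimg c carry no information, so
   vector fields are compared with eq_on_manifold instead of =. *)
Definition eq_on_manifold (R : realType) (n : nat) (M : topologicalType)
  (atlas : set (chart R n M)) (xi eta : vector_components R n M) : Prop :=
  forall c y, atlas c -> cimg c y -> xi c y = eta c y.

Definition combination (R : realType) (n : nat) (M : topologicalType)
  (N : nat) (a : 'I_N -> R) (eta : 'I_N -> vector_components R n M) :
  vector_components R n M :=
  fun c y => \sum_l a l *: eta l c y.

(* The real vector space of all point symmetries has dimension N: it has a
   basis with N elements. *)
Definition symmetry_algebra_dim (R : realType) (n : nat)
  (M : topologicalType) (atlas : set (chart R n M))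
  (A : operator_components R n M) (Gamma : connection_components R n M)
  (N : nat) : Prop :=
  exists eta : 'I_N -> vector_components R n M,
    [/\ forall l, point_symmetry atlas A Gamma (eta l),
        forall a : 'I_N -> R,
          eq_on_manifold atlas (combination a eta) (fun _ _ => 0) ->
          forall l, a l = 0
      & forall xi, point_symmetry atlas A Gamma xi ->
          exists a : 'I_N -> R,
            eq_on_manifold atlas xi (combination a eta)].

(* An evolution system y_t = F(y, y_x, y_xx) is given by its right-hand side
   F y p q, a function of independent jet variables p = y_x, q = y_xx. *)
Definition evolution_rhs (R : realType) (n : nat) :=
  'rV[R]_n -> 'rV[R]_n -> 'rV[R]_n -> 'rV[R]_n.

Definition system_rhs (R : realType) (n : nat) (A : 'rV[R]_n -> 'M[R]_n)
  (G : 'I_n -> 'I_n -> 'I_n -> 'rV[R]_n -> R) : evolution_rhs R n :=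
  fun y p q => \row_i \sum_j A y i j *
    (q ord0 j + \sum_r \sum_s G j r s y * p ord0 r * p ord0 s).

Definition i1 : 'I_2 := ord0.
Definition i2 : 'I_2 := ord_max.

Definition conformal_factor (R : realType) (eps : 'I_2 -> R)
  (y : 'rV[R]_2) : R :=
  2^-1 + 2^-1 * (eps i1 * y ord0 i1 ^+ 2 + eps i2 * y ord0 i2 ^+ 2).

Definition normal_form_rhs (R : realType) (a b : R) (eps : 'I_2 -> R) :
  evolution_rhs R 2 :=
  fun y p q =>
    let f := conformal_factor eps y in
    let y1 := y ord0 i1 in let y2 := y ord0 i2 in
    let p1 := p ord0 i1 in let p2 := p ord0 i2 in
    let q1 := q ord0 i1 in let q2 := q ord0 i2 in
    \row_i
      if i == i1 then
        a * q1
        + \sum_r a * (eps r / f) * p ord0 r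
                 * (y1 * p ord0 r - 2 * y ord0 r * p1)
        + b * eps i1 * q2
        + \sum_r b * eps i1 * (eps r / f) * p ord0 r
                 * (y2 * p ord0 r - 2 * y ord0 r * p2)
      else
        a * q2
        + \sum_r a * (eps r / f) * p ord0 r
                 * (y2 * p ord0 r - 2 * y ord0 r * p2)
        - b * eps i2 * q1
        - \sum_r b * eps i2 * (eps r / f) * p ord0 r
                 * (y1 * p ord0 r - 2 * y ord0 r * p1).

(* Main.v *)
(** Every point symmetry preserves the Ricci tensor, and its 1-jet at one point
    determines it. Three independent symmetries therefore realise, at every
    point, all values and one non-degenerate traceless derivative. Near a point
    they can be chosen with [x3, x1] = - x2, [x3, x2] = de x1 and
    [x1, x2] = ka x3, where de = 1 or -1. If x3 = al x1 + be x2 in the frame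
    (x1, x2), then (be, - al) are gnomonic coordinates of a quadric, and the
    stereographic coordinates of that quadric turn x1, x2, x3 into quadratic
    polynomials. In these coordinates the symmetry vanishing at a point
    determines the connection at that point algebraically and commutes with the
    operator there; transitivity makes the two remaining entries of the operator
    constant. If ka were 0 the connection would be flat, so a scaling gives
    ka = 1 or -1. *)

From HB Require Import structures.
Require Import Defs.
From mathcomp Require Import all_boot all_order all_algebra.
From mathcomp Require Import all_classical all_reals all_analysis.
From mathcomp Require Import ring lra.
Import Order.TTheory GRing.Theory Num.Theory.
Import numFieldNormedType.Exports.
Set Implicit Arguments.
Unset Strict Implicit.
Unset Printing Implicit Defensive.
Local Open Scope classical_set_scope.
Local Open Scope ring_scope.

(** * Lie derivatives in a differential ring *)

(** No flow is integrated and no homogeneous space is constructed; the argument lives on 1-jets. At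
    a zero of a symmetry, invariance of the symmetric Ricci form makes the derivative skew for that
    form, and skew endomorphisms of a non-degenerate plane form a line. Hence 1-jets at a point fill
    a space of dimension 2 + 1, which is where the bound 3 comes from. Uniqueness from the jet is
    first proved on small balls and then spread over the manifold by connectedness. Brackets are
    taken only on a ball inside one chart. There the affine equations are closed under brackets, and
    the jet at the centre identifies each bracket with a symmetry already at hand, so the structure
    constants come from linear algebra at one point. The symmetry vanishing at a point determines
    the connection there because two candidates would differ by a tensor, symmetric in two lower
    indices and with one upper index, that is invariant under a rotation (or a boost when [de] is
    -1); its weights are odd, so only zero is invariant. *)

Lemma sum_ord2 (V : nmodType) (F : 'I_2 -> V) : \sum_i F i = F i1 + F i2.
Proof.
by rewrite big_ord_recl big_ord1; congr (_ + F _); apply/val_inj.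
Qed.

Lemma forall_ord2 (P : 'I_2 -> Prop) : P i1 -> P i2 -> forall i, P i.
Proof.
move=> P1 P2 [[|[|//]] k].
  by rewrite (_ : Ordinal k = i1) //; apply/val_inj.
by rewrite (_ : Ordinal k = i2) //; apply/val_inj.
Qed.

Section DifferentialRing.
Variables (K : comNzRingType) (d : 'I_2 -> K -> K).
Hypothesis dD : forall i, {morph d i : x y / x + y}.
Hypothesis dM : forall i x y, d i (x * y) = d i x * y + x * d i y.
Hypothesis dC : forall x, d i2 (d i1 x) = d i1 (d i2 x).

Lemma derivation0 i : d i 0 = 0.
Proof. by apply: (addrI (d i 0)); rewrite -dD !addr0. Qed.
Lemma derivationN i x : d i (- x) = - d i x.
Proof. by apply: (addrI (d i x)); rewrite -dD !subrr derivation0. Qed.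
Definition derivation_rules := (dD, derivationN, dM, dC).

Variable G : 'I_2 -> 'I_2 -> 'I_2 -> K.
Hypothesis Gsym : forall j r s, G j r s = G j s r.

(** The Lie derivative of the connection along [eta], that is, the difference of the two sides of
    the affine equations. In an abstract ring with commuting derivations the tensor identities below
    become polynomial identities, decided by [ring]. *)
Definition affE (eta : 'I_2 -> K) (i r s : 'I_2) : K :=
  d r (d s (eta i)) +
  \sum_k (d k (G i r s) * eta k + G i k s * d r (eta k) + G i r k * d s (eta k))
  - \sum_k d k (eta i) * G k r s.

Definition curvE (i s r k : 'I_2) : K :=
  d r (G i k s) - d k (G i r s) + \sum_q (G q k s * G i r q - G q r s * G i k q).

Definition bracketE (eta xi : 'I_2 -> K) (i : 'I_2) : K :=
  \sum_k (eta k * d k (xi i) - xi k * d k (eta i)).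

(** The Lie derivative of a tensor with one upper and two lower indices; [affE xi] is such a tensor
    although the connection is not. *)
Definition lie12 (eta : 'I_2 -> K) (X : 'I_2 -> 'I_2 -> 'I_2 -> K) i r s :=
  \sum_k (eta k * d k (X i r s) - X k r s * d k (eta i)
    + X i k s * d r (eta k) + X i r k * d s (eta k)).

(* In dimension 2 the curvature is determined by its components [R^i_(s12)]. *)
Definition lieR (eta : 'I_2 -> K) (i s : 'I_2) :=
  \sum_k (eta k * d k (curvE i s i1 i2) - curvE k s i1 i2 * d k (eta i)
    + curvE i k i1 i2 * d s (eta k) + curvE i s i1 i2 * d k (eta k)).

(* The Lie derivative of the curvature is the antisymmetrised covariant
   derivative of that of the connection. *)
Lemma lieRE eta i s :
  lieR eta i s = d i1 (affE eta i i2 s) - d i2 (affE eta i i1 s)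
   + \sum_k (G i i1 k * affE eta k i2 s - G k i1 s * affE eta i i2 k
         - G i i2 k * affE eta k i1 s + G k i2 s * affE eta i i1 k).
Proof.
move: i s; apply: forall_ord2; apply: forall_ord2; rewrite /lieR /affE /curvE !sum_ord2 !derivation_rules !(Gsym _ i2 i1);  ring.
Qed.

Definition ricE (i j : 'I_2) := \sum_k curvE k i k j.

Definition lieRic (eta : 'I_2 -> K) (i j : 'I_2) :=
  \sum_k (eta k * d k (ricE i j) + ricE k j * d i (eta k) + ricE i k * d j (eta k)).

(** In each Ricci entry one of the two summands vanishes by antisymmetry, so the Ricci tensor is the
    curvature up to sign and a choice of index; the divergence term of [lieR] accounts for the
    suppressed pair of indices. *)
Lemma lieRicE eta i : lieRic eta i i1 = - lieR eta i2 i /\ lieRic eta i i2 = lieR eta i1 i.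
Proof.
move: i; apply: forall_ord2; rewrite /lieRic /lieR /ricE /curvE !sum_ord2 !derivation_rules !(Gsym _ i2 i1);
  by split; ring.
Qed.

Lemma lieRic_eq0 eta : (forall i r s, affE eta i r s = 0) -> forall i j, lieRic eta i j = 0.
Proof.
move=> E0.
have R0 i s : lieR eta i s = 0.
  by rewrite lieRE sum_ord2 !E0 !derivation0 !(mulr0, subr0, addr0).
move=> i; have [h1 h2] := lieRicE eta i.
by apply: forall_ord2; rewrite ?h1 ?h2 R0 ?oppr0.
Qed.

(** The Lie derivative along a bracket is the commutator of the Lie derivatives, applied here to the
    connection. *)
Lemma aff_bracket eta xi i r s : affE (bracketE eta xi) i r s =
  lie12 eta (affE xi) i r s - lie12 xi (affE eta) i r s.
Proof.
move: i r s; do 3 apply: forall_ord2; rewrite /lie12 /affE /bracketE !sum_ord2 !derivation_rules !(Gsym _ i2 i1); ring.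
Qed.

Lemma aff_bracket_eq0 eta xi : (forall i r s, affE eta i r s = 0) ->
  (forall i r s, affE xi i r s = 0) -> forall i r s, affE (bracketE eta xi) i r s = 0.
Proof.
move=> e0 x0 i r s; rewrite aff_bracket /lie12 !sum_ord2 !e0 !x0 !derivation0.
by rewrite !(mulr0, mul0r, subr0, addr0).
Qed.

Lemma jacobi x y z i :
  bracketE x (bracketE y z) i = bracketE (bracketE x y) z i + bracketE y (bracketE x z) i.
Proof. by move: i; apply: forall_ord2; rewrite /bracketE !sum_ord2 !derivation_rules; ring. Qed.

End DifferentialRing.

Section AffineLinear.
Variables (K : comNzRingType) (d : 'I_2 -> K -> K).
Hypothesis dD : forall i, {morph d i : x y / x + y}.
Hypothesis dM : forall i x y, d i (x * y) = d i x * y + x * d i y.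
Variable G : 'I_2 -> 'I_2 -> 'I_2 -> K.

Lemma affED f h i r s :
  affE d G (fun i => f i + h i) i r s = affE d G f i r s + affE d G h i r s.
Proof. by rewrite /affE !sum_ord2 !dD; ring. Qed.

Lemma affEZ c f i r s : (forall k, d k c = 0) ->
  affE d G (fun i => c * f i) i r s = c * affE d G f i r s.
Proof.
move=> dc; have dZ k x : d k (c * x) = c * d k x by rewrite dM dc mul0r add0r.
by rewrite /affE !sum_ord2 !dZ; ring.
Qed.

End AffineLinear.

(** * Smooth functions of two variables *)

Local Notation e_ i := (delta_mx ord0 i).

Section Line.
Variables (R : realType) (n : nat).
Implicit Types (f : 'rV[R]_n -> R) (x v : 'rV[R]_n).

Lemma is_derive_line f x v (t : R) :
  derivable f (t *: v + x) v ->
  is_derive t 1 (fun s : R => f (s *: v + x)) ('D_v f (t *: v + x)).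
Proof.
have E : (fun h : R => h^-1 *: (((fun s : R => f (s *: v + x)) \o shift t) (h *: 1) -
    f (t *: v + x))) =
  (fun h : R => h^-1 *: ((f \o shift (t *: v + x)) (h *: v) - f (t *: v + x))).
  by apply/funext => h /=; rewrite [_%:A]mulr1 scalerDl addrA.
move=> fd; split; first by rewrite /derivable E.
by rewrite /derive E.
Qed.

Lemma MVT_unit (F dF : R -> R) :
  (forall t : R, 0 <= t <= 1 -> is_derive t 1 F (dF t)) ->
  exists2 s : R, 0 <= s <= 1 & F 1 - F 0 = dF s.
Proof.
move=> D.
have [||s] := MVT_segment (@ler01 R) (f := F) (df := dF).
- by move=> t; rewrite in_itv => /= /andP[t0 t1]; apply: D; rewrite !ltW.
- by apply: derivable_within_continuous => t; rewrite in_itv => /D ?; exact: ex_derive.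
by rewrite in_itv subr0 mulr1 => s01 ->; exists s.
Qed.

Lemma is_derive_scale (F : R -> R) (a t dF : R) :
  is_derive (t * a) 1 F dF -> is_derive t 1 (fun s => F (s * a)) (a * dF).
Proof.
move=> DF.
pose m (s : R) : R := s * a.
have dm : is_derive t 1 m a.
  have -> : m = a \*: (@id R) by apply/funext => u; rewrite /m mulrC.
  apply: is_derive_eq; exact: mulr1.
have dF1 : derivable F (m t) 1 by exact: ex_derive.
have dm1 : derivable m t 1 by exact: ex_derive.
change (is_derive t 1 (F \o m) (a * dF)); split.
  exact: (derivable1_diffP _ _).2 (differentiable_comp ((derivable1_diffP _ _).1 dm1)
    ((derivable1_diffP _ _).1 dF1)).
by rewrite -derive1E (derive1_comp dm1 dF1) !derive1E !derive_val mulrC.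
Qed.

Lemma MVT_line f x v (a : R) :
  (forall s : R, 0 <= s <= 1 -> derivable f ((s * a) *: v + x) v) ->
  exists2 s : R, 0 <= s <= 1 &
    f (a *: v + x) - f x = a * 'D_v f ((s * a) *: v + x).
Proof.
move=> fd.
have D (t : R) : 0 <= t <= 1 ->
    is_derive t 1 (fun s : R => f ((s * a) *: v + x)) (a * 'D_v f ((t * a) *: v + x)).
  by move=> /fd /is_derive_line /is_derive_scale.
have [s s01 E] := MVT_unit D.
by exists s => //; rewrite -E mul0r scale0r add0r mul1r.
Qed.

End Line.

Section Plane.
Variable R : realType.
Implicit Types (f g : 'rV[R]_2 -> R) (p q x y : 'rV[R]_2) (U : set 'rV[R]_2).

Lemma ball_rV2 p r y :
  ball p r y <-> `|p ord0 i1 - y ord0 i1| < r /\ `|p ord0 i2 - y ord0 i2| < r.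
Proof.
split => [[_ b]|[b1 b2]]; first by split; exact: b.
split; first exact: le_lt_trans b1.
by move=> i j; rewrite ord1; move: j; apply: forall_ord2.
Qed.

Lemma norm_rV2 p (r : R) :
  (`|p| < r) = (`|p ord0 i1| < r) && (`|p ord0 i2| < r).
Proof.
apply/idP/idP => [pr|/andP[p1 p2]].
  have : ball p r 0 by rewrite -ball_normE /= subr0.
  by move=> /ball_rV2; rewrite !mxE !subr0 => -[-> ->].
have : ball p r 0 by apply/ball_rV2; rewrite !mxE !subr0.
by rewrite -ball_normE /= subr0.
Qed.

Lemma coord_le_norm p i : `|p ord0 i| <= `|p|.
Proof.
move: i; apply: forall_ord2; rewrite leNgt; apply/negP.
  by rewrite norm_rV2 ltxx.
by rewrite norm_rV2 ltxx andbF.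
Qed.

Definition vec (a b : R) : 'rV[R]_2 := a *: e_ i1 + b *: e_ i2.

Lemma vecE a b : (vec a b ord0 i1 = a) * (vec a b ord0 i2 = b).
Proof. by split; rewrite !mxE /= ?mulr1 ?mulr0 ?addr0 ?add0r. Qed.

Lemma rV2P x y : x ord0 i1 = y ord0 i1 -> x ord0 i2 = y ord0 i2 -> x = y.
Proof. by move=> h1 h2; apply/rowP; exact: forall_ord2. Qed.

Lemma vec_eta x : x = vec (x ord0 i1) (x ord0 i2).
Proof. by apply: rV2P; rewrite vecE. Qed.

(** The norm is the sup norm, so a ball is a square with sides along the axes; it contains the
    corner of an axis-parallel path from [q] to [x], and each leg is a one-variable mean value
    theorem. *)
Lemma MVT_box f p r x q : ball p r x -> ball p r q ->
  (forall i z, ball p r z -> derivable f z (e_ i)) ->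
  exists z1 z2, [/\ ball p r z1, ball p r z2 &
   f x - f q = (x ord0 i1 - q ord0 i1) * partial i1 f z1 +
               (x ord0 i2 - q ord0 i2) * partial i2 f z2].
Proof.
move=> /[dup] bx /ball_rV2[x1 x2] /[dup] bq /ball_rV2[q1 q2] fd.
have conv (a b c s : R) : `|c - a| < r -> `|c - b| < r -> 0 <= s <= 1 ->
    `|c - (s * (a - b) + b)| < r.
  rewrite !ltr_norml => /andP[a1 a2] /andP[b1 b2] /andP[s0]; rewrite le_eqVlt.
  move=> /orP[/eqP ->|s1]; first by rewrite mul1r subrK a1.
  have P1 : 0 <= s * (c - a + r) by rewrite mulr_ge0 //; lra.
  have P2 : 0 <= s * (r - (c - a)) by rewrite mulr_ge0 //; lra.
  have P3 : 0 < (1 - s) * (c - b + r) by rewrite mulr_gt0 //; lra.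
  have P4 : 0 < (1 - s) * (r - (c - b)) by rewrite mulr_gt0 //; lra.
  by apply/andP; split; lra.
pose m := vec (x ord0 i1) (q ord0 i2).
pose a1 := x ord0 i1 - q ord0 i1; pose a2 := x ord0 i2 - q ord0 i2.
have mE : m = a1 *: e_ i1 + q.
  by apply: rV2P; rewrite vecE !mxE /= ?mulr1 ?mulr0 ?add0r // /a1 subrK.
have xE : x = a2 *: e_ i2 + m.
  by apply: rV2P; rewrite /m !mxE /= ?(mulr1, mulr0, addr0, add0r) // /a2 subrK.
have B1 s : 0 <= s <= 1 -> ball p r ((s * a1) *: e_ i1 + q).
  move=> s01; apply/ball_rV2; rewrite !mxE /= !mulr1 !mulr0 add0r; split=> //.
  exact: conv.
have B2 s : 0 <= s <= 1 -> ball p r ((s * a2) *: e_ i2 + m).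
  move=> s01; apply/ball_rV2; rewrite /m !mxE /= !(mulr1, mulr0, addr0, add0r).
  by split=> //; exact: conv.
have [s1 s1P E1] := MVT_line (fun s hs => fd i1 _ (B1 s hs)).
have [s2 s2P E2] := MVT_line (fun s hs => fd i2 _ (B2 s hs)).
exists ((s1 * a1) *: e_ i1 + q), ((s2 * a2) *: e_ i2 + m).
split; [exact: B1|exact: B2|].
by rewrite /partial -!/a1 -!/a2 -E1 -E2 -mE -xE [RHS]addrC addrA subrK.
Qed.

End Plane.

(** * Partial derivatives and closure properties of the classes C^k *)

Section SmoothFunctions.
Variables (R : realType) (n : nat).
Implicit Types (f g : 'rV[R]_n -> R) (U V : set 'rV[R]_n) (y : 'rV[R]_n).

Lemma near_eq_open U f g y : open U -> U y -> (forall z, U z -> f z = g z) ->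
  \forall z \near y, f z = g z.
Proof.
by move=> oU Uy fg; move: (open_nbhs_nbhs (conj oU Uy)); apply: filterS.
Qed.

Lemma partial_ext U f g i y : open U -> U y -> (forall z, U z -> f z = g z) ->
  partial i f y = partial i g y.
Proof. by move=> oU Uy fg; apply: near_eq_derive; exact: near_eq_open fg. Qed.

Lemma derivable_ext U f g v y : open U -> U y -> (forall z, U z -> f z = g z) ->
  derivable f y v -> derivable g y v.
Proof. by move=> oU Uy fg; apply: near_eq_derivable; exact: near_eq_open fg. Qed.

Lemma partialD i f g y : derivable f y (e_ i) -> derivable g y (e_ i) ->
  partial i (fun z => f z + g z) y = partial i f y + partial i g y.
Proof. exact: deriveD. Qed.

Lemma partialN i f y : derivable f y (e_ i) ->
  partial i (fun z => - f z) y = - partial i f y.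
Proof. exact: deriveN. Qed.

Lemma partialM i f g y : derivable f y (e_ i) -> derivable g y (e_ i) ->
  partial i (fun z => f z * g z) y = partial i f y * g y + f y * partial i g y.
Proof.
by move=> df dg; rewrite /partial (deriveM df dg) addrC mulrC.
Qed.

Lemma partialV i f y : derivable f y (e_ i) -> f y != 0 ->
  partial i (fun z => (f z)^-1) y = - (f y)^-1 * (f y)^-1 * partial i f y.
Proof.
by move=> df f0; rewrite /partial (deriveV f0 df) -exprVn expr2 [LHS]mulNr !mulNr.
Qed.

Lemma partial_cst i (c : R) y : partial i (fun=> c) y = 0.
Proof. exact: derive_cst. Qed.

Lemma is_derive_coord v y j :
  is_derive y v (fun z : 'rV[R]_n => z ord0 j) (v ord0 j).
Proof.
have dc : differentiable (fun z : 'rV[R]_n => z ord0 j) y by exact: differentiable_coord.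
split; first exact: diff_derivable.
apply: cvg_lim => //; apply: cvg_near_cst.
rewrite near_withinE; near=> h => h0 /=.
by rewrite !mxE addrK [_ *: _]mulrA mulVf // mul1r.
Unshelve. all: by end_near. Qed.

Lemma partial_coord i j y : partial i (fun z => z ord0 j) y = (j == i)%:R.
Proof. by rewrite /partial (@derive_val _ _ _ _ _ _ _ (is_derive_coord _ _ _)) mxE eqxx. Qed.

Lemma CkS k U f : Ck k.+1 U f -> Ck k U f.
Proof.
elim: k f => [|k IH] f; first by case.
move=> [cf df]; split=> // i; have [d1 d2] := df i; split=> //.
exact: IH d2.
Qed.

Lemma Ck_cont k U f : Ck k U f -> forall y, U y -> {for y, continuous f}.
Proof. by case: k => [|k] []. Qed.

Lemma Ck_sub k U V f : V `<=` U -> Ck k U f -> Ck k V f.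
Proof.
move=> VU; elim: k f => [|k IH] f [cf df]; split=> //; try by move=> y /VU /cf.
by move=> i; have [d1 d2] := df i; split; [move=> y /VU /d1|exact: IH].
Qed.

Lemma Ck_ext k U f g : open U -> (forall z, U z -> f z = g z) ->
  Ck k U f -> Ck k U g.
Proof.
move=> oU; have ce f' g' : (forall z, U z -> f' z = g' z) ->
   (forall y, U y -> {for y, continuous f'}) ->
   forall y, U y -> {for y, continuous g'}.
  move=> fg cf y Uy; have := cf y Uy; rewrite /prop_for /continuous_at (fg _ Uy).
  have E : {near nbhs y, f' =1 g'}.
    by exact: (near_eq_open oU Uy fg).
  exact: cvg_trans (near_eq_cvg E).
elim: k f g => [|k IH] f g fg [cf df]; split=> //; try exact: ce cf.
move=> i; have [d1 d2] := df i; split.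
  by move=> y Uy; apply: (derivable_ext oU Uy fg); exact: d1.
by apply: IH d2 => z Uz; exact: partial_ext fg.
Qed.

Lemma Ck_cst k U (c : R) : Ck k U (fun=> c).
Proof.
have cc (c' : R) y : U y -> {for y, continuous (fun=> c' : R)}.
  by move=> _; exact: cst_continuous.
elim: k c => [|k IH] c; split; [exact: cc|by []|exact: cc|].
move=> i; split; first by move=> y _; exact: derivable_cst.
rewrite (_ : partial i _ = fun=> 0) //.
by apply/funext => y; rewrite partial_cst.
Qed.

Lemma CkD k U f g : open U -> Ck k U f -> Ck k U g -> Ck k U (fun z => f z + g z).
Proof.
move=> oU; have cD f' g' : (forall y, U y -> {for y, continuous f'}) ->
    (forall y, U y -> {for y, continuous g'}) ->
    forall y, U y -> {for y, continuous (fun z => f' z + g' z)}.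
  by move=> cf cg y Uy; exact: (continuousD (cf y Uy) (cg y Uy)).
elim: k f g => [|k IH] f g [cf df] [cg dg]; split; [exact: cD|by []|exact: cD|].
move=> i; have [d1 d2] := df i; have [d3 d4] := dg i; split.
  by move=> y Uy; apply: derivableD; [exact: d1|exact: d3].
apply: Ck_ext (IH _ _ d2 d4) => // z Uz.
by rewrite partialD //; [exact: d1|exact: d3].
Qed.

Lemma CkN k U f : open U -> Ck k U f -> Ck k U (fun z => - f z).
Proof.
move=> oU; have cN f' : (forall y, U y -> {for y, continuous f'}) ->
    forall y, U y -> {for y, continuous (fun z => - f' z)}.
  by move=> cf y Uy; exact: (continuousN (cf y Uy)).
elim: k f => [|k IH] f [cf df]; split; [exact: cN|by []|exact: cN|].
move=> i; have [d1 d2] := df i; split.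
  by move=> y Uy; apply: derivableN; exact: d1.
apply: Ck_ext (IH _ d2) => // z Uz.
by rewrite partialN //; exact: d1.
Qed.

Lemma CkM k U f g : open U -> Ck k U f -> Ck k U g -> Ck k U (fun z => f z * g z).
Proof.
move=> oU; have cM f' g' : (forall y, U y -> {for y, continuous f'}) ->
    (forall y, U y -> {for y, continuous g'}) ->
    forall y, U y -> {for y, continuous (fun z => f' z * g' z)}.
  by move=> cf cg y Uy; exact: (continuousM (cf y Uy) (cg y Uy)).
elim: k f g => [|k IH] f g F G; have [cf df] := F; have [cg dg] := G.
  by split; first exact: cM.
split; first exact: cM.
move=> i; have [d1 d2] := df i; have [d3 d4] := dg i; split.
  by move=> y Uy; apply: derivableM; [exact: d1|exact: d3].
apply: Ck_ext (CkD oU (IH _ _ d2 (CkS G)) (IH _ _ (CkS F) d4)) => // z Uz.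
by rewrite partialM //; [exact: d1|exact: d3].
Qed.

Lemma CkV k U f : open U -> (forall y, U y -> f y != 0) ->
  Ck k U f -> Ck k U (fun z => (f z)^-1).
Proof.
move=> oU f0; have cV : (forall y, U y -> {for y, continuous f}) ->
    forall y, U y -> {for y, continuous (fun z => (f z)^-1)}.
  by move=> cf y Uy; exact: (continuousV (f0 y Uy) (cf y Uy)).
elim: k => [|k IH] F; have [cf df] := F.
  by split; first exact: cV.
split; first exact: cV.
move=> i; have [d1 d2] := df i; split.
  by move=> y Uy; apply: derivableV; [exact: f0|exact: d1].
have IF := IH (CkS F).
apply: Ck_ext (CkM oU (CkM oU (CkN oU IF) IF) d2) => // z Uz.
by rewrite partialV //; [exact: d1|exact: f0].
Qed.

End SmoothFunctions.

(** * Chain rule, square roots and symmetry of second derivatives *)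

Section Chain.
Variable R : realType.

Lemma near_dist n (f : 'rV[R]_n -> R) p (e : R) : {for p, continuous f} -> 0 < e ->
  \forall z \near p, `|f p - f z| < e.
Proof. by move=> /cvgrPdist_lt cf e0; exact: cf. Qed.

Lemma half_distE (a b c : R) :
  `|a - c| < `|a - b| / 2 -> `|b - c| < `|a - b| / 2 -> False.
Proof.
move=> ac bc; have := ler_normB (a - c) (b - c).
by rewrite (_ : a - c - (b - c) = a - b); [lra|ring].
Qed.

Lemma near_ball n (p : 'rV[R]_n) (P : set 'rV[R]_n) :
  nbhs p P -> exists2 r : R, 0 < r & ball p r `<=` P.
Proof. by rewrite -nbhs_ballE. Qed.

Lemma derive_line0 n (W : normedModType R) (f : 'rV[R]_n -> W) (y v : 'rV[R]_n) :
  'D_v f y = 'D_1 (fun s : R => f (s *: v + y)) 0.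
Proof.
rewrite /derive.
have -> // : (fun h : R => h^-1 *: ((f \o shift y) (h *: v) - f y)) =
  (fun h : R => h^-1 *: (((fun s : R => f (s *: v + y)) \o shift 0) (h *: 1) - f (0 *: v + y))).
by apply/funext => h /=; rewrite addr0 scale0r add0r [_%:A]mulr1.
Qed.

Lemma is_derive_comp_left n (phi : R -> R) (f : 'rV[R]_n -> R) (y v : 'rV[R]_n) (dphi : R) :
  derivable f y v -> is_derive (f y) 1 phi dphi ->
  is_derive y v (fun z => phi (f z)) (dphi * 'D_v f y).
Proof.
move=> df dp; pose L (s : R) := f (s *: v + y).
have L0 : L 0 = f y by rewrite /L scale0r add0r.
have dL : derivable L 0 1 by exact: (derivable1P f y v).1 df.
have dpL : derivable phi (L 0) 1 by rewrite L0; exact: ex_derive.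
have D : derivable (phi \o L) 0 1.
  exact: (derivable1_diffP _ _).2 (differentiable_comp ((derivable1_diffP _ _).1 dL)
    ((derivable1_diffP _ _).1 dpL)).
split; first exact: (derivable1P (fun z => phi (f z)) y v).2 D.
rewrite derive_line0 -[LHS]/('D_1 (phi \o L) 0) -derive1E (derive1_comp dL dpL).
by rewrite !derive1E L0 (@derive_val _ _ _ _ _ _ _ dp) (derive_line0 f).
Qed.

Lemma Ck_sqrt n k (U : set 'rV[R]_n) (f : 'rV[R]_n -> R) : open U ->
  (forall y, U y -> 0 < f y) -> Ck k U f -> Ck k U (fun z => Num.sqrt (f z)).
Proof.
move=> oU f0; have cS : (forall y, U y -> {for y, continuous f}) ->
    forall y, U y -> {for y, continuous (fun z => Num.sqrt (f z))}.
  move=> cf y Uy; apply: (@continuous_comp _ _ _ f Num.sqrt y (cf y Uy)).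
  exact: sqrt_continuous.
elim: k => [|k IH] F; have [cf df] := F; first by split; first exact: cS.
have D i y : U y -> is_derive y (e_ i) (fun z => Num.sqrt (f z))
    ((2 * Num.sqrt (f y))^-1 * partial i f y).
  move=> Uy; apply: is_derive_comp_left; first exact: (df i).1.
  exact/is_derive1_sqrt/f0.
split; first exact: cS.
move=> i; split; first by move=> y /(D i y) Dy; exact: ex_derive.
have s0 y : U y -> 2 * Num.sqrt (f y) != 0.
  by move=> Uy; rewrite mulf_neq0 // ?pnatr_eq0 // gt_eqF // sqrtr_gt0 f0.
have C := CkM oU (CkV oU s0 (CkM oU (Ck_cst k U 2) (IH (CkS F)))) (df i).2.
apply: Ck_ext C => // z Uz.
by rewrite /partial (@derive_val _ _ _ _ _ _ _ (D i z Uz)).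
Qed.

(** By [MVT_box] the error is a combination of increments of the two partial derivatives at nearby
    points, and continuity makes each at most [e / 2]. *)
Lemma Ck1_expansion (U : set 'rV[R]_2) (f : 'rV[R]_2 -> R) p (e : R) :
  open U -> U p -> Ck 1 U f -> 0 < e ->
  exists2 r : R, 0 < r & forall h, `|h| < r ->
    `|f (h + p) - f p - (h ord0 i1 * partial i1 f p + h ord0 i2 * partial i2 f p)|
      <= e * `|h|.
Proof.
move=> oU Up [cf df] e0.
have e2 : 0 < e / 2 by rewrite divr_gt0.
have N i : \forall z \near p, `|partial i f p - partial i f z| < e / 2.
  exact: near_dist ((df i).2.1 p Up) e2.
have NU : \forall z \near p, U z by exact: open_nbhs_nbhs.
have [r /= r0 rP] := near_ball (filterI NU (filterI (N i1) (N i2))).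
exists r => // h hr.
have bp : ball p r p by exact: ballxx.
have bh : ball p r (h + p).
  by rewrite -ball_normE /= opprD addrCA subrr addr0 normrN.
have [z1 [z2 [/rP[_ [b1 _]] /rP[_ [_ b2]] ->]]] := MVT_box bh bp
  (fun i z bz => (df i).1 z (rP z bz).1).
rewrite !mxE !addrK.
have ringE (a b c d c' d' : R) :
  a * c' + b * d' - (a * c + b * d) = - (a * (c - c') + b * (d - d')) by ring.
rewrite ringE normrN (le_trans (ler_normD _ _)) // !normrM.
rewrite [e]splitr mulrDl [_ * `|h|]mulrC.
by apply: lerD; apply: ler_pM; rewrite ?normr_ge0 ?coord_le_norm // ltW.
Qed.

Lemma Ck1_differentiable (U : set 'rV[R]_2) (f : 'rV[R]_2 -> R) p :
  open U -> U p -> Ck 1 U f -> differentiable f p.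
Proof.
move=> oU Up Cf.
pose L (h : 'rV[R]_2) : R := h ord0 i1 * partial i1 f p + h ord0 i2 * partial i2 f p.
have lL : linear L.
  move=> a x y; rewrite /L !mxE.
  have lin (x1 y1 x2 y2 c1 c2 : R) : (a * x1 + y1) * c1 + (a * x2 + y2) * c2 =
     a * (x1 * c1 + x2 * c2) + (y1 * c1 + y2 * c2) by ring.
  exact: lin.
pose lLM := GRing.isLinear.Build _ _ _ _ _ lL.
pose Ll : {linear _ -> _} := HB.pack L lLM.
have cL : continuous Ll.
  move=> x; change ({for x, continuous L}).
  by apply: continuousD; apply: continuousM;
    [exact: coord_continuous|exact: cst_continuous|exact: coord_continuous|exact: cst_continuous].
have E : f \o shift p = cst (f p) + Ll +o_ (0 : 'rV[R]_2) id.
  apply/eqaddoP => _/posnumP[e].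
  have [r r0 rP] := Ck1_expansion oU Up Cf (gt0 e).
  have : \forall h \near (0 : 'rV[R]_2), `|h| < r by exact: nbhs0_lt.
  apply: filterS => h /rP hP.
  have -> : (f \o shift p - (cst (f p) + Ll)) h = f (h + p) - f p - L h.
    by rewrite -[LHS]/(f (h + p) - (f p + L h)) opprD addrA.
  exact: hP.
have dE := diff_unique cL E.
by apply/diff_locallyP; rewrite dE.
Qed.

(** Restricting the inner pair to the line through [y] along [v] gives a curve, to which the total
    differential of [f] is applied. *)
Lemma is_derive_comp2 n (U : set 'rV[R]_2) (f : 'rV[R]_2 -> R)
    (g1 g2 : 'rV[R]_n -> R) (y v : 'rV[R]_n) :
  open U -> Ck 1 U f -> U (vec (g1 y) (g2 y)) ->
  derivable g1 y v -> derivable g2 y v ->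
  is_derive y v (fun z => f (vec (g1 z) (g2 z)))
    (partial i1 f (vec (g1 y) (g2 y)) * 'D_v g1 y +
     partial i2 f (vec (g1 y) (g2 y)) * 'D_v g2 y).
Proof.
move=> oU Cf Uy d1 d2.
pose c (s : R) := vec (g1 (s *: v + y)) (g2 (s *: v + y)).
have c0 : c 0 = vec (g1 y) (g2 y) by rewrite /c scale0r add0r.
have dg (g : 'rV[R]_n -> R) : derivable g y v ->
  derivable (fun s : R => g (s *: v + y)) 0 1 by move=> dg; exact: (derivable1P g y v).1 dg.
have dc : derivable c 0 1.
  apply/derivable_mxP => i j; rewrite ord1; move: j; apply: forall_ord2.
    rewrite (_ : (fun _ => _) = (fun s : R => g1 (s *: v + y))); first exact: dg.
    by apply/funext => s; rewrite vecE.
  rewrite (_ : (fun _ => _) = (fun s : R => g2 (s *: v + y))); first exact: dg.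
  by apply/funext => s; rewrite vecE.
have Dc : 'D_1 c 0 = vec ('D_v g1 y) ('D_v g2 y).
  have Dj j : (fun s => c s ord0 j) = fun s : R => (if j == i1 then g1 else g2) (s *: v + y).
    by apply/funext => s; move: j; apply: forall_ord2; rewrite vecE.
  by rewrite (derive_mx dc); apply: rV2P; rewrite mxE Dj vecE derive_line0.
have df : differentiable f (c 0) by rewrite c0; exact: Ck1_differentiable Cf.
have dc' : differentiable c 0 by apply/derivable1_diffP.
have D : differentiable (f \o c) 0 by exact: differentiable_comp.
split.
  exact: (derivable1P (fun z => f (vec (g1 z) (g2 z))) y v).2 ((derivable1_diffP _ _).2 D).
rewrite derive_line0 -[LHS]/('D_1 (f \o c) 0) (deriveE _ D) diff_comp //=.
rewrite -(deriveE _ dc') Dc {1}/vec linearD !linearZ /= -!(deriveE _ df) c0.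
by rewrite mulrC [X in _ + X]mulrC.
Qed.

(** The induction keeps [f] general because the chain rule composes its partial derivatives with
    [g1] and [g2]; these are again smooth, whereas a fixed class C^k for [f] would drop. *)
Lemma Ck_comp n k (U : set 'rV[R]_2) (V : set 'rV[R]_n) (f : 'rV[R]_2 -> R)
    (g1 g2 : 'rV[R]_n -> R) :
  open U -> open V -> (forall y, V y -> U (vec (g1 y) (g2 y))) ->
  smooth U f -> Ck k V g1 -> Ck k V g2 ->
  Ck k V (fun y => f (vec (g1 y) (g2 y))).
Proof.
move=> oU oV VU; have cC f' : Ck 0 U f' -> Ck 0 V g1 -> Ck 0 V g2 ->
    forall y, V y -> {for y, continuous (fun y => f' (vec (g1 y) (g2 y)))}.
  move=> [cf _] [c1 _] [c2 _] y Vy.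
  apply: (@continuous_comp _ _ _ (fun y => vec (g1 y) (g2 y)) f' y); last first.
    exact: cf (VU _ Vy).
  apply: (@continuousD _ _ _ (fun y => g1 y *: e_ i1) (fun y => g2 y *: e_ i2)).
    by apply: continuousZr_tmp; exact: c1.
  by apply: continuousZr_tmp; exact: c2.
have C0 k' (g : 'rV[R]_n -> R) : Ck k' V g -> Ck 0 V g.
  by move=> /Ck_cont cg; split.
elim: k f => [|k IH] f sf C1 C2.
  by split=> //; apply: cC; first exact: (sf 0).
have [_ D1] := C1; have [_ D2] := C2.
split; first by apply: cC; [exact: (sf 0)|exact: C0 C1|exact: C0 C2].
have D i y : V y -> is_derive y (e_ i) (fun z => f (vec (g1 z) (g2 z)))
    (partial i1 f (vec (g1 y) (g2 y)) * partial i g1 y +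
     partial i2 f (vec (g1 y) (g2 y)) * partial i g2 y).
  move=> Vy; apply: (is_derive_comp2 oU (sf 1) (VU _ Vy)).
    exact: (D1 i).1.
  exact: (D2 i).1.
move=> i; split; first by move=> y /(D i y) Dy; exact: ex_derive.
have sp j : smooth U (partial j f) by move=> m; exact: ((sf m.+1).2 j).2.
have C := CkD oV (CkM oV (IH _ (sp i1) (CkS C1) (CkS C2)) (D1 i).2)
                 (CkM oV (IH _ (sp i2) (CkS C1) (CkS C2)) (D2 i).2).
apply: Ck_ext C => // z Vz.
by rewrite /partial (@derive_val _ _ _ _ _ _ _ (D i z Vz)).
Qed.

(** The second difference of [f] over a small square of side [h] does not depend on the order of the
    two steps, and equals [h ^+ 2] times either mixed derivative at some point of the ball. *)
Lemma partialC (U : set 'rV[R]_2) (f : 'rV[R]_2 -> R) p :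
  open U -> Ck 2 U f -> U p ->
  partial i2 (partial i1 f) p = partial i1 (partial i2 f) p.
Proof.
move=> oU Cf Up; have [cf df] := Cf.
have d1 i y : U y -> derivable f y (e_ i) by exact: (df i).1.
have d2 i j y : U y -> derivable (partial i f) y (e_ j) by exact: ((df i).2.2 j).1.
have c2 i j := ((df i).2.2 j).2.1 p Up.
have S (r : R) : 0 < r -> ball p r `<=` U -> exists z w, [/\ ball p r z, ball p r w &
    partial i2 (partial i1 f) z = partial i1 (partial i2 f) w].
  move=> r0 rU; pose h := r / 2.
  have h0 : 0 < h by rewrite /h divr_gt0.
  have hr : h < r by rewrite /h; lra.
  have B (a b : R) : 0 <= a <= 1 -> 0 <= b <= 1 ->
      ball p r ((a * h) *: e_ i1 + ((b * h) *: e_ i2 + p)).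
    move=> /andP[a0 a1] /andP[b0 b1]; apply/ball_rV2; rewrite !mxE /=.
    have X (t q : R) : 0 <= t -> t <= 1 -> `|q - (t * h + q)| < r.
      move=> t0 t1; rewrite opprD addrCA subrr addr0 normrN normrM !ger0_norm ?(ltW h0) //.
      by rewrite (le_lt_trans _ hr) // ler_piMl // ltW.
    by rewrite !(mulr1, mulr0, add0r); split; apply: X.
  have I0 : 0 <= (0 : R) <= 1 by rewrite lexx ler01.
  have I1 : 0 <= (1 : R) <= 1 by rewrite lexx ler01.
  (* [F] is the difference in direction [j]; the mean value theorem is applied to [F] in direction
     [i], then to [partial i f] in direction [j]. *)
  have mid (i j : 'I_2) (F := fun x => f (h *: e_ j + x) - f x) :
     (forall a b : R, 0 <= a <= 1 -> 0 <= b <= 1 ->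
       ball p r ((a * h) *: e_ i + ((b * h) *: e_ j + p))) ->
     exists2 z, ball p r z & F (h *: e_ i + p) - F p = h * (h * partial j (partial i f) z).
    move=> Bij.
    have DF s : 0 <= s <= 1 -> is_derive ((s * h) *: e_ i + p) (e_ i) F
      (partial i f (h *: e_ j + ((s * h) *: e_ i + p)) - partial i f ((s * h) *: e_ i + p)).
      move=> s01.
      have U0 : U ((s * h) *: e_ i + p).
        by apply: rU; have := Bij s 0 s01 I0; rewrite mul0r scale0r add0r.
      have U1 : U (h *: e_ j + ((s * h) *: e_ i + p)).
        by apply: rU; have := Bij s 1 s01 I1; rewrite mul1r addrCA.
      have DS : is_derive ((s * h) *: e_ i + p) (e_ i) (fun x => f (h *: e_ j + x))
           (partial i f (h *: e_ j + ((s * h) *: e_ i + p))).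
        have EE : (fun k : R => k^-1 *: (((fun x => f (h *: e_ j + x)) \o
              shift ((s * h) *: e_ i + p)) (k *: e_ i) -
            f (h *: e_ j + ((s * h) *: e_ i + p)))) =
            (fun k : R => k^-1 *: ((f \o shift (h *: e_ j + ((s * h) *: e_ i + p)))
             (k *: e_ i) - f (h *: e_ j + ((s * h) *: e_ i + p)))).
          by apply/funext => k /=; rewrite [k *: _ + (h *: _ + _)]addrCA.
        have := d1 i _ U1; rewrite /derivable -EE => Dd.
        split; first exact: Dd.
        by rewrite /partial /derive EE.
      have D0 := derivableP (d1 i _ U0).
      exact: is_deriveB.
    have [s s01 ->] := MVT_line (fun s s01 => @ex_derive _ _ _ _ _ _ _ (DF s s01)).
    rewrite (@derive_val _ _ _ _ _ _ _ (DF s s01)).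
    have d2' t : 0 <= t <= 1 ->
        derivable (partial i f) ((t * h) *: e_ j + ((s * h) *: e_ i + p)) (e_ j).
      by move=> t01; apply/d2/rU; rewrite addrCA; exact: Bij.
    have [t t01 ->] := MVT_line d2'.
    exists ((t * h) *: e_ j + ((s * h) *: e_ i + p)); last by [].
    by rewrite addrCA; exact: Bij.
  have [z bz Ez] := mid i1 i2 B.
  have [|w bw Ew] := mid i2 i1.
    by move=> a b a01 b01; rewrite addrCA; exact: B.
  have hn : h != 0 by rewrite gt_eqF.
  have hK (a b : R) : h * (h * a) = h * (h * b) -> a = b by move=> /(mulfI hn) /(mulfI hn).
  exists z, w; split; [exact: bz|exact: bw|apply: hK].
  have Eh : h *: e_ i1 + (h *: e_ i2 + p) = h *: e_ i2 + (h *: e_ i1 + p) by exact: addrCA.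
  apply: etrans (esym Ez) _; apply: etrans _ Ew; rewrite Eh.
  have fourE (a b c e : R) : a - b - (c - e) = a - c - (b - e) by ring.
  exact: fourE.
apply/eqP/negPn/negP => ne.
set A := partial i2 _ p in ne; set B := partial i1 _ p in ne.
(* If the two values differed, the common value found in a small ball would be closer to each than
   half their distance. *)
have e0 : 0 < `|A - B| / 2 by rewrite divr_gt0 // normr_gt0 subr_eq0.
have N1 := near_dist (c2 i1 i2) e0.
have N2 := near_dist (c2 i2 i1) e0.
have NU : \forall z \near p, U z by exact: open_nbhs_nbhs.
have [r /= r0 rP] := near_ball (filterI NU (filterI N1 N2)).
have [z [w [/rP[_ [h1 _]] /rP[_ [_ h2]] E]]] := S r r0 (fun z bz => (rP z bz).1).
by apply: (half_distE (a := A) (b := B) (c := partial i2 (partial i1 f) z) h1); rewrite E; exact: h2.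
Qed.

End Chain.

(** * The inverse function theorem in the plane *)

(** Joins completeness with the normed structure, so that the contraction theorem applies to the
    plane. *)
HB.instance Definition _ (R : realType) (m n : nat) := Complete.on 'M[R]_(m.+1, n.+1).

Section Inverse.
Variable R : realType.

Lemma cramer2 (a b c d x y : R) : a * d - b * c != 0 ->
  d * x - b * y = 0 -> a * y - c * x = 0 -> x = 0 /\ y = 0.
Proof.
move=> D0 e1 e2; split; apply: (mulfI D0); rewrite mulr0.
  transitivity (a * (d * x - b * y) + b * (a * y - c * x)); first by ring.
  by rewrite e1 e2 !mulr0 addr0.
transitivity (c * (d * x - b * y) + d * (a * y - c * x)); first by ring.
by rewrite e1 e2 !mulr0 addr0.
Qed.

Lemma norm_lin_le (x1 x2 a1 a2 M : R) : `|x1| <= M -> `|x2| <= M ->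
  `|a1| <= 4^-1 -> `|a2| <= 4^-1 -> `|x1 * a1 + x2 * a2| <= 2^-1 * M.
Proof.
move=> h1 h2 h3 h4; apply: le_trans (ler_normD _ _) _; rewrite !normrM.
have -> : 2^-1 * M = M * 4^-1 + M * 4^-1 by field.
by apply: lerD; apply: ler_pM.
Qed.

Lemma dist_near n (f : 'rV[R]_n -> R) p :
  (forall e : R, 0 < e -> \forall z \near p, `|f p - f z| < e) -> {for p, continuous f}.
Proof.
by move=> H; apply: (@cvgrPdist_lt _ _ _ (nbhs p) _ f (f p)).2 => e /H.
Qed.

Lemma rVB n (x y : 'rV[R]_n) i : (x - y) ord0 i = x ord0 i - y ord0 i.
Proof. by rewrite !mxE. Qed.

Lemma norm_rV2_le (w : 'rV[R]_2) (r : R) :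
  `|w ord0 i1| <= r -> `|w ord0 i2| <= r -> `|w| <= r.
Proof.
move=> w1 w2; apply/ler_addgt0Pr => e e0; apply: ltW; rewrite norm_rV2.
by apply/andP; split; [apply: le_lt_trans w1 _|apply: le_lt_trans w2 _]; rewrite ltrDl.
Qed.

Lemma contraction_ball_fixed_point (X : completeNormedModType R) (T : X -> X) (p : X) (r q : R) :
  0 <= r -> 0 <= q -> q < 1 ->
  (forall x, `|p - x| <= r -> `|p - T x| <= r) ->
  (forall x y, `|p - x| <= r -> `|p - y| <= r -> `|T x - T y| <= q * `|x - y|) ->
  exists2 z, `|p - z| <= r & z = T z.
Proof.
move=> r0 q0 q1 TC Tq.
pose C : set X := closed_ball_ Num.Def.normr p r.
have TCC : {homo T : x / C x >-> C x} by move=> x; exact: TC.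
have cT : is_contraction (mkfun_fun TCC).
  by exists (NngNum q0); split=> // -[x y] [Cx Cy]; exact: Tq.
have [||z Cz E] := banach_fixed_point cT.
- exact: closed_closed_ball_.
- by exists p; rewrite /C /closed_ball_ /= subrr normr0.
by exists z.
Qed.

Variables (U : set 'rV[R]_2) (Y : 'I_2 -> 'rV[R]_2 -> R) (p : 'rV[R]_2).
Hypotheses (oU : open U) (Up : U p) (sY : forall i, smooth U (Y i)).
Let J i j x := partial j (Y i) x.
Let D x := J i1 i1 x * J i2 i2 x - J i1 i2 x * J i2 i1 x.
Hypothesis D0 : D p != 0.
Let F x := vec (Y i1 x) (Y i2 x).

(* [N x w] is the inverse of the Jacobian matrix at [x] applied to [w]. *)
Let N x (w : 'rV[R]_2) : 'rV[R]_2 :=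
  vec ((J i2 i2 x * w ord0 i1 - J i1 i2 x * w ord0 i2) / D x)
      ((J i1 i1 x * w ord0 i2 - J i2 i1 x * w ord0 i1) / D x).
(** The Newton map with the Jacobian frozen at [p]: [F x = w] means that [x] is a fixed point of
    [fun x => h x + N p w], and the derivative of [h] vanishes at [p]. *)
Let h x := x - N p (F x).

Let sJ i j : smooth U (J i j).
Proof. by move=> k; exact: ((sY i k.+1).2 j).2. Qed.

Let sD : smooth U D.
Proof.
by move=> k; apply: CkD => //; [|apply: CkN => //]; apply: CkM => //; exact: sJ.
Qed.

Let NB (x v w : 'rV[R]_2) : N x (v - w) = N x v - N x w.
Proof. by apply: rV2P; rewrite rVB !vecE !rVB -mulrBl; congr (_ / _); ring. Qed.

Let NZ (x w : 'rV[R]_2) (t : R) : N x (t *: w) = t *: N x w.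
Proof.
have rVZ (u : 'rV[R]_2) i : (t *: u) ord0 i = t * u ord0 i by rewrite mxE.
by apply: rV2P; rewrite rVZ !vecE !rVZ [in RHS]mulrA; congr (_ / _); rewrite mulrBr !(mulrCA t).
Qed.

Let NJ (x v : 'rV[R]_2) : D x != 0 ->
  N x (vec (v ord0 i1 * J i1 i1 x + v ord0 i2 * J i1 i2 x)
           (v ord0 i1 * J i2 i1 x + v ord0 i2 * J i2 i2 x)) = v.
Proof.
move=> Dx; apply: rV2P; rewrite !vecE; apply: (mulIf Dx); rewrite divfK //.
  rewrite /D; move: (J i1 i1 x) (J i1 i2 x) (J i2 i1 x) (J i2 i2 x) (v ord0 i1) (v ord0 i2).
  by move=> a b c d v1 v2; ring.
rewrite /D; move: (J i1 i1 x) (J i1 i2 x) (J i2 i1 x) (J i2 i2 x) (v ord0 i1) (v ord0 i2).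
by move=> a b c d v1 v2; ring.
Qed.

Let N_inj w : N p w = 0 -> w = 0.
Proof.
move=> Nw.
have N0 i : N p w ord0 i * D p = 0 by rewrite Nw mxE mul0r.
have [] := cramer2 D0 (x := w ord0 i1) (y := w ord0 i2).
- by rewrite -(N0 i1) vecE divfK.
- by rewrite -(N0 i2) vecE divfK.
by move=> w1 w2; apply: rV2P; rewrite mxE.
Qed.

Let N_bound (x : 'rV[R]_2) : exists2 B : R, 0 < B & forall w, `|N x w| <= B * `|w|.
Proof.
pose b (i j : 'I_2) := `|J i j x| / `|D x|.
have b0 i j : 0 <= b i j by rewrite divr_ge0.
have est (i j k l : 'I_2) (w : 'rV[R]_2) (m m' : 'I_2) :
    `|(J i j x * w ord0 m - J k l x * w ord0 m') / D x| <= (b i j + b k l) * `|w|.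
  rewrite mulrBl (le_trans (ler_normB _ _)) // mulrDl /b.
  rewrite !normrM !normfV ![_ / _ * _]mulrAC.
  by apply: lerD; rewrite ler_wpM2r ?invr_ge0 // ler_wpM2l // coord_le_norm.
exists (b i2 i2 + b i1 i2 + (b i1 i1 + b i2 i1) + 1).
  by rewrite ltr_wpDl // !addr_ge0.
move=> w; apply: norm_rV2_le; rewrite vecE (le_trans (est _ _ _ _ _ _ _)) //;
  rewrite ler_wpM2r //.
  by rewrite -addrA lerDl !addr_ge0.
by rewrite addrAC lerDr !addr_ge0.
Qed.

(** The entries [a i j] of the Jacobian at [x], multiplied by the inverse Jacobian at [p], form the
    identity at [x = p]. Keeping each within [4^-1] of it makes the two terms of [MVT_box] add up to
    a factor [2^-1]. *)
Let h_contract : exists r : R, [/\ 0 < r, ball p r `<=` U,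
   forall x, ball p r x -> D x != 0 &
   forall x y, ball p r x -> ball p r y -> `|h x - h y| <= 2^-1 * `|x - y|].
Proof.
pose a (i j : 'I_2) (x : 'rV[R]_2) : R := N p (vec (J i1 j x) (J i2 j x)) ord0 i.
have ap i j : a i j p = (i == j)%:R.
  move: i j; apply: forall_ord2; apply: forall_ord2; rewrite /a !vecE /=.
  - by rewrite (mulrC (J i2 i2 p)) -/(D p) divff.
  - by rewrite (mulrC (J i2 i2 p)) subrr mul0r.
  - by rewrite (mulrC (J i1 i1 p)) subrr mul0r.
  - by rewrite (mulrC (J i2 i1 p)) -/(D p) divff.
have ca i j : {for p, continuous (a i j)}.
  have C : Ck 0 U (a i j).
    move: i; apply: forall_ord2.
      have C := CkM oU (CkD oU (CkM oU (Ck_cst 0 U (J i2 i2 p)) (sJ i1 j 0))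
        (CkN oU (CkM oU (Ck_cst 0 U (J i1 i2 p)) (sJ i2 j 0)))) (Ck_cst 0 U (D p)^-1).
      by apply: Ck_ext C => // z _; rewrite /a !vecE.
    have C := CkM oU (CkD oU (CkM oU (Ck_cst 0 U (J i1 i1 p)) (sJ i2 j 0))
        (CkN oU (CkM oU (Ck_cst 0 U (J i2 i1 p)) (sJ i1 j 0)))) (Ck_cst 0 U (D p)^-1).
    by apply: Ck_ext C => // z _; rewrite /a !vecE.
  exact: C.1.
have q0 : 0 < 4^-1 :> R by rewrite invr_gt0.
have na i j := near_dist (ca i j) q0.
have nD := near_dist ((sD 0).1 p Up) (e := `|D p|).
rewrite normr_gt0 in nD; have {}nD := nD D0.
have nU : \forall z \near p, U z by exact: open_nbhs_nbhs.
have [r r0 rP] := near_ball (filterI nU (filterI nD (filterI (filterI (na i1 i1) (na i1 i2))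
   (filterI (na i2 i1) (na i2 i2))))).
exists r; split=> //.
- by move=> x /rP[].
- move=> x /rP[_ [Dx _]]; apply/eqP => Dx0; move: Dx.
  by rewrite Dx0 subr0 ltxx.
move=> x y bx bY.
have dY i j z : ball p r z -> derivable (Y i) z (e_ j).
  by move=> /rP[Uz _]; exact: ((sY i 1).2 j).1.
have dh i : forall j z, ball p r z -> is_derive z (e_ j) (fun x => h x ord0 i)
    ((i == j)%:R - a i j z).
  move=> j z bz.
  have C : is_derive z (e_ j) (fun x : 'rV[R]_2 => x ord0 i) (i == j)%:R.
    by have := is_derive_coord (e_ j) z i; rewrite mxE eqxx.
  have DY k : is_derive z (e_ j) (Y k) (J k j z) by apply: derivableP; exact: dY.
  have DN : is_derive z (e_ j) (fun x => N p (F x) ord0 i) (a i j z).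
    have S (c1 c2 : R) k l : is_derive z (e_ j) (fun x => (c1 * Y k x - c2 * Y l x) / D p)
        ((c1 * J k j z - c2 * J l j z) / D p).
      have -> : (fun x => (c1 * Y k x - c2 * Y l x) / D p) =
         (D p)^-1 \*: ((c1 \*: Y k) - (c2 \*: Y l)).
        by apply/funext => u /=; rewrite mulrC.
      apply: is_derive_eq; rewrite mulrC; congr (_ * _).
    have -> : (fun x => N p (F x) ord0 i) = fun x => (if i == i1
      then (J i2 i2 p * Y i1 x - J i1 i2 p * Y i2 x) / D p
      else (J i1 i1 p * Y i2 x - J i2 i1 p * Y i1 x) / D p).
      by apply/funext => u; move: {C} i; apply: forall_ord2; rewrite !vecE.
    by move: {C} i; apply: forall_ord2; rewrite /a !vecE /=; exact: S.
  have -> : (fun x => h x ord0 i) = (fun x : 'rV[R]_2 => x ord0 i) - (fun x => N p (F x) ord0 i).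
    by apply/funext => u; exact: rVB.
  exact: is_deriveB.
have key i : `|h x ord0 i - h y ord0 i| <= 2^-1 * `|x - y|.
  have [z1 [z2 [b1 b2 ->]]] := MVT_box bx bY (fun j z bz => @ex_derive _ _ _ _ _ _ _ (dh i j z bz)).
  rewrite /partial !(@derive_val _ _ _ _ _ _ _ (dh i _ _ _)) // -!ap.
  have la j z : ball p r z -> `|a i j p - a i j z| <= 4^-1.
    move=> /rP[_ [_ [[A1 A2] [A3 A4]]]]; apply: ltW.
    by move: i j {dh}; apply: forall_ord2; apply: forall_ord2; [exact: A1|exact: A2|exact: A3|exact: A4].
  have c j : `|x ord0 j - y ord0 j| <= `|x - y|.
    by have := coord_le_norm (x - y) j; rewrite rVB.
  by apply: norm_lin_le; [exact: c|exact: c|exact: la|exact: la].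
by apply: norm_rV2_le; rewrite rVB; exact: key.
Qed.


(** Existence of preimages comes from the contraction, uniqueness and a Lipschitz bound for [Z] from
    [lip], the derivative of [Z] from the first-order expansion of [F], and smoothness from a
    bootstrap on the formula for that derivative. *)
Lemma inverse_function : exists (rho : R) (V : set 'rV[R]_2) (Z : 'rV[R]_2 -> 'rV[R]_2),
  [/\ 0 < rho, open V, V p, V `<=` U &
   [/\ forall x, V x -> ball (F p) rho (F x) /\ Z (F x) = x,
       forall w, ball (F p) rho w -> V (Z w) /\ F (Z w) = w &
       forall i, smooth (ball (F p) rho) (fun w => Z w ord0 i)]].
Proof.
have [r [r0 rU rD rh]] := h_contract.
have [B B0 BN] := N_bound p.
pose s := r / 2; have s0 : 0 < s by rewrite divr_gt0.
have sr : s < r by rewrite /s ltr_pdivrMr // ltr_pMr // ltr1n.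
have bs x : `|p - x| <= s -> ball p r x.
  by move=> xs; rewrite -ball_normE /=; exact: le_lt_trans sr.
(* For [w] this close to [F p], the correction [N p (w - F p)] is shorter than [s / 2]; the
   contraction supplies the other half, so the closed ball of radius [s] is mapped into itself. *)
pose rho := s / 2 / B.
have rho0 : 0 < rho by rewrite !divr_gt0.
have hE x w : F x = w -> x = h x + N p w by move=> <-; rewrite subrK.
have NF x w : x = h x + N p w -> F x = w.
  move=> E; apply/subr0_eq/N_inj; rewrite NB; apply/eqP; rewrite subr_eq0; apply/eqP.
  by move: E; rewrite /h -addrA => /eqP; rewrite addrC -subr_eq subrr eq_sym addrC subr_eq0 => /eqP.
have Nw w : ball (F p) rho w -> `|N p (w - F p)| < s / 2.
  rewrite -ball_normE /= => wr; apply: le_lt_trans (BN _) _.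
  by rewrite distrC mulrC -ltr_pdivlMr.
have distE x w : p - (h x + N p w) = h p - h x - N p (w - F p).
  rewrite NB; have {1}-> := hE p (F p) erefl.
  by rewrite opprD addrACA (opprB (N p w)).
have ex w : ball (F p) rho w -> exists x, `|p - x| < s /\ F x = w.
  move=> wr; have [||||x y|x xs E] := @contraction_ball_fixed_point _
     (fun x => h x + N p w) p s 2^-1.
  - exact: ltW.
  - by rewrite invr_ge0.
  - by rewrite invf_lt1 ?ltr1n.
  - move=> x xs; rewrite distE (le_trans (ler_normB _ _)) // [s]splitr lerD //; last first.
      exact/ltW/Nw.
    rewrite (le_trans (rh _ _ _ _)) //; [exact: ballxx|exact: bs|].
    by rewrite mulrC ler_pM2r // invr_gt0.
  - by move=> xs ys; rewrite opprD addrACA subrr addr0; apply: rh; exact: bs.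
  exists x; split; last exact: NF.
  rewrite E distE (le_lt_trans (ler_normB _ _)) // [s]splitr ler_ltD //; last exact: Nw.
  rewrite (le_trans (rh _ _ _ _)) //; [exact: ballxx|exact: bs|].
  by rewrite mulrC ler_pM2r // invr_gt0.
pose Z w := xget p [set x | `|p - x| < s /\ F x = w].
have ZP w : ball (F p) rho w -> `|p - Z w| < s /\ F (Z w) = w.
  by move=> /ex [x xP]; rewrite /Z; case: xgetP => [y -> //|/(_ x)].
pose V := [set x | `|p - x| < s /\ ball (F p) rho (F x)].
(* Since [x - y] is [h x - h y] plus [N p (F x - F y)] and [h] halves distances, half of the left
   side can be absorbed. *)
have lip x y : ball p r x -> ball p r y -> `|x - y| <= 2 * (B * `|F x - F y|).
  move=> bx bY; have := rh x y bx bY.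
  have : `|x - y| <= `|h x - h y| + B * `|F x - F y|.
    have -> : x - y = (h x - h y) + (N p (F x) - N p (F y)).
      by rewrite {1}(hE x (F x)) // {1}(hE y (F y)) // opprD addrACA.
    by apply: le_trans (ler_normD _ _) _; rewrite lerD2l -NB.
  by move: `|x - y| `|h x - h y| (B * _) => u v t; lra.
have inj x y : ball p r x -> ball p r y -> F x = F y -> x = y.
  move=> bx bY E; have := lip x y bx bY; rewrite E subrr normr0 !mulr0 normr_le0 subr_eq0.
  by move/eqP.
have cF x : U x -> {for x, continuous F}.
  move=> Ux; apply: (@continuousD _ _ _ (fun x => Y i1 x *: e_ i1) (fun x => Y i2 x *: e_ i2)).
    by apply: continuousZr_tmp; exact: (sY i1 0).1.
  by apply: continuousZr_tmp; exact: (sY i2 0).1.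
have oV : open V.
  rewrite openE => x [xs xF]; apply: filterI.
    have : nbhs x (ball p s).
      by apply: open_nbhs_nbhs; split; [exact: ball_open|rewrite -ball_normE].
    by apply: filterS => u; rewrite -ball_normE.
  apply: (cF x); first by apply/rU/bs/ltW.
  by apply: open_nbhs_nbhs; split; [exact: ball_open|].
exists rho, V, Z; split=> //.
- by rewrite /V /= subrr normr0; split=> //; exact: ballxx.
- by move=> x [xs _]; apply: rU; exact/bs/ltW.
split.
- move=> x [xs bx]; split=> //; have [zs E] := ZP _ bx.
  by apply: inj => //; [exact/bs/ltW|exact/bs/ltW].
- by move=> w /[dup] bw /ZP [zs E]; rewrite /V /= E.
set W := ball (F p) rho.
have oW : open W by exact: ball_open.
have Zb w : W w -> ball p r (Z w) by move=> /ZP[zs _]; exact/bs/ltW.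
have ZU w : W w -> U (Z w) by move=> /Zb /rU.
have Zlip w w' : W w -> W w' -> `|Z w - Z w'| <= 2 * B * `|w - w'|.
  move=> Ww Ww'; have := lip _ _ (Zb _ Ww) (Zb _ Ww').
  by rewrite (ZP _ Ww).2 (ZP _ Ww').2 mulrA.
have B20 : 0 < 2 * B by rewrite mulr_gt0.
have cZ j w : W w -> {for w, continuous (fun w => Z w ord0 j)}.
  move=> Ww; apply: dist_near => e e0.
  have e10 : 0 < e / (2 * B) by rewrite divr_gt0.
  have n1 : nbhs w W by exact: open_nbhs_nbhs.
  have n2 : nbhs w (ball w (e / (2 * B))).
    by apply: open_nbhs_nbhs; split; [exact: ball_open|exact: ballxx].
  apply: filterS (filterI n1 n2) => w' [Ww' bw'].
  rewrite -rVB; apply: le_lt_trans (coord_le_norm _ _) _.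
  apply: le_lt_trans (Zlip _ _ Ww Ww') _.
  by rewrite mulrC -ltr_pdivlMr //; move: bw'; rewrite -ball_normE.
(* The expansion of [F] at [z = Z w] is applied to the increment [Dl] of [Z]; the exact increment of
   [F] is [t *: e_ i], so applying the inverse Jacobian at [z] isolates the difference quotient. *)
have dZ w i j : W w -> is_derive w (e_ i) (fun w => Z w ord0 j) (N (Z w) (e_ i) ord0 j).
  move=> Ww; set z := Z w.
  have Dz : D z != 0 by apply: rD; exact: Zb.
  have [C C0 CN] := N_bound z.
  suff L : (fun t : R => t^-1 *: (((fun w => Z w ord0 j) \o shift w) (t *: e_ i) - z ord0 j))
       @ (0 : R)^' --> N z (e_ i) ord0 j.
    by split; [apply/cvg_ex; eexists; exact: L|exact: cvg_lim L].
  apply/cvgrPdist_le => e e0.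
  (* Compensates for the bound [C] of the inverse Jacobian at [z] and for the Lipschitz constant
     [2 * B] of [Z]. *)
  pose e' := e / C / (2 * B).
  have e'0 : 0 < e' by rewrite !divr_gt0.
  have [r1 r10 E1] := Ck1_expansion oU (ZU w Ww) (sY i1 1) e'0.
  have [r2 r20 E2] := Ck1_expansion oU (ZU w Ww) (sY i2 1) e'0.
  have [r3 r30 E3] := near_ball (open_nbhs_nbhs (conj oW Ww)).
  pose r4 := Num.min r3 (Num.min r1 r2 / (2 * B)).
  have r40 : 0 < r4 by rewrite lt_min r30 divr_gt0 // lt_min r10.
  rewrite near_withinE; have : \forall t \near (0 : R), `|t| < r4 by exact: nbhs0_lt.
  apply: filterS => t tr t0 /=.
  have tei : `|t *: e_ i : 'rV[R]_2| <= `|t|.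
    have X (b : bool) : `|t * b%:R| <= `|t| by case: b; rewrite ?mulr1 ?mulr0 ?normr0.
    by apply: norm_rV2_le; rewrite !mxE; exact: X.
  have Wt : W (t *: e_ i + w).
    apply: E3; rewrite -ball_normE /= opprD addrCA subrr addr0 normrN (le_lt_trans tei) //.
    by move: tr; rewrite lt_min => /andP[].
  pose Dl := Z (t *: e_ i + w) - z.
  have Dlt : `|Dl| <= 2 * B * `|t|.
    apply: le_trans (Zlip _ _ Wt Ww) _; rewrite addrK ler_pM2l //.
  have [Dl1 Dl2] : `|Dl| < r1 /\ `|Dl| < r2.
    move: tr; rewrite lt_min => /andP[_]; rewrite ltr_pdivlMr // mulrC => tr.
    by have := le_lt_trans Dlt tr; rewrite lt_min => /andP.
  have FD : F (Dl + z) - F z = t *: e_ i.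
    by rewrite subrK (ZP _ Wt).2 (ZP _ Ww).2 addrK.
  pose err := vec (Dl ord0 i1 * J i1 i1 z + Dl ord0 i2 * J i1 i2 z)
           (Dl ord0 i1 * J i2 i1 z + Dl ord0 i2 * J i2 i2 z) - t *: e_ i.
  have errb : `|err| <= e' * `|Dl|.
    have errE i' : err ord0 i' = Dl ord0 i1 * J i' i1 z + Dl ord0 i2 * J i' i2 z -
        (Y i' (Dl + z) - Y i' z).
      by rewrite /err -FD !rVB; move: i'; apply: forall_ord2; rewrite /F !vecE.
    by apply: norm_rV2_le; rewrite errE distrC; [exact: E1 Dl1|exact: E2 Dl2].
  have NE : N z err = Dl - t *: N z (e_ i).
    by rewrite /err NB NJ // NZ.
  have -> : N z (e_ i) ord0 j - t^-1 *: (Z (t *: e_ i + w) ord0 j - z ord0 j) =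
     - t^-1 * N z err ord0 j.
    have Dlj : Z (t *: e_ i + w) ord0 j - z ord0 j = Dl ord0 j by rewrite rVB.
    have E4 : N z err ord0 j = Dl ord0 j - t * N z (e_ i) ord0 j.
      by rewrite NE rVB; congr (_ - _); rewrite mxE.
    have alg (u v : R) : v - t^-1 * u = - t^-1 * (u - t * v) by field.
    by rewrite E4 -Dlj; exact: alg.
  rewrite normrM normrN normfV ler_pdivrMl ?normr_gt0 //.
  apply: le_trans (coord_le_norm _ _) _; apply: le_trans (CN _) _.
  rewrite mulrC -ler_pdivlMr //; apply: le_trans errb _.
  rewrite /e' mulrC -ler_pdivlMr; last by rewrite !divr_gt0.
  apply: le_trans Dlt _; rewrite le_eqVlt; apply/orP; left; apply/eqP.
  by field; rewrite !gt_eqF.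
(* Bootstrap: the partial derivatives of [Z] are rational in the Jacobian entries composed with [Z],
   so if [Z] is C^k then so are they. *)
have sZ k : forall j, Ck k W (fun w => Z w ord0 j).
  elim: k => [|k IH] j; first by split=> // w; exact: cZ.
  split; first by move=> w; exact: cZ.
  move=> i; split; first by move=> w Ww; exact: (@ex_derive _ _ _ _ _ _ _ (dZ w i j Ww)).
  have comp f : smooth U f -> Ck k W (fun w => f (Z w)).
    move=> sf; have C := Ck_comp oU oW _ sf (IH i1) (IH i2).
    by apply: Ck_ext (C _) => // w Ww; rewrite -vec_eta //; exact: ZU.
  have DV : Ck k W (fun w => (D (Z w))^-1).
    by apply: CkV (comp _ sD) => // w /Zb /rD.
  apply: (Ck_ext (f := fun w => N (Z w) (e_ i) ord0 j)) => //.
    by move=> w Ww; rewrite /partial (@derive_val _ _ _ _ _ _ _ (dZ w i j Ww)).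
  have cc := Ck_cst k W; have cJ a b := comp _ (sJ a b).
  pose v : 'rV[R]_2 := e_ i.
  have C1 := CkM oW (CkD oW (CkM oW (cJ i2 i2) (cc (v ord0 i1)))
     (CkN oW (CkM oW (cJ i1 i2) (cc (v ord0 i2))))) DV.
  have C2 := CkM oW (CkD oW (CkM oW (cJ i1 i1) (cc (v ord0 i2)))
     (CkN oW (CkM oW (cJ i2 i1) (cc (v ord0 i1))))) DV.
  have E1 : Ck k W (fun w => N (Z w) v ord0 i1).
    by apply: (Ck_ext oW _ C1) => w _; rewrite vecE.
  have E2 : Ck k W (fun w => N (Z w) v ord0 i2).
    by apply: (Ck_ext oW _ C2) => w _; rewrite vecE.
  by move: j; apply: forall_ord2.
by move=> i k; exact: sZ.
Qed.

End Inverse.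

(** * Local affine fields *)

(** Bundling the openness proof lets the type of smooth functions depend on the set alone and carry
    a ring structure. *)
Record open_set (R : realType) := OpenSet {
  open_carrier :> set 'rV[R]_2;
  open_carrierP : open open_carrier
}.

Section SmoothRing.
Variables (R : realType) (U : open_set R).
Let oU : open U := @open_carrierP R U.

Definition smooth_pred : {pred 'rV[R]_2 -> R} := [pred f | `[< smooth U f >]].

Lemma smooth_pred_subring : subring_closed smooth_pred.
Proof.
split=> [|f g|f g].
- by apply/asboolP => k; exact: Ck_cst.
- by move=> /asboolP sf /asboolP sg; apply/asboolP => k; apply: CkD => //; exact: CkN.
- by move=> /asboolP sf /asboolP sg; apply/asboolP => k; exact: CkM.
Qed.

HB.instance Definition _ := GRing.isSubringClosed.Build _ smooth_pred smooth_pred_subring.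

Record smooth_fun := SmoothFun { sfun :> 'rV[R]_2 -> R; _ : sfun \in smooth_pred }.
HB.instance Definition _ := [isSub for sfun].
HB.instance Definition _ := [Choice of smooth_fun by <:].
HB.instance Definition _ := [SubChoice_isSubComNzRing of smooth_fun by <:].

Lemma sfunP (f : smooth_fun) : smooth U f.
Proof. by case: f => f /= /asboolP. Qed.

Lemma smooth_trunc (f : 'rV[R]_2 -> R) : smooth U f -> f \_ U \in smooth_pred.
Proof.
move=> sf; apply/asboolP => k; apply: (Ck_ext oU _ (sf k)) => z Uz.
by rewrite patchE mem_set.
Qed.

(* Only the values on [U] matter; extending by [0] makes the equality of the
   ring the pointwise equality on [U]. *)
Fact trunc_subproof (f : 'rV[R]_2 -> R) : smooth U f ->
  {g : smooth_fun | forall y, (open_carrier U y -> g y = f y) /\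
                              (~ open_carrier U y -> g y = 0)}.
Proof.
move=> sf; exists (SmoothFun (smooth_trunc sf)) => y /=; rewrite patchE.
by split=> Uy; [rewrite mem_set|rewrite memNset].
Qed.

End SmoothRing.

(** Locked: only the values given by [truncE] and [trunc_out] are used. *)
HB.lock Definition trunc (R : realType) (U : open_set R) (f : 'rV[R]_2 -> R)
  (sf : smooth U f) : smooth_fun U := sval (trunc_subproof sf).

Section Derivations.
Variables (R : realType) (U : open_set R).
Let oU : open U := @open_carrierP R U.
Local Notation smooth_fun := (smooth_fun U).

Lemma truncE f (sf : smooth U f) y : open_carrier U y -> trunc sf y = f y.
Proof. by rewrite trunc.unlock; exact: (svalP (trunc_subproof sf) y).1. Qed.

Lemma trunc_out f (sf : smooth U f) y : ~ open_carrier U y -> trunc sf y = 0.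
Proof. by rewrite trunc.unlock; exact: (svalP (trunc_subproof sf) y).2. Qed.

Lemma smooth_partial (f : 'rV[R]_2 -> R) i : smooth U f -> smooth U (partial i f).
Proof. by move=> sf k; exact: ((sf k.+1).2 i).2. Qed.

End Derivations.

HB.lock Definition sderiv (R : realType) (U : open_set R) (i : 'I_2)
  (f : smooth_fun U) : smooth_fun U := trunc (smooth_partial i (sfunP f)).

Section DerivationTheory.
Variables (R : realType) (U : open_set R).
Let oU : open U := @open_carrierP R U.
Local Notation smooth_fun := (smooth_fun U).

Lemma sderivE i (f : smooth_fun) y :
  open_carrier U y -> sderiv i f y = partial i f y.
Proof. by rewrite sderiv.unlock; exact: truncE. Qed.

Lemma sderiv_out i (f : smooth_fun) y : ~ open_carrier U y -> sderiv i f y = 0.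
Proof. by rewrite sderiv.unlock; exact: trunc_out. Qed.

Lemma sfunD (f g : smooth_fun) y : (f + g) y = f y + g y. Proof. by []. Qed.
Lemma sfunN (f : smooth_fun) y : (- f) y = - f y. Proof. by []. Qed.
Lemma sfunB (f g : smooth_fun) y : (f - g) y = f y - g y. Proof. by []. Qed.
Lemma sfunM (f g : smooth_fun) y : (f * g) y = f y * g y. Proof. by []. Qed.
Lemma sfun0 y : (0 : smooth_fun) y = 0. Proof. by []. Qed.
Lemma sfun1 y : (1 : smooth_fun) y = 1. Proof. by []. Qed.
Definition sfunE := (sfunD, sfunN, sfunB, sfunM, sfun0, sfun1).

Lemma sfun_derivable (f : smooth_fun) y i : open_carrier U y -> derivable f y (e_ i).
Proof. by move=> Uy; exact: ((sfunP f 1).2 i).1. Qed.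

Lemma sfun_eq (f g : smooth_fun) : (forall y, open_carrier U y -> f y = g y) ->
  (forall y, ~ open_carrier U y -> f y = g y) -> f = g.
Proof.
move=> h1 h2; apply/val_inj/funext => y.
by have [/h1|/h2] := pselect (open_carrier U y).
Qed.

Lemma sderivD i : {morph @sderiv R U i : f g / f + g}.
Proof.
move=> f g; apply: sfun_eq => y Uy; rewrite sfunD; last by rewrite !sderiv_out // addr0.
by rewrite !sderivE // -partialD //; exact: sfun_derivable.
Qed.

Lemma sderivM i (f g : smooth_fun) : sderiv i (f * g) = sderiv i f * g + f * sderiv i g.
Proof.
apply: sfun_eq => y Uy; rewrite !sfunE; last by rewrite !sderiv_out // mul0r mulr0 addr0.
by rewrite !sderivE // -partialM //; exact: sfun_derivable.
Qed.

Lemma sderivC (f : smooth_fun) : sderiv i2 (sderiv i1 f) = sderiv i1 (sderiv i2 f).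
Proof.
apply: sfun_eq => y Uy; last first.
  exact: etrans (sderiv_out i2 (sderiv i1 f) Uy) (esym (sderiv_out i1 (sderiv i2 f) Uy)).
have E i j : partial i (sderiv j f) y = partial i (partial j f) y.
  by apply: (partial_ext _ oU Uy) => z Uz; exact: sderivE.
rewrite (sderivE i2 (sderiv i1 f) Uy) (sderivE i1 (sderiv i2 f) Uy) !E.
exact: (partialC oU (sfunP f 2) Uy).
Qed.

End DerivationTheory.

(** * Affine fields on an open set and their derivative at a zero *)

Section LocalFields.
Variables (R : realType) (U : open_set R).
Let oU : open U := @open_carrierP R U.
Let K : comNzRingType := smooth_fun U.
Let d : 'I_2 -> K -> K := @sderiv R U.
Variable G : 'I_2 -> 'I_2 -> 'I_2 -> 'rV[R]_2 -> R.
Hypothesis sG : forall j r s, smooth U (G j r s).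
Hypothesis Gsym : forall j r s y, open_carrier U y -> G j r s y = G j s r y.

Definition conn j r s : K := trunc (sG j r s).

Lemma connC j r s : conn j r s = conn j s r.
Proof.
by apply: sfun_eq => y Uy; [rewrite !truncE // Gsym|rewrite !trunc_out].
Qed.

Definition affine_field (f : 'I_2 -> K) := forall i r s, affE d conn f i r s = 0.

Lemma dconnE i j r s y : open_carrier U y -> d i (conn j r s) y = partial i (G j r s) y.
Proof.
move=> Uy; rewrite sderivE //; apply: (partial_ext _ oU Uy) => z Uz; exact: truncE.
Qed.

Lemma ddE i j (f : K) y : open_carrier U y -> d i (d j f) y = partial i (partial j f) y.
Proof.
move=> Uy; rewrite sderivE //; apply: (partial_ext _ oU Uy) => z Uz; exact: sderivE.
Qed.

Lemma affE_val (f : 'I_2 -> K) i r s y : open_carrier U y ->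
  (affE d conn f i r s : smooth_fun U) y = partial r (partial s (f i)) y +
  \sum_k (partial k (G i r s) y * f k y + G i k s y * partial r (f k) y
    + G i r k y * partial s (f k) y) - \sum_k partial k (f i) y * G k r s y.
Proof.
move=> Uy; rewrite /affE !sum_ord2 !sfunE !dconnE // !ddE // !truncE //.
by rewrite !sderivE.
Qed.

Lemma affine_fieldP (f : 'I_2 -> K) (eta : 'rV[R]_2 -> 'rV[R]_2) :
  (forall i y, open_carrier U y -> f i y = eta y ord0 i) ->
  (forall y, open_carrier U y -> forall i r s, infinitesimal_affine eta G i r s y) ->
  affine_field f.
Proof.
move=> fe E i r s; apply: sfun_eq => y Uy.
  have pE k j z : open_carrier U z -> partial k (fun z => eta z ord0 j) z = partial k (f j) z.
    by move=> Uz; apply: (partial_ext _ oU Uz) => z' Uz'; exact: esym (fe _ _ Uz').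
  have ppE : partial r (partial s (fun z => eta z ord0 i)) y = partial r (partial s (f i)) y.
    by apply: (partial_ext _ oU Uy) => z Uz; exact: pE.
  have := E y Uy i r s; rewrite /infinitesimal_affine ppE (affE_val f i r s Uy) sfun0 4!sum_ord2.
  rewrite (pE i1 i y Uy) (pE i2 i y Uy) (pE r i1 y Uy) (pE r i2 y Uy).
  rewrite (pE s i1 y Uy) (pE s i2 y Uy) -(fe i1 y Uy) -(fe i2 y Uy) => ->.
  exact: subrr.
rewrite sfun0 /affE !sum_ord2 !sfunE /d !sderiv_out //.
by rewrite /conn !trunc_out // !(mul0r, mulr0, addr0, subr0).
Qed.

Lemma curvE_val i s r k y : open_carrier U y ->
  (curvE d conn i s r k : smooth_fun U) y = curvature G i s r k y.
Proof.
move=> Uy; rewrite /curvE /curvature !sum_ord2 !sfunE !dconnE // !truncE //.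
Qed.

Lemma ricE_val i j y : open_carrier U y ->
  (ricE d conn i j : smooth_fun U) y = ricci G y i j.
Proof.
move=> Uy; rewrite /ricci mxE sum_ord2 -!curvE_val // -sfunD.
by congr (sfun _ y); exact: sum_ord2.
Qed.

(** At a zero of [f] the Lie derivative of the Ricci tensor loses its transport term; what remains
    says that the derivative of [f] is skew for the symmetric part. *)
Lemma affine_field_skew (f : 'I_2 -> K) y : open_carrier U y -> affine_field f ->
  (forall i, f i y = 0) ->
  forall i j, \sum_k (ricci_sym G y k j * partial i (f k) y +
                      ricci_sym G y i k * partial j (f k) y) = 0.
Proof.
move=> Uy af f0.
have L i j : \sum_k (ricci G y k j * partial i (f k) y + ricci G y i k * partial j (f k) y) = 0.
  have := lieRic_eq0 (@sderivD R U) (@sderivM R U) (@sderivC R U) connC af i j.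
  move/(congr1 (fun g : smooth_fun U => g y)); rewrite /lieRic sum_ord2 !(sfunD, sfunM) sfun0.
  rewrite !(ricE_val _ _ Uy) sum_ord2.
  rewrite !(sderivE _ (f _) Uy) !f0 !mul0r !add0r => <-; ring.
have gE i j : ricci_sym G y i j = 2^-1 * (ricci G y i j + ricci G y j i) by rewrite mxE.
move=> i j; have := L i j; have := L j i; rewrite 3!sum_ord2 4!gE.
set a := ricci G y. move: (a i1 i) (a i1 j) (a i2 i) (a i2 j) (a i i1) (a i i2) (a j i1) (a j i2).
move: (partial i (f i1) y) (partial i (f i2) y) (partial j (f i1) y) (partial j (f i2) y).
move=> b1 b2 b3 b4 a1 a2 a3 a4 a5 a6 a7 a8 h1 h2.
transitivity (2^-1 * ((a2 * b1 + a5 * b3 + (a4 * b2 + a6 * b4)) + (a1 * b3 + a7 * b1 + (a3 * b4 + a8 * b2)))).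
  by field.
by rewrite h2 h1 addr0 mulr0.
Qed.


(** Lowering an index with the non-degenerate form turns a skew derivative into an antisymmetric
    matrix, which has a single free entry; the last hypothesis makes that entry zero. *)
Lemma affine_field_jet0 (f : 'I_2 -> K) y : open_carrier U y -> affine_field f ->
  ricci_sym G y \in unitmx -> (forall i, f i y = 0) ->
  \sum_k (ricci_sym G y i2 k * partial i1 (f k) y -
          ricci_sym G y i1 k * partial i2 (f k) y) = 0 ->
  forall i j, partial j (f i) y = 0.
Proof.
move=> Uy af gu f0; have S := affine_field_skew Uy af f0.
have gC i j : ricci_sym G y i j = ricci_sym G y j i by rewrite !mxE addrC.
have det0 : ricci_sym G y i1 i1 * ricci_sym G y i2 i2 -
    ricci_sym G y i1 i2 * ricci_sym G y i2 i1 != 0.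
  move: gu; rewrite unitmxE unitfE (expand_det_row _ ord0) sum_ord2 /cofactor !det_mx11 !mxE.
  have -> : lift (ord0 : 'I_2) (0 : 'I_1) = i2 by apply/val_inj.
  have -> : lift (i2 : 'I_2) (0 : 'I_1) = i1 by apply/val_inj.
  by rewrite /= expr0 expr1 mul1r mulN1r mulrN.
rewrite sum_ord2; have := S i1 i1; have := S i1 i2; have := S i2 i2; clear S gu.
rewrite 3!sum_ord2; move: (ricci_sym G y) gC det0 => g gC.
move: (g i1 i1) (g i1 i2) (g i2 i1) (g i2 i2) (gC i2 i1).
move=> a b b' c -> det0 h22 h12 h11 ht.
suff [[h1 h2] [h3 h4]] : (partial i1 (f i1) y = 0 /\ partial i1 (f i2) y = 0) /\
   (partial i2 (f i1) y = 0 /\ partial i2 (f i2) y = 0).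
  by apply: forall_ord2; apply: forall_ord2.
move: (partial i1 (f i1) y) (partial i1 (f i2) y) (partial i2 (f i1) y)
  (partial i2 (f i2) y) h22 h12 h11 ht => p q r s h22 h12 h11 ht.
(* The sum and difference of [h12] and [ht] decouple the equations into one system for [p], [q] and
   one for [r], [s], both with the symmetric Ricci matrix. *)
have D0 : c * a - (- b) * (- b) != 0 by rewrite mulrNN mulrC.
split.
  by have [||-> ->] := cramer2 (a := c) (b := - b) (c := - b) (d := a) D0 (x := p) (y := q);
    [lra|lra|].
by have [||-> ->] := cramer2 (a := c) (b := - b) (c := - b) (d := a) D0 (x := r) (y := s);
  [lra|lra|].
Qed.

End LocalFields.

(** * Local uniqueness of an affine field with given 1-jet *)

Section JetUniqueness.
Variable R : realType.

Lemma bounded_on_box (U : set 'rV[R]_2) (f : 'rV[R]_2 -> R) p r0 r :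
  (forall y, U y -> {for y, continuous f}) -> ball p r0 `<=` U -> 0 < r -> r < r0 ->
  exists2 M : R, 0 <= M & forall x, ball p r x -> `|f x| <= M.
Proof.
move=> cf bU r_gt0 rr.
pose A := [set v : 'rV[R]_2 | forall i,
  (fun i => `[p ord0 i - r, p ord0 i + r]%classic) i (v ord0 i)].
have cA : compact A by apply: rV_compact => i; exact: segment_compact.
have AU x : A x -> U x.
  move=> Ax; apply: bU; apply/ball_rV2; split.
    have := Ax i1; rewrite /= in_itv /= => /andP[h1 h2].
    by rewrite ltr_norml; apply/andP; split; lra.
  have := Ax i2; rewrite /= in_itv /= => /andP[h1 h2].
  by rewrite ltr_norml; apply/andP; split; lra.
have A0 : A !=set0.
  by exists p => i /=; rewrite in_itv /=; apply/andP; split; lra.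
have cn : {within A, continuous (fun x => `|f x|)}.
  apply: continuous_in_subspaceT => x; rewrite inE => /AU Ux.
  apply: (@continuous_comp _ _ _ f (@Num.norm _ R) x (cf x Ux)).
  exact: norm_continuous.
have [c cAc cM] := EVT_max_rV A0 cA cn.
exists `|f c|; first exact: normr_ge0.
move=> x /ball_rV2[]; rewrite !ltr_norml => /andP[h1 h2] /andP[h3 h4].
apply: cM; rewrite inE; apply: forall_ord2 => /=; rewrite in_itv /=; apply/andP; split; lra.
Qed.

Lemma le_sum (F : 'I_2 -> R) i : (forall i, 0 <= F i) -> F i <= \sum_i F i.
Proof. by move=> F0; rewrite (bigD1 i) //= lerDl sumr_ge0. Qed.

(** [D] stands for a second derivative and [t1] to [t8] for the products in an affine equation. The
    extra [1] makes the factor at least 1, so that the same bound also covers the first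
    derivatives. *)
Lemma sum8_le (D t1 t2 t3 t4 t5 t6 t7 t8 C N : R) : 0 <= N ->
  D + (t1 + t2 + t3 + (t4 + t5 + t6)) = t7 + t8 ->
  `|t1| <= C * N -> `|t2| <= C * N -> `|t3| <= C * N -> `|t4| <= C * N ->
  `|t5| <= C * N -> `|t6| <= C * N -> `|t7| <= C * N -> `|t8| <= C * N ->
  `|D| <= (8 * C + 1) * N.
Proof.
rewrite !ler_norml => ? ? /andP[? ?] /andP[? ?] /andP[? ?] /andP[? ?].
by move=> /andP[? ?] /andP[? ?] /andP[? ?] /andP[? ?]; apply/andP; split; lra.
Qed.

Lemma norm_sum_le (a b c e C1 C2 M : R) : `|a| <= C1 -> `|b| <= M -> `|c| <= C2 -> `|e| <= M ->
  `|a * b + c * e| <= (C1 + C2) * M.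
Proof.
move=> h1 h2 h3 h4; apply: le_trans (ler_normD _ _) _; rewrite !normrM mulrDl.
by apply: lerD; apply: ler_pM.
Qed.

Variables (U : open_set R).
Let oU : open U := @open_carrierP R U.
Let K : comNzRingType := smooth_fun U.
Variable G : 'I_2 -> 'I_2 -> 'I_2 -> 'rV[R]_2 -> R.
Hypothesis sG : forall j r s, smooth U (G j r s).
Hypothesis Gsym : forall j r s y, open_carrier U y -> G j r s y = G j s r y.

(* The equations express the derivatives of the 1-jet linearly through the
   1-jet, so on a small ball the sup norm of a 1-jet vanishing at a point is at
   most half of itself. *)
Lemma jet_uniqueness p : open_carrier U p -> exists r : R, [/\ 0 < r, ball p r `<=` U &
  forall f : 'I_2 -> K, affine_field sG f ->
  forall q, ball p r q -> (forall i, f i q = 0) -> (forall i j, partial j (f i) q = 0) ->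
  forall x i, ball p r x -> f i x = 0].
Proof.
move=> Up.
have [r0 r00 rU] := near_ball (open_nbhs_nbhs (conj oU Up)).
have r20 : 0 < r0 / 2 by rewrite divr_gt0.
have r2r : r0 / 2 < r0 by lra.
have bd (f : 'rV[R]_2 -> R) : smooth U f ->
    exists2 M : R, 0 <= M & forall x, ball p (r0 / 2) x -> `|f x| <= M.
  by move=> sf; apply: bounded_on_box rU r20 r2r => y Uy; exact: (sf 0).1.
have [C C0 [CG CdG]] : exists2 C : R, 0 <= C &
   (forall j r s x, ball p (r0 / 2) x -> `|G j r s x| <= C) /\
   (forall k j r s x, ball p (r0 / 2) x -> `|partial k (G j r s) x| <= C).
  pose M j r s := projT1 (cid2 (bd _ (sG j r s))).
  pose N k j r s := projT1 (cid2 (bd _ (smooth_partial k (sG j r s)))).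
  have M0 j r s : 0 <= M j r s by rewrite /M; case: cid2.
  have N0 k j r s : 0 <= N k j r s by rewrite /N; case: cid2.
  have MP j r s x : ball p (r0 / 2) x -> `|G j r s x| <= M j r s.
    by rewrite /M; case: cid2 => /= m _; apply.
  have NP k j r s x : ball p (r0 / 2) x -> `|partial k (G j r s) x| <= N k j r s.
    by rewrite /N; case: cid2 => /= m _; apply.
  (* A sum of non-negative bounds over all indices serves as a common bound. *)
  exists (\sum_j \sum_r \sum_s (M j r s + \sum_k N k j r s)).
    by do 3 (apply: sumr_ge0 => ? _); rewrite addr_ge0 // sumr_ge0.
  have S0 j r s : 0 <= M j r s + \sum_k N k j r s by rewrite addr_ge0 // sumr_ge0.
  have S1 j r s : M j r s + \sum_k N k j r s <= \sum_j \sum_r \sum_s (M j r s + \sum_k N k j r s).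
    apply: le_trans (@le_sum (fun s => M j r s + \sum_k N k j r s) s (S0 j r)) _.
    apply: le_trans (@le_sum (fun r => \sum_s (M j r s + \sum_k N k j r s)) r _) _.
      by move=> r'; apply: sumr_ge0.
    apply: (@le_sum (fun j => \sum_r \sum_s (M j r s + \sum_k N k j r s))).
    by move=> j'; do 2 (apply: sumr_ge0 => ? _).
  split=> [j r s x bx|k j r s x bx].
    by apply: le_trans (MP _ _ _ _ bx) _; apply: le_trans (S1 j r s); rewrite lerDl sumr_ge0.
  apply: le_trans (NP _ _ _ _ _ bx) _; apply: le_trans (S1 j r s).
  apply: le_trans (@le_sum (fun k => N k j r s) k _) _ => //.
  by rewrite lerDr.
pose C8 := 8 * C + 1.
have C80 : 0 < C8 by rewrite /C8; lra.
(* Two points of the ball differ by at most [2 * r] in each coordinate, so [MVT_box] bounds a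
   component by [4 * r * C8 * N], which is at most [N / 2]. *)
pose r := Num.min (r0 / 2) (8 * C8)^-1.
have r_gt0 : 0 < r by rewrite lt_min r20 invr_gt0 mulr_gt0.
have rr0 : r <= r0 / 2 by rewrite ge_min lexx.
have rC : r * (8 * C8) <= 1.
  by rewrite -ler_pdivlMr ?mulr_gt0 // div1r ge_min lexx orbT.
have bb : ball p r `<=` ball p (r0 / 2) by exact: le_ball.
have bU : ball p r `<=` U by move=> x bx; apply: rU; exact: le_ball (ltW r2r) _ (bb _ bx).
exists r; split=> // f af q bq f0 df0.
have sf i : smooth U (f i) by exact: sfunP.
have [M M0 MP] : exists2 M : R, 0 <= M & forall x, ball p r x ->
    (forall i, `|f i x| <= M) /\ (forall i j, `|partial j (f i) x| <= M).
  pose A i := projT1 (cid2 (bd _ (sf i))).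
  pose B i j := projT1 (cid2 (bd _ (smooth_partial j (sf i)))).
  have A0 i : 0 <= A i by rewrite /A; case: cid2.
  have B0 i j : 0 <= B i j by rewrite /B; case: cid2.
  have AP i x : ball p (r0 / 2) x -> `|f i x| <= A i.
    by rewrite /A; case: cid2 => /= m _; apply.
  have BP i j x : ball p (r0 / 2) x -> `|partial j (f i) x| <= B i j.
    by rewrite /B; case: cid2 => /= m _; apply.
  exists (\sum_i A i + \sum_i \sum_j B i j).
    by rewrite addr_ge0 // sumr_ge0 // => i _; exact: sumr_ge0.
  move=> x /bb bx; split=> [i|i j].
    apply: le_trans (AP i x bx) _; apply: le_trans (@le_sum A i A0) _.
    by rewrite lerDl sumr_ge0 // => i' _; exact: sumr_ge0.
  apply: le_trans (BP i j x bx) _; apply: le_trans (@le_sum (B i) j (B0 i)) _.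
  apply: le_trans (@le_sum (fun i => \sum_j B i j) i _) _.
    by move=> i'; exact: sumr_ge0.
  by rewrite lerDr sumr_ge0.
have half (N : R) : 0 <= N ->
  (forall x, ball p r x -> (forall i, `|f i x| <= N) /\ (forall i j, `|partial j (f i) x| <= N)) ->
  forall x, ball p r x -> (forall i, `|f i x| <= N / 2) /\ (forall i j, `|partial j (f i) x| <= N / 2).
  move=> N0 NP.
  have dd i a b x : ball p r x -> `|partial a (partial b (f i)) x| <= C8 * N.
    move=> bx; have [n1 n2] := NP x bx; have := af i a b.
    move/(congr1 (fun g : smooth_fun U => g x)); rewrite affE_val //; last exact: bU.
    rewrite sfun0 !sum_ord2 => /eqP; rewrite subr_eq0 => /eqP.
    have g j u v := CG j u v x (bb _ bx); have dg k j u v := CdG k j u v x (bb _ bx).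
    have pl (u v : R) : `|u| <= C -> `|v| <= N -> `|u * v| <= C * N.
      by move=> *; rewrite normrM; exact: ler_pM.
    have pr (u v : R) : `|u| <= C -> `|v| <= N -> `|v * u| <= C * N.
      by move=> *; rewrite mulrC; exact: pl.
    move=> E; apply: (sum8_le N0 E); try exact: pl; exact: pr.
  have step (g : 'rV[R]_2 -> R) x : smooth U g -> g q = 0 -> ball p r x ->
     (forall j z, ball p r z -> `|partial j g z| <= C8 * N) -> `|g x| <= N / 2.
    move=> sg gq bx gN.
    have [z1 [z2 [b1 b2]]] := MVT_box bx bq (fun j z bz => ((sg 1%N).2 j).1 z (bU z bz)).
    rewrite gq subr0 => ->.
    have d2 i : `|x ord0 i - q ord0 i| <= 2 * r.
      rewrite -rVB; apply: le_trans (coord_le_norm _ _) _.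
      rewrite -(subrK p x) -addrA; apply: le_trans (ler_normD _ _) _.
      move: bx bq; rewrite -!ball_normE /= => /ltW bx /ltW bq.
      by rewrite distrC mulr2n mulrDl mul1r lerD.
    apply: le_trans (norm_sum_le (d2 i1) (gN i1 z1 b1) (d2 i2) (gN i2 z2 b2)) _.
    have -> : (2 * r + 2 * r) * (C8 * N) = (r * (8 * C8)) * (N / 2) by field.
    by rewrite -[X in _ <= X]mul1r ler_wpM2r // divr_ge0.
  move=> x bx; split=> [i|i j].
    apply: step => // j z bz; apply: le_trans ((NP z bz).2 i j) _.
    by rewrite ler_peMl // /C8; lra.
  apply: step => //; first exact: smooth_partial.
  by move=> k z bz; exact: dd.
(* Iterating the halving gives a geometric bound on the 1-jet. *)
have pow n : forall x, ball p r x -> (forall i, `|f i x| <= M / 2 ^+ n) /\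
    (forall i j, `|partial j (f i) x| <= M / 2 ^+ n).
  elim: n => [|n IH]; first by rewrite expr0 divr1.
  rewrite exprSr invfM mulrA; apply: half => //.
  by rewrite divr_ge0 // exprn_ge0.
move=> x i bx; apply/eqP; rewrite -normr_le0; apply/ler_addgt0Pr => e e0.
rewrite add0r.
have [n nP] : exists n, M / 2 ^+ n < e.
  have [n Mn] : exists n : nat, M / e < n%:R.
    by exists (Num.bound (M / e)); apply: archi_boundP; rewrite divr_ge0 // ltW.
  exists n; rewrite ltr_pdivrMr ?exprn_gt0 // mulrC -ltr_pdivrMr //.
  apply: lt_le_trans Mn _; rewrite -natrX ler_nat; exact/ltnW/ltn_expl.
by apply: le_trans ((pow n x bx).1 i) (ltW nP).
Qed.

End JetUniqueness.

(** * Stereographic coordinates *)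

Section Coordinates.
Variable R : realType.
Implicit Types (x : 'I_2 -> 'rV[R]_2 -> R) (f g h : 'rV[R]_2 -> R) (V : set 'rV[R]_2).

Definition dir x f (y : 'rV[R]_2) : R := \sum_k x k y * partial k f y.

Definition br x (z : 'I_2 -> 'rV[R]_2 -> R) i (y : 'rV[R]_2) : R :=
  \sum_k (x k y * partial k (z i) y - z k y * partial k (x i) y).

Lemma addrACA_sub (a b c e : R) : a - b + (c - e) = a + c - (b + e).
Proof. by rewrite addrACA -opprD. Qed.

Lemma leibniz_sum (a b c1 e1 c2 e2 u v : R) :
  a * (c1 * v + u * e1) + b * (c2 * v + u * e2) = (a * c1 + b * c2) * v + u * (a * e1 + b * e2).
Proof. by ring. Qed.

Lemma brE x z i y : br x z i y = dir x (z i) y - dir z (x i) y.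
Proof. rewrite /br /dir !sum_ord2; exact: addrACA_sub. Qed.

Lemma smooth_derivable V f y k : smooth V f -> V y -> derivable f y (e_ k).
Proof. by move=> sf; exact: ((sf 1%N).2 k).1. Qed.

Lemma dir_ext V x f g y : open V -> V y -> (forall z, V z -> f z = g z) ->
  dir x f y = dir x g y.
Proof. by move=> oV Vy fg; rewrite /dir !sum_ord2 !(partial_ext _ oV Vy fg). Qed.

Lemma dirD V x f g y : V y -> smooth V f -> smooth V g ->
  dir x (fun z => f z + g z) y = dir x f y + dir x g y.
Proof.
move=> Vy sf sg; rewrite /dir !sum_ord2 !partialD; try exact: smooth_derivable Vy.
by rewrite !mulrDr addrACA.
Qed.

Lemma dirM V x f g y : V y -> smooth V f -> smooth V g ->
  dir x (fun z => f z * g z) y = dir x f y * g y + f y * dir x g y.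
Proof.
move=> Vy sf sg; rewrite /dir !sum_ord2 !partialM; try exact: smooth_derivable Vy.
exact: leibniz_sum.
Qed.

Lemma dir_cst x (c : R) y : dir x (fun=> c) y = 0.
Proof. by rewrite /dir sum_ord2 !partial_cst !mulr0 addr0. Qed.

Lemma smoothD V f g : open V -> smooth V f -> smooth V g -> smooth V (fun z => f z + g z).
Proof. by move=> oV sf sg k; exact: CkD. Qed.
Lemma smoothN V f : open V -> smooth V f -> smooth V (fun z => - f z).
Proof. by move=> oV sf k; exact: CkN. Qed.
Lemma smoothM V f g : open V -> smooth V f -> smooth V g -> smooth V (fun z => f z * g z).
Proof. by move=> oV sf sg k; exact: CkM. Qed.
Lemma smoothV V f : open V -> (forall y, V y -> f y != 0) -> smooth V f ->
  smooth V (fun z => (f z)^-1).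
Proof. by move=> oV f0 sf k; exact: CkV. Qed.
Lemma smooth_cst V (c : R) : smooth V (fun=> c).
Proof. by move=> k; exact: Ck_cst. Qed.
Lemma smooth_sqrt V f : open V -> (forall y, V y -> 0 < f y) -> smooth V f ->
  smooth V (fun z => Num.sqrt (f z)).
Proof. by move=> oV f0 sf k; exact: Ck_sqrt. Qed.
Lemma smooth_sub V W f : W `<=` V -> smooth V f -> smooth W f.
Proof. by move=> WV sf k; exact: Ck_sub (sf k). Qed.

(** [stereo1] and [stereo2] are the two infinitesimal translations of the quadric in stereographic
    coordinates, independent at the origin, and [stereo3] is the rotation (a boost if [de = - 1])
    about it. *)
Definition stereo1 (de ka : R) (i : 'I_2) (y : 'rV[R]_2) : R :=
  if i == i1 then (1 - ka * y ord0 i1 ^+ 2 + ka * de * y ord0 i2 ^+ 2) / 2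
  else - ka * y ord0 i1 * y ord0 i2.
Definition stereo2 (de ka : R) (i : 'I_2) (y : 'rV[R]_2) : R :=
  if i == i1 then - ka * y ord0 i1 * y ord0 i2
  else (de + ka * de * y ord0 i1 ^+ 2 - ka * y ord0 i2 ^+ 2) / 2.
Definition stereo3 (de : R) (i : 'I_2) (y : 'rV[R]_2) : R :=
  if i == i1 then - y ord0 i2 else de * y ord0 i1.
Definition qnorm (de : R) (y : 'rV[R]_2) : R := y ord0 i1 ^+ 2 + de * y ord0 i2 ^+ 2.

(** * Algebra of the passage from gnomonic to stereographic coordinates *)

Section StereoAlgebra.
Variables (de ka a b u : R).
Hypotheses (de2 : de ^+ 2 = 1) (u_gt0 : 0 < u).
Let w1 := a * (1 + u).
Let w2 := b * (1 + u).
Hypothesis uu : u * u = 1 - ka * (w1 * w1 + de * (w2 * w2)).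

Let u0 : 2 * u != 0. Proof. by rewrite mulf_neq0 ?pnatr_eq0 // gt_eqF. Qed.
Let u1 : 1 + u != 0. Proof. by rewrite gt_eqF // ltr_wpDl. Qed.

(** The half-angle identity of stereographic projection: it is [1 - u * u] divided by [1 + u], with
    [(w1, w2)] expressed through [(a, b)]. *)
Let nE : ka * (a ^+ 2 + de * b ^+ 2) * (1 + u) = 1 - u.
Proof.
apply: (mulIf u1); transitivity (1 - u * u); last by ring.
by rewrite uu /w1 /w2; ring.
Qed.

(** By [nE] the two quantities are [2 / (1 + u)] and [2 * u / (1 + u)]. *)
Lemma stereo_pos : 0 < 1 + ka * (a ^+ 2 + de * b ^+ 2) /\
  0 < 1 - ka * (a ^+ 2 + de * b ^+ 2).
Proof.
have u1' : 0 < 1 + u by rewrite ltr_wpDl.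
split; rewrite -(pmulr_lgt0 _ u1').
  by rewrite mulrDl mul1r nE; lra.
rewrite mulrBl mul1r nE; have := u_gt0; lra.
Qed.

Variables dY1 dY2 du dw1 dw2 : R.
Hypotheses (e1 : dY1 * (1 + u) + a * du = dw1) (e2 : dY2 * (1 + u) + b * du = dw2).
Hypothesis eu : 2 * u * du = - ka * (2 * w1 * dw1 + de * (2 * w2 * dw2)).

(** [dY1], [dY2], [du], [dw1], [dw2] stand for derivatives of [a], [b], [u], [w1], [w2] along one
    field; [e1], [e2] and [eu] are the differentiated relations. Solving [eu] for [du] first leaves
    linear equations for [dY1] and [dY2]. *)
Lemma stereo_dir1 : dw1 = 1 - ka * w1 ^+ 2 -> dw2 = - ka * w1 * w2 ->
  dY1 = (1 - ka * a ^+ 2 + ka * de * b ^+ 2) / 2 /\ dY2 = - ka * a * b.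
Proof.
move=> h1 h2; have duE : du = - ka * w1 * u.
  apply: (mulfI u0); rewrite eu h1 h2.
  transitivity (- ka * w1 * 2 * (1 - ka * (w1 * w1 + de * (w2 * w2)))); first by ring.
  by rewrite -uu; ring.
split; apply: (mulIf u1).
  transitivity (dw1 - a * du); first by rewrite -e1 addrK.
  rewrite h1 duE.
  transitivity (((1 + u) - 2 * ka * a ^+ 2 * (1 + u) +
     ka * (a ^+ 2 + de * b ^+ 2) * (1 + u)) / 2); last by field.
  by rewrite nE /w1; field.
transitivity (dw2 - b * du); first by rewrite -e2 addrK.
by rewrite h2 duE /w1 /w2; ring.
Qed.

Lemma stereo_dir2 : dw1 = - ka * w1 * w2 -> dw2 = de - ka * w2 ^+ 2 ->
  dY1 = - ka * a * b /\ dY2 = (de + ka * de * a ^+ 2 - ka * b ^+ 2) / 2.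
Proof.
move=> h1 h2; have duE : du = - ka * w2 * u.
  apply: (mulfI u0); rewrite eu h1 h2.
  transitivity (- ka * w2 * 2 * (de ^+ 2 - ka * (w1 * w1 + de * (w2 * w2)))); first by ring.
  by rewrite de2 -uu; ring.
split; apply: (mulIf u1).
  transitivity (dw1 - a * du); first by rewrite -e1 addrK.
  by rewrite h1 duE /w1 /w2; ring.
transitivity (dw2 - b * du); first by rewrite -e2 addrK.
rewrite h2 duE.
transitivity ((de * (1 + u) + de * (ka * (a ^+ 2 + de * b ^+ 2) * (1 + u))
    - ka * b ^+ 2 * (1 + u) - de ^+ 2 * ka * b ^+ 2 * (1 + u)) / 2); last by field.
by rewrite nE de2 /w2; field.
Qed.

Lemma stereo_dir3 : dw1 = - w2 -> dw2 = de * w1 -> dY1 = - b /\ dY2 = de * a.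
Proof.
move=> h1 h2; have duE : du = 0.
  apply: (mulfI u0); rewrite eu h1 h2.
  transitivity (- ka * (2 * w1 * w2 * (de ^+ 2 - 1))); first by ring.
  by rewrite de2; ring.
split; apply: (mulIf u1).
  transitivity (dw1 - a * du); first by rewrite -e1 addrK.
  by rewrite h1 duE /w2; ring.
transitivity (dw2 - b * du); first by rewrite -e2 addrK.
by rewrite h2 duE /w1; ring.
Qed.

End StereoAlgebra.

(** * Coordinates extracted from three fields with the given brackets *)

Section Frame.
Variables (V : set 'rV[R]_2) (x1 x2 x3 : 'I_2 -> 'rV[R]_2 -> R) (de ka : R).
Hypotheses (oV : open V) (de2 : de ^+ 2 = 1).
Hypotheses (s1 : forall i, smooth V (x1 i)) (s2 : forall i, smooth V (x2 i))
  (s3 : forall i, smooth V (x3 i)).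
Hypothesis b31 : forall i y, V y -> br x3 x1 i y = - x2 i y.
Hypothesis b32 : forall i y, V y -> br x3 x2 i y = de * x1 i y.
Hypothesis b12 : forall i y, V y -> br x1 x2 i y = ka * x3 i y.
Let D y := x1 i1 y * x2 i2 y - x2 i1 y * x1 i2 y.
Hypothesis D0 : forall y, V y -> D y != 0.

Let al y := (x3 i1 y * x2 i2 y - x2 i1 y * x3 i2 y) / D y.
Let be y := (x1 i1 y * x3 i2 y - x3 i1 y * x1 i2 y) / D y.

Let sD : smooth V D.
Proof. by apply: smoothD => //; [|apply: smoothN => //]; exact: smoothM. Qed.
Let sal : smooth V al.
Proof.
apply: smoothM => //; last exact: smoothV.
by apply: smoothD => //; [|apply: smoothN => //]; exact: smoothM.
Qed.
Let sbe : smooth V be.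
Proof.
apply: smoothM => //; last exact: smoothV.
by apply: smoothD => //; [|apply: smoothN => //]; exact: smoothM.
Qed.

Let x3E i y : V y -> x3 i y = al y * x1 i y + be y * x2 i y.
Proof.
by move=> Vy; have := D0 Vy; move: i; apply: forall_ord2; rewrite /al /be /D => h; field.
Qed.

Let frame_eq0 (A B : R) y : V y -> (forall i, A * x1 i y + B * x2 i y = 0) ->
  A = 0 /\ B = 0.
Proof.
move=> Vy AB; apply: (cramer2 (a := x2 i2 y) (b := - x2 i1 y) (c := - x1 i2 y) (d := x1 i1 y)).
- by have := D0 Vy; rewrite /D mulrNN mulrC.
- by rewrite -(AB i1); ring.
- by rewrite -(AB i2); ring.
Qed.

(** The Leibniz rule for the bracket with [al x1 + be x2]. Since [x1] and [x2] are independent,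
    comparison with the prescribed brackets gives the derivatives of [al] and [be] along each field,
    without solving any differential equation. *)
Let br_x3 x i y : V y ->
  br x x3 i y = dir x al y * x1 i y + dir x be y * x2 i y +
    al y * br x x1 i y + be y * br x x2 i y.
Proof.
move=> Vy; rewrite !brE.
rewrite (dir_ext (g := fun z => al z * x1 i z + be z * x2 i z) x oV Vy); last first.
  by move=> z Vz; exact: x3E.
rewrite (dirD x Vy (smoothM oV sal (s1 i)) (smoothM oV sbe (s2 i))).
rewrite (dirM x Vy sal (s1 i)) (dirM x Vy sbe (s2 i)).
have -> : dir x3 (x i) y = al y * dir x1 (x i) y + be y * dir x2 (x i) y.
  by rewrite /dir !sum_ord2 !x3E //; ring.
by ring.
Qed.

Let br_self x i y : br x x i y = 0.
Proof. by rewrite brE subrr. Qed.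
Let brC x z i y : br x z i y = - br z x i y.
Proof. by rewrite !brE opprB. Qed.

Let tab1 y : V y -> dir x1 al y = - ka * be y * al y /\ dir x1 be y = 1 - ka * be y ^+ 2.
Proof.
move=> Vy; have [i|h1 h2] := @frame_eq0 (dir x1 al y + ka * be y * al y)
   (dir x1 be y + ka * be y ^+ 2 - 1) y Vy.
  have := br_x3 x1 i Vy; rewrite brC b31 // br_self b12 // x3E //.
  by move=> E; rewrite -(subrr (- - x2 i y)) {1}E; ring.
by split; lra.
Qed.

Let tab2 y : V y -> dir x2 al y = ka * al y ^+ 2 - de /\ dir x2 be y = ka * al y * be y.
Proof.
move=> Vy; have [i|h1 h2] := @frame_eq0 (dir x2 al y - ka * al y ^+ 2 + de)
   (dir x2 be y - ka * al y * be y) y Vy.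
  have := br_x3 x2 i Vy; rewrite brC b32 // br_self (brC x2 x1) b12 // x3E //.
  by move=> E; rewrite -(subrr (- (de * x1 i y))) {1}E; ring.
by split; lra.
Qed.

Let tab3 y : V y -> dir x3 al y = - de * be y /\ dir x3 be y = al y.
Proof.
move=> Vy; have [i|h1 h2] := @frame_eq0 (dir x3 al y + de * be y)
   (dir x3 be y - al y) y Vy.
  have := br_x3 x3 i Vy; rewrite br_self b31 // b32 //.
  by move=> E; rewrite [RHS]E; ring.
by split; lra.
Qed.


Variable p : 'rV[R]_2.
Hypotheses (Vp : V p) (x3p : forall i, x3 i p = 0).

Let w1 := be.
Let w2 y := - al y.
Let q y := 1 - ka * (w1 y * w1 y + de * (w2 y * w2 y)).

Let sw1 : smooth V w1. Proof. exact: sbe. Qed.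
Let sw2 : smooth V w2. Proof. exact: smoothN. Qed.
Let sq : smooth V q.
Proof.
apply: smoothD; [exact: oV|exact: smooth_cst|apply: smoothN; first exact: oV].
apply: smoothM; [exact: oV|exact: smooth_cst|apply: smoothD; first exact: oV].
  by apply: smoothM.
by apply: smoothM; [exact: oV|exact: smooth_cst|apply: smoothM].
Qed.

Let alp : al p = 0. Proof. by rewrite /al !x3p !(mul0r, mulr0, subr0). Qed.
Let bep : be p = 0. Proof. by rewrite /be !x3p !(mul0r, mulr0, subr0). Qed.
Let qp : q p = 1. Proof. by rewrite /q /w1 /w2 alp bep oppr0 !mulr0 addr0 mulr0 subr0. Qed.

Let tabq x y : V y -> dir x q y = - ka * (2 * w1 y * dir x w1 y + de * (2 * w2 y * dir x w2 y)).
Proof.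
move=> Vy; pose n z := w1 z * w1 z + de * (w2 z * w2 z).
have s11 : smooth V (fun z => w1 z * w1 z) by exact: smoothM.
have s22 : smooth V (fun z => w2 z * w2 z) by exact: smoothM.
have sc (c : R) : smooth V (fun=> c) by exact: smooth_cst.
have sd22 : smooth V (fun z => de * (w2 z * w2 z)) by exact: smoothM (sc de) s22.
have sn : smooth V n by exact: smoothD.
have E : dir x q y = dir x (fun z => 1 + (- ka) * n z) y.
  apply: (dir_ext x oV Vy) => z _.
    exact: (congr1 (fun t => 1 + t) (esym (mulNr ka (n z)))).
rewrite E (dirD x Vy (sc 1) (smoothM oV (sc (- ka)) sn)) dir_cst.
rewrite (dirM x Vy (sc (- ka)) sn) dir_cst (dirD x Vy s11 sd22) (dirM x Vy sw1 sw1).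
by rewrite (dirM x Vy (sc de) s22) dir_cst (dirM x Vy sw2 sw2); ring.
Qed.

Let dirw2 x y : V y -> dir x w2 y = - dir x al y.
Proof.
move=> Vy; rewrite /dir !sum_ord2 !partialN; try exact: smooth_derivable Vy.
by ring.
Qed.

(** The coordinates are [w / (1 + u)] with [u] the square root of [q]. At [p] the functions [w1] and
    [w2] vanish and [q] is 1, so [p] goes to the origin and the inverse function theorem applies. *)
Lemma stereographic_coordinates : exists (Y : 'I_2 -> 'rV[R]_2 -> R) (rho : R)
    (W : set 'rV[R]_2) (Z : 'rV[R]_2 -> 'rV[R]_2), let F y := vec (Y i1 y) (Y i2 y) in
  [/\ 0 < rho, open W, W p, W `<=` V &
   [/\ forall i, smooth W (Y i),
       forall y, W y -> ball 0 rho (F y) /\ Z (F y) = y,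
       forall w, ball 0 rho w -> W (Z w) /\ F (Z w) = w,
       forall i, smooth (ball (0 : 'rV[R]_2) rho) (fun w => Z w ord0 i) &
       forall y, W y -> [/\ 0 < 1 + ka * qnorm de (F y), 0 < 1 - ka * qnorm de (F y) &
         forall i, [/\ dir x1 (Y i) y = stereo1 de ka i (F y),
           dir x2 (Y i) y = stereo2 de ka i (F y) &
           dir x3 (Y i) y = stereo3 de i (F y)]]]].
Proof.
(* Since [q p = 1], staying within distance 1 of this value keeps [q] positive and its square root
   smooth. *)
have [r r0 rP] : exists2 r : R, 0 < r & ball p r `<=` V `&` [set y | `|q p - q y| < 1].
  apply: near_ball; apply: filterI; first exact: open_nbhs_nbhs.
  exact: near_dist ((sq 0%N).1 p Vp) ltr01.
pose B := ball p r; have oB : open B by exact: ball_open.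
have BV : B `<=` V by move=> y /rP[].
have q0 y : B y -> 0 < q y.
  by move=> /rP[_] /=; rewrite qp ltr_norml => /andP[_]; rewrite ltrBlDr -ltrBlDl subrr.
have Bp : B p by exact: ballxx.
have sB f : smooth V f -> smooth B f by exact: smooth_sub.
pose u y := Num.sqrt (q y).
have u0 y : B y -> 0 < u y by move=> By; rewrite sqrtr_gt0 q0.
have uu y : B y -> u y * u y = q y by move=> By; rewrite -expr2 sqr_sqrtr // ltW // q0.
have su : smooth B u by apply: smooth_sqrt => //; exact: sB.
have s1u : smooth B (fun z => 1 + u z) by apply: smoothD => //; exact: smooth_cst.
have u1 y : B y -> 1 + u y != 0 by move=> /u0 h; rewrite gt_eqF // ltr_wpDl.
pose w i y := if i == i1 then w1 y else w2 y.
have sw i : smooth B (w i) by apply: sB; move: i; apply: forall_ord2; [exact: sw1|exact: sw2].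
pose Y i y := w i y / (1 + u y).
have sY i : smooth B (Y i) by apply: smoothM => //; exact: smoothV.
have wE i y : B y -> w i y = Y i y * (1 + u y) by move=> By; rewrite divfK // u1.
have du x y : B y -> 2 * u y * dir x u y = dir x q y.
  move=> By; rewrite -(dir_ext x oB By uu) (dirM x By su su); ring.
have dY x i y : B y -> dir x (Y i) y * (1 + u y) + Y i y * dir x u y = dir x (w i) y.
  move=> By; rewrite (dir_ext x oB By (wE i)) (dirM x By (sY i) s1u).
  by rewrite (dirD x By (smooth_cst B 1) su) dir_cst add0r.
have tab y : B y -> [/\ 0 < 1 + ka * qnorm de (vec (Y i1 y) (Y i2 y)),
     0 < 1 - ka * qnorm de (vec (Y i1 y) (Y i2 y)) &
    forall i, [/\ dir x1 (Y i) y = stereo1 de ka i (vec (Y i1 y) (Y i2 y)),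
           dir x2 (Y i) y = stereo2 de ka i (vec (Y i1 y) (Y i2 y)) &
           dir x3 (Y i) y = stereo3 de i (vec (Y i1 y) (Y i2 y))]].
  move=> By; have Vy := BV _ By; have uy := u0 y By.
  have e1 : w1 y = Y i1 y * (1 + u y) := wE i1 y By.
  have e2 : w2 y = Y i2 y * (1 + u y) := wE i2 y By.
  have qu : u y * u y = 1 - ka * (Y i1 y * (1 + u y) * (Y i1 y * (1 + u y)) +
     de * (Y i2 y * (1 + u y) * (Y i2 y * (1 + u y)))).
    by rewrite uu // /q e1 e2.
  have alE : al y = - (Y i2 y * (1 + u y)) by rewrite -e2 opprK.
  have beE : be y = Y i1 y * (1 + u y) := e1.
  have f1 x := dY x i1 y By; have f2 x := dY x i2 y By.
  have fu x : 2 * u y * dir x u y = - ka * (2 * (Y i1 y * (1 + u y)) * dir x w1 y +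
      de * (2 * (Y i2 y * (1 + u y)) * dir x w2 y)).
    by rewrite du // tabq // e1 e2.
  have [pos1 pos2] := stereo_pos uy qu.
  have [t1a t1b] := tab1 Vy; have [t2a t2b] := tab2 Vy; have [t3a t3b] := tab3 Vy.
  rewrite alE beE in t1a t1b t2a t2b t3a t3b.
  have [r11 r12] : dir x1 (Y i1) y = (1 - ka * Y i1 y ^+ 2 + ka * de * Y i2 y ^+ 2) / 2 /\
      dir x1 (Y i2) y = - ka * Y i1 y * Y i2 y.
    apply: (stereo_dir1 uy qu (f1 x1) (f2 x1) (fu x1)); first exact: t1b.
    by rewrite /w /= dirw2 // t1a; ring.
  have [r21 r22] : dir x2 (Y i1) y = - ka * Y i1 y * Y i2 y /\
      dir x2 (Y i2) y = (de + ka * de * Y i1 y ^+ 2 - ka * Y i2 y ^+ 2) / 2.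
    apply: (stereo_dir2 de2 uy qu (f1 x2) (f2 x2) (fu x2)).
      by rewrite /w /= -[dir x2 _ y]/(dir x2 be y) t2b; ring.
    by rewrite /w /= dirw2 // t2a; ring.
  have [r31 r32] : dir x3 (Y i1) y = - Y i2 y /\ dir x3 (Y i2) y = de * Y i1 y.
    apply: (stereo_dir3 de2 uy (f1 x3) (f2 x3) (fu x3)); first exact: t3b.
    by rewrite /w /= dirw2 // t3a; ring.
  rewrite /stereo1 /stereo2 /stereo3 /qnorm !vecE; split=> //.
  by apply: forall_ord2; split.
have Yp i : Y i p = 0.
  rewrite /Y /w /w2 /w1 alp bep oppr0 if_same; exact: mul0r.
have Fp : vec (Y i1 p) (Y i2 p) = 0.
  by rewrite !Yp; apply: rV2P; rewrite vecE mxE.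
(* At the origin the derivatives of [Y] along [x1] and [x2] are [(1/2, 0)] and [(0, de/2)], so the
   Jacobian times the frame determinant is [de / 4]. *)
have D2 : partial i1 (Y i1) p * partial i2 (Y i2) p - partial i2 (Y i1) p * partial i1 (Y i2) p != 0.
  have [_ _ t] := tab p Bp; have [t11 t21 _] := t i1; have [t12 t22 _] := t i2.
  move: t11 t21 t12 t22; rewrite Fp /stereo1 /stereo2 /= !mxE /dir !sum_ord2.
  rewrite !(expr0n, mulr0, mul0r, addr0, subr0, oppr0) /=.
  move: (partial i1 (Y i1) p) (partial i2 (Y i2) p) (partial i2 (Y i1) p) (partial i1 (Y i2) p)
    (x1 i1 p) (x1 i2 p) (x2 i1 p) (x2 i2 p) => a b c e f g h k h1 h2 h3 h4.
  apply/eqP => E0; have : (f * k - g * h) * (a * b - c * e) = de / 4.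
    transitivity ((f * a + g * c) * (h * e + k * b) - (h * a + k * c) * (f * e + g * b)).
      by ring.
    by rewrite h1 h2 h3 h4; field.
  rewrite E0 mulr0 => /esym /eqP; rewrite mulf_eq0 invr_eq0 pnatr_eq0 orbF => /eqP de0.
  by move: de2; rewrite de0 expr0n => /esym /eqP; rewrite oner_eq0.
have [rho [W [Z [rho0 oW Wp WB [Z1 Z2 Z3]]]]] := inverse_function oB Bp sY D2.
rewrite Fp in Z1 Z2 Z3.
exists Y, rho, W, Z; split=> //; first by move=> y /WB /BV.
split=> //.
- by move=> i; apply: smooth_sub (sY i).
- by move=> y /WB /tab.
Qed.

End Frame.

End Coordinates.

(** * The Lie algebra of the symmetries near a point *)

Lemma unitmx2_det (F : fieldType) (g : 'M[F]_2) : g \in unitmx ->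
  g i1 i1 * g i2 i2 - g i1 i2 * g i2 i1 != 0.
Proof.
rewrite unitmxE unitfE (expand_det_row _ ord0) sum_ord2 /cofactor !det_mx11 !mxE.
have -> : lift (ord0 : 'I_2) (0 : 'I_1) = i2 by apply/val_inj.
have -> : lift (i2 : 'I_2) (0 : 'I_1) = i1 by apply/val_inj.
by rewrite /= expr0 expr1 mul1r mulN1r mulrN.
Qed.

Section LocalStructure.
Variables (R : realType) (U : open_set R).
Let oU : open U := @open_carrierP R U.
Let K : comNzRingType := smooth_fun U.
Let d : 'I_2 -> K -> K := @sderiv R U.
Let dD := @sderivD R U.
Let dM := @sderivM R U.
Let dC := @sderivC R U.
Variable G : 'I_2 -> 'I_2 -> 'I_2 -> 'rV[R]_2 -> R.
Hypothesis sG : forall j r s, smooth U (G j r s).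
Hypothesis Gsym : forall j r s y, open_carrier U y -> G j r s y = G j s r y.
Local Notation affine := (affine_field sG).

Definition const_fun (c : R) : K := trunc (@smooth_cst R U c).

Lemma const_funE c y : open_carrier U y -> (const_fun c : smooth_fun U) y = c.
Proof. exact: truncE. Qed.

Lemma d_const_fun i c : d i (const_fun c) = 0.
Proof.
apply: sfun_eq => y Uy; last exact: sderiv_out.
rewrite sderivE // (partial_ext i oU Uy (g := fun=> c)) ?partial_cst //.
by move=> z Uz; exact: const_funE.
Qed.

Lemma affineD f h : affine f -> affine h -> affine (fun i => f i + h i).
Proof.
by move=> af ah i r s; rewrite (affED dD) (af i r s) (ah i r s) addr0.
Qed.

Lemma affineZ c f : affine f -> affine (fun i => const_fun c * f i).
Proof.
by move=> af i r s; rewrite (affEZ dM) ?(af i r s) ?mulr0 // => k; exact: d_const_fun.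
Qed.

Definition brK (f h : 'I_2 -> K) : 'I_2 -> K := bracketE d f h.

Lemma brK_affine f h : affine f -> affine h -> affine (brK f h).
Proof. exact: (aff_bracket_eq0 dD dM dC (connC sG Gsym)). Qed.

Lemma brKE f h i y : open_carrier U y ->
  (brK f h i : smooth_fun U) y = br (fun i => f i : smooth_fun U) (fun i => h i : smooth_fun U) i y.
Proof. by move=> Uy; rewrite /brK /bracketE /br !sum_ord2 !(sfunB, sfunM, sfunD) !sderivE. Qed.


Variables (p : 'rV[R]_2) (r : R).
Hypotheses (Up : open_carrier U p) (r0 : 0 < r) (rU : ball p r `<=` U).
Hypothesis gu : ricci_sym G p \in unitmx.
Hypothesis rP : forall f : 'I_2 -> K, affine f -> forall q, ball p r q ->
  (forall i, f i q = 0) -> (forall i j, partial j (f i) q = 0) ->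
  forall x i, ball p r x -> f i x = 0.

(* The part of the derivative at [p] left free by [affine_field_skew]. *)
Definition twist (f : 'I_2 -> K) : R :=
  \sum_k (ricci_sym G p i2 k * partial i1 (f k) p -
          ricci_sym G p i1 k * partial i2 (f k) p).

Lemma twistBZ f h c : twist (fun i => f i + const_fun c * h i) = twist f + c * twist h.
Proof.
have E j k : partial j (f k + const_fun c * h k) p = partial j (f k) p + c * partial j (h k) p.
  have dc : partial j (const_fun c) p = 0.
    exact: etrans (esym (sderivE j (const_fun c) Up))
      (congr1 (fun g : smooth_fun U => g p) (d_const_fun j c)).
  have D (g : smooth_fun U) : derivable g p (e_ j) by exact: sfun_derivable.
  apply: etrans (partialD (D (f k)) (D (const_fun c * h k))) _; congr (_ + _).
  apply: etrans (partialM (D (const_fun c)) (D (h k))) _.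
  by rewrite dc mul0r add0r const_funE.
rewrite /twist !sum_ord2 !E.
move: (partial i1 (f i1) p) (partial i1 (f i2) p) (partial i2 (f i1) p) (partial i2 (f i2) p)
  (partial i1 (h i1) p) (partial i1 (h i2) p) (partial i2 (h i1) p) (partial i2 (h i2) p).
move: (ricci_sym G p) => g x1 x2 x3 x4 y1 y2 y3 y4.
by move: (g i2 i1) (g i2 i2) (g i1 i1) (g i1 i2) => *; ring.
Qed.

Lemma affine_eq0 f : affine f -> (forall i, f i p = 0) -> twist f = 0 ->
  forall x i, ball p r x -> f i x = 0.
Proof.
move=> af f0 tf; apply: (rP af (q := p)) => //; first exact: ballxx.
exact: affine_field_jet0 tf.
Qed.

Lemma affine_eq f h c : affine f -> affine h -> (forall i, f i p = c * h i p) ->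
  twist f = c * twist h -> forall x i, ball p r x -> f i x = c * h i x.
Proof.
move=> af ah fh tfh x i bx; have Ux := rU bx.
have := @affine_eq0 (fun i => f i + const_fun (- c) * h i) _ _ _ x i bx.
rewrite !(sfunD, sfunM) const_funE // mulNr => E; apply/subr0_eq/E.
- by apply: affineD => //; exact: affineZ.
- by move=> j; rewrite !(sfunD, sfunM) const_funE // fh mulNr subrr.
- by rewrite twistBZ tfh mulNr subrr.
Qed.


Lemma br_ext f f' h h' i y : ball p r y ->
  (forall z i, ball p r z -> f i z = f' i z) -> (forall z i, ball p r z -> h i z = h' i z) ->
  br f h i y = br f' h' i y :> R.
Proof.
move=> By ff hh; have oB : open (ball p r) by exact: ball_open.
have E (u u' : 'I_2 -> 'rV[R]_2 -> R) k j : (forall z i, ball p r z -> u i z = u' i z) ->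
    partial k (u j) y = partial k (u' j) y.
  by move=> uu; apply: (partial_ext k oB By) => z Bz; exact: uu.
by rewrite /br !sum_ord2 !(E f f') // !(E h h') // !ff // !hh.
Qed.

(** Let [g] be the symmetric Ricci matrix and [B] the derivative of [x] at [p]. Skewness and the
    twist make [g B] antisymmetric with entries of absolute value 1/2; hence [B] has trace zero and
    [det g * det B = 1/4]. *)
Lemma isotropy_twist (x : 'I_2 -> K) : affine x -> (forall i, x i p = 0) -> twist x = 1 ->
  partial i1 (x i1) p + partial i2 (x i2) p = 0 /\
  partial i1 (x i1) p * partial i2 (x i2) p - partial i2 (x i1) p * partial i1 (x i2) p != 0.
Proof.
move=> ax x0; have S := affine_field_skew Gsym Up ax x0.
have gC i j : ricci_sym G p i j = ricci_sym G p j i by rewrite !mxE addrC.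
have det0 := unitmx2_det gu.
rewrite /twist sum_ord2; have := S i1 i1; have := S i1 i2; have := S i2 i2; clear S.
rewrite 3!sum_ord2; move: (ricci_sym G p) gC det0 => g gC.
move: (g i1 i1) (g i1 i2) (g i2 i1) (g i2 i2) (gC i2 i1) => a b b' c -> det0.
move: (partial i1 (x i1) p) (partial i1 (x i2) p) (partial i2 (x i1) p)
  (partial i2 (x i2) p) => k l m n h22 h12 h11 ht.
have P11 : a * k + b * l = 0 by lra.
have P22 : b * m + c * n = 0 by lra.
have P12 : b * k + c * l = 2^-1 by lra.
have P21 : a * m + b * n = - 2^-1 by lra.
split.
  apply: (mulfI det0); rewrite mulr0.
  transitivity (c * (a * k + b * l) - b * (b * k + c * l) - b * (a * m + b * n)
     + a * (b * m + c * n)); first by ring.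
  by rewrite P11 P12 P21 P22; ring.
apply/eqP => D0; have : (a * c - b * b) * (k * n - m * l) = 4^-1.
  transitivity ((a * k + b * l) * (b * m + c * n) - (a * m + b * n) * (b * k + c * l)).
    by ring.
  by rewrite P11 P12 P21 P22; field.
by rewrite D0 mulr0 => /esym /eqP; rewrite invr_eq0 pnatr_eq0.
Qed.

Lemma brZ (f h : 'I_2 -> K) (a b : R) i y : open_carrier U y ->
  br (fun i z => a * f i z) (fun i z => b * h i z) i y = a * b * br (fun i => f i) (fun i => h i) i y.
Proof.
move=> Uy.
have E (u : smooth_fun U) (c : R) k : partial k (fun z => c * u z) y = c * partial k u y.
  rewrite (partialM (derivable_cst c y (e_ k)) (@sfun_derivable R U u y k Uy)).
  by rewrite partial_cst mul0r add0r.
by rewrite /br !sum_ord2 !E; move: (partial _ _ _) (partial _ _ _) (partial _ _ _) (partial _ _ _)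
  (f i1 y) (f i2 y) (h i1 y) (h i2 y) => *; ring.
Qed.

Variable P : ('I_2 -> K) -> Prop.
Hypothesis PA : forall f, P f -> affine f.
Hypothesis PJ : forall v1 v2 t : R, exists f, [/\ P f, f i1 p = v1, f i2 p = v2 & twist f = t].

(* [P] stands for "is the restriction of a global symmetry"; bracketing is only
   done locally, and this lemma replaces the result by a member of [P]. *)
Lemma affine_rep f : affine f -> exists2 g, P g & forall y i, ball p r y -> g i y = f i y.
Proof.
move=> af; have [g [Pg g1 g2 gt]] := PJ (f i1 p) (f i2 p) (twist f).
exists g => // y i By; rewrite -[RHS]mul1r; apply: affine_eq By => //.
- exact: PA.
- by move=> j; rewrite mul1r; move: j; apply: forall_ord2.
- by rewrite mul1r.
Qed.

Definition rels (x1 x2 x3 : 'I_2 -> K) (de ka : R) := forall i y, ball p r y ->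
  [/\ br (fun i => x3 i) (fun i => x1 i) i y = - x2 i y,
      br (fun i => x3 i) (fun i => x2 i) i y = de * x1 i y &
      br (fun i => x1 i) (fun i => x2 i) i y = ka * x3 i y].

Definition frame_at (x1 x2 x3 : 'I_2 -> K) :=
  x1 i1 p * x2 i2 p - x2 i1 p * x1 i2 p != 0 /\ forall i, x3 i p = 0.

(** On values at [p], bracketing with [x3] acts as [- B], where [B] is the derivative of [x3]. As
    [B] has trace zero, its square is [- de] with [de = det B]. So from a start [x10] with value
    [v], the fields [- [x3, x10]] and [de^-1 [x3, x2]] have values [B v] and [v]. *)
Lemma unnormalized_structure : exists x1 x2 x3 de ka,
  [/\ P x1, P x2, P x3, frame_at x1 x2 x3 & de != 0 /\ rels x1 x2 x3 de ka].
Proof.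
have Bp : ball p r p by exact: ballxx.
have [x3 [P3 x31 x32 t3]] := PJ 0 0 1.
have x3p i : x3 i p = 0 by move: i; apply: forall_ord2.
have [tr0 det0] := isotropy_twist (PA P3) x3p t3.
set b11 := partial i1 (x3 i1) p in tr0 det0; set b22 := partial i2 (x3 i2) p in tr0 det0.
set b12 := partial i2 (x3 i1) p in det0; set b21 := partial i1 (x3 i2) p in det0.
pose de := b11 * b22 - b12 * b21.
(* A vector that is not an eigenvector of [B]: a basis vector if some off-diagonal entry is nonzero,
   otherwise [(1, 1)], because the diagonal entries are then opposite and nonzero. *)
have [v1 [v2 vdet]] : exists v1 v2 : R,
    v1 * (b21 * v1 + b22 * v2) - (b11 * v1 + b12 * v2) * v2 != 0.
  have [b210|b210] := eqVneq b21 0; last first.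
    by exists 1, 0; rewrite !(mulr0, mulr1, mul1r, addr0, subr0).
  have [b120|b120] := eqVneq b12 0; last first.
    by exists 0, 1; rewrite !(mulr0, mul0r, mulr1, add0r, sub0r) oppr_eq0.
  exists 1, 1; rewrite b210 b120 !(mulr1, mul1r, add0r, addr0).
  apply/eqP => E; have b0 : b11 = 0 by lra.
  by move: det0; rewrite b0 b210 mulr0 mul0r subr0 eqxx.
have [x10 [P10 x101 x102 t10]] := PJ v1 v2 0.
have br3 (f : 'I_2 -> K) i : br (fun i => x3 i) (fun i => f i) i p =
    - (f i1 p * partial i1 (x3 i) p + f i2 p * partial i2 (x3 i) p).
  by rewrite /br sum_ord2 !x3p !mul0r !sub0r opprD.
have [x2 P2 x2E] := affine_rep (affineZ (- 1) (brK_affine (PA P3) (PA P10))).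
have {}x2E y i : ball p r y -> x2 i y = - br (fun i => x3 i) (fun i => x10 i) i y.
  by move=> By; have Uy := rU By; rewrite x2E // sfunM const_funE // brKE // mulN1r.
have [x1 P1 x1E] := affine_rep (affineZ de^-1 (brK_affine (PA P3) (PA P2))).
have {}x1E y i : ball p r y -> x1 i y = de^-1 * br (fun i => x3 i) (fun i => x2 i) i y.
  by move=> By; have Uy := rU By; rewrite x1E // sfunM const_funE // brKE.
have x21 : x2 i1 p = b11 * v1 + b12 * v2.
  by rewrite x2E // br3 x101 x102 opprK mulrC [X in _ + X]mulrC.
have x22 : x2 i2 p = b21 * v1 + b22 * v2.
  by rewrite x2E // br3 x101 x102 opprK mulrC [X in _ + X]mulrC.
have b22E : b22 = - b11 by lra.
have x11 : x1 i1 p = v1.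
  rewrite x1E // br3 x21 x22; apply: (mulfI det0); rewrite mulrA divff // mul1r.
  by rewrite -/b11 -/b12 b22E; ring.
have x12 : x1 i2 p = v2.
  rewrite x1E // br3 x21 x22; apply: (mulfI det0); rewrite mulrA divff // mul1r.
  by rewrite -/b21 -/b22 b22E; ring.
(* Equal values at [p] leave only a multiple of [x3], with coefficient read from the twists since
   [twist x3 = 1]. As [x3] commutes with itself, [x1] may replace [x10] in the bracket defining
   [x2]. *)
have x1D y i : ball p r y -> x1 i y = x10 i y + (twist x1 - twist x10) * x3 i y.
  move=> By; have Uy := rU By; set c := twist x1 - twist x10.
  have := @affine_eq (fun i => x1 i + const_fun (- 1) * x10 i) x3 c _ _ _ _ y i By.
  rewrite sfunD sfunM const_funE // mulN1r => E; apply/eqP; rewrite addrC -subr_eq; apply/eqP.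
  apply: E.
  - by apply: affineD; [exact: PA|apply: affineZ; exact: PA].
  - exact: PA.
  - move=> j; rewrite sfunD sfunM const_funE // x3p mulr0 mulN1r.
    by move: j; apply: forall_ord2; rewrite ?x11 ?x101 ?x12 ?x102 subrr.
  - by rewrite twistBZ t3 mulr1 mulN1r.
have b31 i y : ball p r y -> br (fun i => x3 i) (fun i => x1 i) i y = - x2 i y.
  move=> By; rewrite x2E // opprK.
  have Uy := rU By.
  have := @br_ext (fun i => x3 i) (fun i => x3 i) (fun i => x1 i)
    (fun i z => x10 i z + (twist x1 - twist x10) * x3 i z) i y By (fun _ _ _ => erefl) _.
  move=> -> //; move: (twist x1 - twist x10) => c.
  have D (u : smooth_fun U) k : derivable u y (e_ k) by exact: sfun_derivable.
  have E k : partial k (fun z => x10 i z + c * x3 i z) y =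
      partial k (x10 i) y + c * partial k (x3 i) y.
    have dZ : derivable (fun z => c * x3 i z) y (e_ k).
      exact: derivableM (derivable_cst c y (e_ k)) (D (x3 i) k).
    rewrite (partialD (D (x10 i) k) dZ).
    by rewrite (partialM (derivable_cst c y (e_ k)) (D (x3 i) k)) partial_cst mul0r add0r.
  rewrite /br !sum_ord2 !E.
  move: (partial i1 (x3 i) y) (partial i2 (x3 i) y) (partial i1 (x10 i) y) (partial i2 (x10 i) y).
  by move: (x3 i1 y) (x3 i2 y) (x10 i1 y) (x10 i2 y) => *; ring.
have b32 i y : ball p r y -> br (fun i => x3 i) (fun i => x2 i) i y = de * x1 i y.
  by move=> By; rewrite x1E // mulrA divff // mul1r.
pose z := brK x1 x2.
have az : affine z by apply: brK_affine; exact: PA.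
(* By Jacobi, [[x3, [x1, x2]] = - [x2, x2] + de [x1, x1] = 0]. Since [B] is invertible, [[x1, x2]]
   then vanishes at [p] and is a multiple of [x3]. *)
have b3z i : br (fun i => x3 i) (fun i => z i) i p = 0.
  have := jacobi dD dM dC x3 x1 x2 i; move/(congr1 (fun g : smooth_fun U => g p)).
  rewrite sfunD -!/(brK _ _) !brKE // => ->.
  have -> : br (fun i => brK x3 x1 i) (fun i => x2 i) i p =
            br (fun i z => - 1 * x2 i z) (fun i z => 1 * x2 i z) i p.
    apply: br_ext Bp _ _ => y j By; last by rewrite mul1r.
    by rewrite brKE ?b31 ?mulN1r //; exact: rU.
  have -> : br (fun i => x1 i) (fun i => brK x3 x2 i) i p =
            br (fun i z => 1 * x1 i z) (fun i z => de * x1 i z) i p.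
    apply: br_ext Bp _ _ => y j By; first by rewrite mul1r.
    by rewrite brKE ?b32 //; exact: rU.
  by rewrite !brZ // !brE !subrr !mulr0 addr0.
have zp i : z i p = 0.
  have := b3z i1; have := b3z i2; rewrite !br3 => /eqP; rewrite oppr_eq0 => /eqP h2 /eqP.
  rewrite oppr_eq0 => /eqP h1.
  have [|||u1 u2] := cramer2 (a := b22) (b := - b12) (c := - b21) (d := b11) _
     (x := z i1 p) (y := z i2 p).
  - by rewrite mulrNN mulrC.
  - by rewrite -h1 -/b11 -/b12; ring.
  - by rewrite -h2 -/b21 -/b22; ring.
  by move: i; apply: forall_ord2.
exists x1, x2, x3, de, (twist z); split=> //.
  by split=> //; rewrite x11 x12 x21 x22.
split=> // i y By; split; [exact: b31|exact: b32|].
have Uy := rU By; rewrite -(brKE x1 x2 i Uy).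
apply: (affine_eq az (PA P3)) By; last by rewrite t3 mulr1.
by move=> j; rewrite zp x3p mulr0.
Qed.

Lemma normalized_structure : exists x1 x2 x3 de ka,
  [/\ P x1, P x2, P x3, frame_at x1 x2 x3 &
   [/\ de ^+ 2 = 1, ka = 0 \/ ka ^+ 2 = 1 & rels x1 x2 x3 de ka]].
Proof.
have [x1 [x2 [x3 [de [ka [P1 P2 P3 [fr0 x3p] [de0 rel]]]]]]] := unnormalized_structure.
(* Multiplying [x1], [x2], [x3] by [t], [t * s], [s] preserves the first relation, multiplies [de]
   by [s ^+ 2] and [ka] by [t ^+ 2]. *)
pose s := (Num.sqrt `|de|)^-1; pose t := if ka == 0 then 1 else (Num.sqrt `|ka|)^-1.
have s0 : s != 0 by rewrite invr_eq0 sqrtr_eq0 -ltNge normr_gt0.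
have t0 : t != 0.
  rewrite /t; case: (eqVneq ka 0) => [_|k0]; first exact: oner_neq0.
  by rewrite invr_eq0 sqrtr_eq0 -ltNge normr_gt0.
have sq (c : R) : c != 0 -> ((Num.sqrt `|c|)^-1 ^+ 2 * c) ^+ 2 = 1.
  move=> c0; rewrite exprVn sqr_sqrtr // exprMn exprVn real_normK ?num_real //.
  by rewrite mulVf // expf_neq0.
have [z1 Q1 E1] := affine_rep (affineZ t (PA P1)).
have [z2 Q2 E2] := affine_rep (affineZ (t * s) (PA P2)).
have [z3 Q3 E3] := affine_rep (affineZ s (PA P3)).
have Bp : ball p r p by exact: ballxx.
have F (c : R) (x z : 'I_2 -> K) : (forall y i, ball p r y -> z i y = (const_fun c * x i : K) y) ->
    forall y i, ball p r y -> z i y = c * x i y.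
  by move=> E y i By; rewrite E // sfunM const_funE //; exact: rU.
have {}E1 := F _ _ _ E1; have {}E2 := F _ _ _ E2; have {}E3 := F _ _ _ E3.
exists z1, z2, z3, (s ^+ 2 * de), (t ^+ 2 * ka); split=> //.
  split; last by move=> i; rewrite E3 // x3p mulr0.
  rewrite !E1 // !E2 //.
  rewrite (_ : _ - _ = t * (t * s) * (x1 i1 p * x2 i2 p - x2 i1 p * x1 i2 p)); last by ring.
  by rewrite !mulf_neq0.
split.
- exact: sq.
- rewrite /t; case: (eqVneq ka 0) => [->|k0]; first by left; rewrite mulr0.
  by right; exact: sq.
move=> i y By; have Uy := rU By; have [r1 r2 r3] := rel i y By.
split.
- rewrite (br_ext _ By E3 E1) brZ // r1 E2 //; ring.
- rewrite (br_ext _ By E3 E2) brZ // r2 E1 //; ring.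
- rewrite (br_ext _ By E1 E2) brZ // r3 E3 //; ring.
Qed.

End LocalStructure.

(** * Global symmetries *)

Definition chart_set (R : realType) (M : topologicalType) (c : chart R 2 M) : open_set R :=
  @OpenSet R (cimg c) (@open_cimg R 2 M c).

Lemma smoothZD (R : realType) n (U : set 'rV[R]_n) (a : R) (f g : 'rV[R]_n -> R) :
  open U -> smooth U f -> smooth U g -> smooth U (fun z => a * f z + g z).
Proof. by move=> oU sf sg k; apply: CkD => //; apply: CkM => //; exact: Ck_cst. Qed.

Lemma partialZD (R : realType) n (a : R) (f g : 'rV[R]_n -> R) i y :
  derivable f y (e_ i) -> derivable g y (e_ i) ->
  partial i (fun z => a * f z + g z) y = a * partial i f y + partial i g y.
Proof.
move=> df dg; have da := derivable_cst a y (e_ i).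
rewrite (partialD (derivableM da df) dg) (partialM da df).
by rewrite partial_cst mul0r add0r.
Qed.

Lemma lie_lin (R : comNzRingType) (a x1 x2 e1 e2 d1 d2 b1 b2 c1 c2 p1 p2 q1 q2 s1 s2 t1 t2 : R) :
  x1 * d1 - b1 * p1 + c1 * s1 + (x2 * d2 - b2 * p2 + c2 * s2) = 0 ->
  e1 * d1 - b1 * q1 + c1 * t1 + (e2 * d2 - b2 * q2 + c2 * t2) = 0 ->
  (a * x1 + e1) * d1 - b1 * (a * p1 + q1) + c1 * (a * s1 + t1) +
  ((a * x2 + e2) * d2 - b2 * (a * p2 + q2) + c2 * (a * s2 + t2)) = 0.
Proof.
move=> h1 h2; rewrite -[RHS](addr0 0) -{1}(mulr0 a) -{1}h1 -h2; ring.
Qed.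

Lemma aff_lin (R : comNzRingType) (a D E p1 p2 q1 q2 g1 g2 d1 d2 x1 x2 e1 e2 u1 u2 v1 v2
    xr1 xr2 er1 er2 xs1 xs2 es1 es2 : R) :
  p1 * g1 + p2 * g2 = D + (d1 * x1 + u1 * xr1 + v1 * xs1 + (d2 * x2 + u2 * xr2 + v2 * xs2)) ->
  q1 * g1 + q2 * g2 = E + (d1 * e1 + u1 * er1 + v1 * es1 + (d2 * e2 + u2 * er2 + v2 * es2)) ->
  (a * p1 + q1) * g1 + (a * p2 + q2) * g2 = a * D + E +
   (d1 * (a * x1 + e1) + u1 * (a * xr1 + er1) + v1 * (a * xs1 + es1) +
    (d2 * (a * x2 + e2) + u2 * (a * xr2 + er2) + v2 * (a * xs2 + es2))).
Proof.
move=> h1 h2; transitivity (a * (p1 * g1 + p2 * g2) + (q1 * g1 + q2 * g2)); first by ring.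
by rewrite h1 h2; ring.
Qed.

Section Symmetries.
Variables (R : realType) (M : topologicalType) (atlas : set (chart R 2 M)).
Variables (A : operator_components R 2 M) (Gamma : connection_components R 2 M).
Hypothesis Gamma_connection : affine_connection atlas Gamma.
Hypothesis Gamma_symmetric : symmetric_connection atlas Gamma.
Hypothesis M_manifold : smooth_manifold atlas.
Hypothesis M_connected : connected [set: M].
Implicit Types (c : chart R 2 M) (xi eta : vector_components R 2 M).

(** The zero branch is a default that makes this total in [xi]; for a vector field and a chart of
    the atlas the first branch is taken. *)
Definition local_field c xi i : smooth_fun (chart_set c) :=
  match pselect (smooth (chart_set c) (fun z => xi c z ord0 i)) with
  | left s => trunc s
  | right _ => 0
  end.

Lemma local_fieldE c xi i y : vector_field atlas xi -> atlas c -> cimg c y ->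
  local_field c xi i y = xi c y ord0 i.
Proof.
move=> [sxi _] ac cy; rewrite /local_field; case: pselect => [s|[]]; first exact: truncE.
exact: sxi.
Qed.

Lemma smooth_conn c (ac : atlas c) j r s : smooth (chart_set c) (Gamma c j r s).
Proof. exact: Gamma_connection.1. Qed.

Lemma conn_sym c (ac : atlas c) j r s y : open_carrier (chart_set c) y ->
  Gamma c j r s y = Gamma c j s r y.
Proof. by move=> cy; exact: Gamma_symmetric. Qed.

Lemma local_field_affine c xi (ac : atlas c) : point_symmetry atlas A Gamma xi ->
  affine_field (smooth_conn ac) (local_field c xi).
Proof.
move=> [vf det]; apply: (affine_fieldP _ (eta := xi c)).
  by move=> i y cy; exact: local_fieldE.
by move=> y cy; exact: (det c y ac cy).2.
Qed.

Lemma point_symmetryZD a xi eta : point_symmetry atlas A Gamma xi ->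
  point_symmetry atlas A Gamma eta ->
  point_symmetry atlas A Gamma (fun c y => a *: xi c y + eta c y).
Proof.
move=> [[sxi txi] dxi] [[seta teta] deta].
have cE c i : (fun y => (a *: xi c y + eta c y) ord0 i) =
    (fun y => a * xi c y ord0 i + eta c y ord0 i).
  by apply/funext => y; rewrite !mxE.
split; first split.
- by move=> c ac i; rewrite cE; apply: smoothZD; [exact: open_cimg|exact: sxi|exact: seta].
- move=> c c' m ac ac' cm cm' i; rewrite !mxE (txi _ _ _ ac ac' cm cm') (teta _ _ _ ac ac' cm cm').
  by rewrite !sum_ord2 !mxE; ring.
move=> c y ac cy; have [x1 x2] := dxi c y ac cy; have [e1 e2] := deta c y ac cy.
have oc := @open_cimg _ _ _ c.
have pE k i z : cimg c z -> partial k (fun z => a * xi c z ord0 i + eta c z ord0 i) z =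
    a * partial k (fun z => xi c z ord0 i) z + partial k (fun z => eta c z ord0 i) z.
  move=> cz; apply: partialZD; first exact: ((sxi c ac i 1%N).2 k).1.
  exact: ((seta c ac i 1%N).2 k).1.
have ppE k l i : partial k (partial l (fun z => a * xi c z ord0 i + eta c z ord0 i)) y =
    a * partial k (partial l (fun z => xi c z ord0 i)) y +
    partial k (partial l (fun z => eta c z ord0 i)) y.
  rewrite (partial_ext k oc cy (pE l i)); apply: partialZD.
    exact: (((sxi c ac i 2%N).2 l).2.2 k).1 y cy.
  exact: (((seta c ac i 2%N).2 l).2.2 k).1 y cy.
split.
  move=> i j; have := x1 i j; have := e1 i j; rewrite /lie_derivative_operator.
  rewrite !sum_ord2 !cE !pE // !mxE.
  by move=> h1 h2; exact: lie_lin h2 h1.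
move=> i k l; have := x2 i k l; have := e2 i k l; rewrite /infinitesimal_affine.
by rewrite !sum_ord2 !cE !ppE !pE // !mxE => h1 h2; exact: aff_lin h2 h1.
Qed.

(** The interior of the zero set is open, nonempty by [jet_uniqueness] at [p], and closed;
    connectedness makes it everything. *)
Lemma point_symmetry_vanish xi c p : point_symmetry atlas A Gamma xi -> atlas c -> cimg c p ->
  (forall i, local_field c xi i p = 0) -> (forall i j, partial j (local_field c xi i) p = 0) ->
  forall e y, atlas e -> cimg e y -> xi e y = 0.
Proof.
move=> ps ac cp v0 j0; have [vf _] := ps; have [_ _ cover _ _] := M_manifold.
pose S : set M := [set m | forall e, atlas e -> cdom e m -> xi e (Defs.coord e m) = 0].
have transfer e m : atlas e -> cdom e m -> xi e (Defs.coord e m) = 0 -> S m.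
  move=> ae em x0 e' ae' em'; apply/rowP => i.
  rewrite (vf.2 e e' m ae ae' em em') mxE big1 // => k _.
  by rewrite x0 mxE mulr0.
(* One neighbourhood [N] of [m] works for a zero jet at any of its points [m']. Hence a limit point
   of the interior, having interior points in its [N], belongs to the interior. *)
have local e m : atlas e -> cdom e m -> exists2 N, nbhs m N & forall m', N m' ->
    (forall i, local_field e xi i (Defs.coord e m') = 0) ->
    (forall i j, partial j (local_field e xi i) (Defs.coord e m') = 0) -> nbhs m S.
  move=> ae em; have ep : open_carrier (chart_set e) (Defs.coord e m) by exists m.
  have [r [r0 rU rP]] := jet_uniqueness (smooth_conn ae) ep.
  have nb : nbhs m (cdom e `&` Defs.coord e @^-1` ball (Defs.coord e m) r).
    apply: filterI; first by apply: open_nbhs_nbhs; split=> //; exact: open_cdom.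
    have bb : nbhs (Defs.coord e m) (ball (Defs.coord e m) r).
      by apply: open_nbhs_nbhs; split; [exact: ball_open|exact: ballxx].
    exact: (@Defs.coord_continuous _ _ _ e m em _ bb).
  exists (cdom e `&` Defs.coord e @^-1` ball (Defs.coord e m) r) => // m' [em' bm'] v j.
  apply: filterS nb => m1 [em1 bm1]; apply: (transfer e) => //.
  have z i := rP _ (local_field_affine ae ps) _ bm' v j _ i bm1.
  have cy : cimg e (Defs.coord e m1) by exists m1.
  by apply/rowP => i; rewrite mxE -(local_fieldE i vf ae cy); exact: z.
have [m0 cm0 m0p] := cp.
have ZT : S° = [set: M].
  apply: M_connected.
  - have [N nN NS] := local c m0 ac cm0; exists m0.
    by apply: (NS m0); [exact: nbhs_singleton|rewrite m0p|rewrite m0p].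
  - by exists S°; [exact: open_interior|rewrite setTI].
  - exists S°; last by rewrite setTI.
    move=> m mZ; have [e ae em] := cover m; have [N nN NS] := local e m ae em.
    have nE : nbhs m (N `&` cdom e).
      by apply: filterI => //; apply: open_nbhs_nbhs; split=> //; exact: open_cdom.
    have [m1 [m1Z [m1N m1e]]] := mZ _ nE.
    have eq1 : cimg e (Defs.coord e m1) by exists m1.
    (* Near the interior point [m1] the components vanish identically, so their derivatives there
       vanish too. *)
    have z0 : \forall z \near Defs.coord e m1, forall i, local_field e xi i z = 0.
      have n1 : nbhs (Defs.coord e m1) (Defs.point e @^-1` S).
        have Sm : nbhs (Defs.point e (Defs.coord e m1)) S by rewrite coordK.
        exact: (@Defs.point_continuous _ _ _ e _ eq1 _ Sm).
      have n2 : nbhs (Defs.coord e m1) (cimg e).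
        by apply: open_nbhs_nbhs; split=> //; exact: open_cimg.
      apply: filterS (filterI n1 n2) => z [Sz [m2 em2 E]] i; rewrite -E.
      have Sm2 : S m2 by move: Sz; rewrite -E /= coordK.
      rewrite local_fieldE //; last by exists m2.
      by rewrite (Sm2 e ae em2) mxE.
    apply: (NS m1 m1N).
      by move=> i; exact: (nbhs_singleton z0).
    move=> i j; rewrite /partial (near_eq_derive (g := fun=> 0)); first exact: derive_cst.
    by apply: filterS z0 => z; apply.
move=> e y ae [m em <-]; have : S° m by rewrite ZT.
by move=> /interior_subset; apply.
Qed.

Hypothesis gen_pos : general_position atlas Gamma.
Hypothesis dim_max : symmetry_algebra_dim atlas A Gamma 3.

(** The index [l0] provides one symmetry, from which the empty sum is obtained as [- eta + eta]. *)
Lemma point_symmetry_comb N (a : 'I_N -> R) (eta : 'I_N -> vector_components R 2 M) :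
  'I_N -> (forall l, point_symmetry atlas A Gamma (eta l)) ->
  point_symmetry atlas A Gamma (combination a eta).
Proof.
move=> l0 ps.
have E s : point_symmetry atlas A Gamma (fun c y => \sum_(l <- s) a l *: eta l c y).
  elim: s => [|l s IH].
    have := point_symmetryZD (- 1) (ps l0) (ps l0).
    congr (point_symmetry _ _ _ _); apply/funext => c; apply/funext => y.
    by rewrite big_nil scaleN1r addNr.
  have := point_symmetryZD (a l) (ps l) IH.
  congr (point_symmetry _ _ _ _); apply/funext => c; apply/funext => y.
  by rewrite big_cons.
exact: E.
Qed.

Lemma partial_comb N (a : 'I_N -> R) (f : 'I_N -> 'rV[R]_2 -> R) k y :
  (forall l, derivable (f l) y (e_ k)) ->
  partial k (fun z => \sum_l a l * f l z) y = \sum_l a l * partial k (f l) y.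
Proof.
move=> df; have E s : derivable (fun z => \sum_(l <- s) a l * f l z) y (e_ k) /\
    partial k (fun z => \sum_(l <- s) a l * f l z) y = \sum_(l <- s) a l * partial k (f l) y.
  elim: s => [|l s [IH1 IH2]].
    rewrite (_ : (fun _ => _) = fun=> 0); last by apply/funext => z; rewrite big_nil.
    by rewrite big_nil partial_cst; split=> //; exact: derivable_cst.
  rewrite (_ : (fun _ => _) = fun z => a l * f l z + \sum_(l <- s) a l * f l z); last first.
    by apply/funext => z; rewrite big_cons.
  split; last by rewrite partialZD // IH2 big_cons.
  exact: derivableD (derivableM (derivable_cst (a l) y (e_ k)) (df l)) IH1.
exact: (E _).2.
Qed.

(** Combinations of the three basis symmetries are mapped linearly to the triple of two values and
    the twist at [p]. A kernel element has zero 1-jet, vanishes on the whole manifold and so has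
    zero coefficients; an injective square matrix is invertible. *)
Lemma symmetry_jets c (ac : atlas c) p : cimg c p -> forall v1 v2 t : R,
  exists2 xi, point_symmetry atlas A Gamma xi &
   [/\ local_field c xi i1 p = v1, local_field c xi i2 p = v2 &
       twist (Gamma c) p (local_field c xi) = t].
Proof.
move=> cp; have [eta [ps indep _]] := dim_max.
pose Wm : 'M[R]_3 := \matrix_(l < 3, j < 3)
  (if val j == 0 then local_field c (eta l) i1 p else
   if val j == 1 then local_field c (eta l) i2 p else
   twist (Gamma c) p (local_field c (eta l)))%N.
have psc a := point_symmetry_comb a (ord0 : 'I_3) ps.
have cv a i y : cimg c y -> local_field c (combination a eta) i y =
    \sum_l a l * local_field c (eta l) i y.
  move=> cy; rewrite (local_fieldE i (psc a).1 ac cy) /combination summxE.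
  by apply: eq_bigr => l _; rewrite mxE (local_fieldE i (ps l).1 ac cy).
have cd a i k : partial k (local_field c (combination a eta) i) p =
    \sum_l a l * partial k (local_field c (eta l) i) p.
  rewrite (partial_ext k (@open_cimg R 2 M c) cp (cv a i)) partial_comb // => l.
  exact: sfun_derivable.
have ct a : twist (Gamma c) p (local_field c (combination a eta)) =
    \sum_l a l * twist (Gamma c) p (local_field c (eta l)).
  rewrite /twist; transitivity (\sum_k \sum_l a l *
    (ricci_sym (Gamma c) p i2 k * partial i1 (local_field c (eta l) k) p -
     ricci_sym (Gamma c) p i1 k * partial i2 (local_field c (eta l) k) p)).
    apply: eq_bigr => k _; rewrite !cd !mulr_sumr -sumrB; apply: eq_bigr => l _.
    by rewrite mulrBr !(mulrCA (a l)).
  by rewrite exchange_big; apply: eq_bigr => l _; rewrite mulr_sumr.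
have mul (a : 'rV[R]_3) j : (a *m Wm) ord0 j =
  (if val j == 0 then local_field c (combination (a ord0) eta) i1 p else
   if val j == 1 then local_field c (combination (a ord0) eta) i2 p else
   twist (Gamma c) p (local_field c (combination (a ord0) eta)))%N.
  rewrite mxE !cv // ct; case: ifP => [j0|j0]; last case: ifP => [j1|j1];
  by apply: eq_bigr => l _; rewrite mxE j0 ?j1.
have Wu : Wm \in unitmx.
  rewrite -row_free_unit -kermx_eq0; apply/rowV0P => a /sub_kermxP aW.
  have z j := congr1 (fun v : 'rV[R]_3 => v ord0 j) aW.
  have z0 := z (Ordinal (isT : 0 < 3)%N); rewrite mul mxE /= in z0.
  have z1 := z (Ordinal (isT : 1 < 3)%N); rewrite mul mxE /= in z1.
  have z2 := z (Ordinal (isT : 2 < 3)%N); rewrite mul mxE /= in z2.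
  have v0 : forall i, local_field c (combination (a ord0) eta) i p = 0 by exact: forall_ord2.
  have j0 := affine_field_jet0 (@conn_sym c ac) cp (local_field_affine ac (psc (a ord0)))
    (gen_pos ac cp) v0 z2.
  have van := point_symmetry_vanish (psc (a ord0)) ac cp v0 j0.
  by apply/rowP => l; rewrite mxE; apply: (indep (a ord0)) => e y ae ey; exact: van.
move=> v1 v2 t; pose tv : 'rV[R]_3 := \row_j (if val j == 0 then v1 else
   if val j == 1 then v2 else t)%N.
have aW : tv *m invmx Wm *m Wm = tv by rewrite mulmxKV.
have z j := congr1 (fun v : 'rV[R]_3 => v ord0 j) aW.
exists (combination ((tv *m invmx Wm) ord0) eta); first exact: psc.
split.
- by have := z (Ordinal (isT : 0 < 3)%N); rewrite mul mxE.
- by have := z (Ordinal (isT : 1 < 3)%N); rewrite mul mxE.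
- by have := z (Ordinal (isT : 2 < 3)%N); rewrite mul mxE.
Qed.

End Symmetries.

(** * The normal form *)

Section Charts.
Variables (R : realType) (M : topologicalType).
Implicit Types c e : chart R 2 M.

Lemma overlap_open c e : open (overlap c e).
Proof.
rewrite openE => y [m [cm em] my].
have cy : cimg c y by exists m.
have pm : Defs.point c y = m by rewrite -my coordK.
have ne : nbhs (Defs.point c y) (cdom e).
  by rewrite pm; apply: open_nbhs_nbhs; split=> //; exact: open_cdom.
have n1 : nbhs y (Defs.point c @^-1` cdom e) by exact: (@Defs.point_continuous _ _ _ c y cy _ ne).
have n2 : nbhs y (cimg c) by apply: open_nbhs_nbhs; split=> //; exact: open_cimg.
apply: filterS (filterI n1 n2) => z [ez [m' cm' mz]]; exists m' => //; split=> //.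
by move: ez; rewrite -mz /= coordK.
Qed.

Lemma smooth_comp (U : set 'rV[R]_2) n (V : set 'rV[R]_n) (f : 'rV[R]_2 -> R)
    (g : 'rV[R]_n -> 'rV[R]_2) : open U -> open V -> (forall y, V y -> U (g y)) ->
  smooth U f -> (forall i, smooth V (fun y => g y ord0 i)) -> smooth V (fun y => f (g y)).
Proof.
move=> oU oV VU sf sg k.
have C := Ck_comp (n := n) oU oV _ sf (sg i1 k) (sg i2 k).
apply: (Ck_ext oV _ (C _)) => y Vy; rewrite -vec_eta //; exact: VU.
Qed.

Variables (c : chart R 2 M) (W : set 'rV[R]_2) (F Z : 'rV[R]_2 -> 'rV[R]_2) (rho : R).
Let B := ball (0 : 'rV[R]_2) rho.
Hypotheses (oW : open W) (Wc : W `<=` cimg c).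
Hypothesis sF : forall i, smooth W (fun y => F y ord0 i).
Hypothesis sZ : forall i, smooth B (fun y => Z y ord0 i).
Hypothesis FK : forall y, W y -> B (F y) /\ Z (F y) = y.
Hypothesis ZK : forall w, B w -> W (Z w) /\ F (Z w) = w.

Let oB : open B. Proof. exact: ball_open. Qed.

Let cont_of (V : set 'rV[R]_2) (g : 'rV[R]_2 -> 'rV[R]_2) y :
  (forall i, smooth V (fun y => g y ord0 i)) -> V y -> {for y, continuous g}.
Proof.
move=> sg Vy.
have -> : g = fun y => g y ord0 i1 *: e_ i1 + g y ord0 i2 *: e_ i2.
  by apply/funext => z; rewrite {1}(vec_eta (g z)).
apply: (@continuousD _ _ _ (fun y => g y ord0 i1 *: e_ i1) (fun y => g y ord0 i2 *: e_ i2)).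
  by apply: continuousZr_tmp; exact: (sg i1 0%N).1.
by apply: continuousZr_tmp; exact: (sg i2 0%N).1.
Qed.

Let dom := cdom c `&` Defs.coord c @^-1` W.

Let dom_open : open dom.
Proof.
rewrite openE => m [cm Wm]; apply: filterI.
  by apply: open_nbhs_nbhs; split=> //; exact: open_cdom.
have nW : nbhs (Defs.coord c m) W by exact: open_nbhs_nbhs.
exact: (@Defs.coord_continuous _ _ _ c m cm _ nW).
Qed.

Let imgE : (F \o Defs.coord c) @` dom = B.
Proof.
apply/seteqP; split=> [_ [m [cm Wm] <-]|w Bw]; first exact: (FK Wm).1.
have [WZ FZ] := ZK Bw; have [m cm mZ] := Wc WZ.
by exists m => //=; [split=> //=; rewrite mZ|rewrite mZ].
Qed.

Let img_open : open ((F \o Defs.coord c) @` dom).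
Proof. by rewrite imgE. Qed.

Let newK m : dom m -> (Defs.point c \o Z) ((F \o Defs.coord c) m) = m.
Proof. by move=> [cm Wm] /=; rewrite (FK Wm).2 coordK. Qed.

Let coord_cont m : dom m -> {for m, continuous (F \o Defs.coord c)}.
Proof.
move=> [cm Wm]; apply: continuous_comp; first exact: Defs.coord_continuous.
exact: cont_of sF _.
Qed.

Let point_cont y : ((F \o Defs.coord c) @` dom) y -> {for y, continuous (Defs.point c \o Z)}.
Proof.
rewrite imgE => By; apply: continuous_comp; first exact: cont_of sZ _.
by apply: Defs.point_continuous; apply: Wc; exact: (ZK By).1.
Qed.

(** The chart [c] restricted to the preimage of [W], followed by [F]; [Z] supplies the inverse.
    Compatibility with the atlas will place it there by maximality. *)
Definition change_chart : chart R 2 M :=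
  Chart dom_open img_open newK coord_cont point_cont.

Lemma cimg_change_chart : cimg change_chart = B.
Proof. exact: imgE. Qed.

Lemma coord_change_chart m : Defs.coord change_chart m = F (Defs.coord c m).
Proof. by []. Qed.

Lemma change_chart_compatible e : compatible c e -> compatible change_chart e.
Proof.
move=> [ce ec]; split=> i.
  have E y : overlap change_chart e y -> transition change_chart e i y = transition c e i (Z y).
    by [].
  have O y : overlap change_chart e y -> overlap c e (Z y).
    move=> [m [[cm Wm] em] <-]; exists m => //.
    by rewrite coord_change_chart (FK Wm).2.
  have S : smooth (overlap change_chart e) (fun y => transition c e i (Z y)).
    have := @smooth_comp (overlap c e) 2 (overlap change_chart e) (transition c e i) Z
      (@overlap_open c e) (@overlap_open change_chart e) O (ce i).
    apply.
    move=> j; apply: smooth_sub (sZ j) => y.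
    by move=> [m [dm _] <-]; rewrite -/B -imgE; exists m.
  exact: S.
have O y : overlap e change_chart y -> W (Defs.coord c (Defs.point e y)).
  by move=> [m [em [cm Wm]] <-]; rewrite coordK.
have := @smooth_comp W 2 (overlap e change_chart) (fun y => F y ord0 i)
  (fun y => Defs.coord c (Defs.point e y)) oW (@overlap_open e change_chart) O (sF i).
apply=> j.
apply: smooth_sub (ec j) => y [m [em [cm _]] <-].
by exists m.
Qed.

Lemma jac_change_chart m i k : cdom change_chart m ->
  jac c change_chart m i k = partial k (fun y => F y ord0 i) (Defs.coord c m).
Proof.
move=> [cm Wm]; apply: (partial_ext k oW Wm) => y Wy.
have [m' cm' <-] := Wc Wy.
by rewrite /transition coord_change_chart coordK.
Qed.

End Charts.

(** * Quadratic polynomials and the linear system for the connection *)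

Section Quadratic.
Variable R : realType.

(** The symmetries have such components in stereographic coordinates; storing the coefficients turns
    repeated differentiation into rewriting. *)
Definition quad (c0 c1 c2 c11 c12 c22 : R) (y : 'rV[R]_2) : R :=
  c0 + c1 * y ord0 i1 + c2 * y ord0 i2 + c11 * (y ord0 i1 * y ord0 i1) +
  c12 * (y ord0 i1 * y ord0 i2) + c22 * (y ord0 i2 * y ord0 i2).

Lemma partial_quad c0 c1 c2 c11 c12 c22 k y :
  partial k (quad c0 c1 c2 c11 c12 c22) y =
  if k == i1 then quad c1 (2 * c11) c12 0 0 0 y else quad c2 c12 (2 * c22) 0 0 0 y.
Proof.
have X i : is_derive y (e_ k) (fun z : 'rV[R]_2 => z ord0 i) (i == k)%:R.
  by have := is_derive_coord (e_ k) y i; rewrite mxE eqxx.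
have dX i : derivable (fun z : 'rV[R]_2 => z ord0 i) y (e_ k) by have := X i; case.
have Z (c : R) (f : 'rV[R]_2 -> R) : derivable f y (e_ k) -> derivable (fun z => c * f z) y (e_ k) /\
    partial k (fun z => c * f z) y = c * partial k f y.
  move=> df; split; first exact: derivableM (derivable_cst c y (e_ k)) df.
  by rewrite (partialM (derivable_cst c y (e_ k)) df) partial_cst mul0r add0r.
have P i j : derivable (fun z : 'rV[R]_2 => z ord0 i * z ord0 j) y (e_ k) /\
    partial k (fun z : 'rV[R]_2 => z ord0 i * z ord0 j) y =
    (i == k)%:R * y ord0 j + y ord0 i * (j == k)%:R.
  split; first exact: derivableM (dX i) (dX j).
  by rewrite (partialM (dX i) (dX j)) !partial_coord.
have S (f g : 'rV[R]_2 -> R) : derivable f y (e_ k) -> derivable g y (e_ k) ->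
   derivable (fun z => f z + g z) y (e_ k).
  by move=> df dg; exact: derivableD.
have d1 := Z c1 _ (dX i1); have d2 := Z c2 _ (dX i2).
have d11 := Z c11 _ (P i1 i1).1; have d12 := Z c12 _ (P i1 i2).1.
have d22 := Z c22 _ (P i2 i2).1; have d0 : derivable (fun=> c0 : R) y (e_ k) by exact: derivable_cst.
have s1 := S _ _ d0 d1.1; have s2 := S _ _ s1 d2.1; have s3 := S _ _ s2 d11.1.
have s4 := S _ _ s3 d12.1.
rewrite /quad (partialD s4 d22.1) (partialD s3 d12.1) (partialD s2 d11.1) (partialD s1 d2.1).
rewrite (partialD d0 d1.1) d22.2 d12.2 d11.2 d2.2 d1.2 !(P _ _).2 !partial_coord partial_cst.
by move: k {X dX Z P S d1 d2 d11 d12 d22 d0 s1 s2 s3 s4}; apply: forall_ord2 => /=; ring.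
Qed.

Lemma partial_quad1 c0 c1 c2 c11 c12 c22 :
  partial i1 (quad c0 c1 c2 c11 c12 c22) = quad c1 (2 * c11) c12 0 0 0.
Proof. by apply/funext => y; rewrite partial_quad. Qed.

Lemma partial_quad2 c0 c1 c2 c11 c12 c22 :
  partial i2 (quad c0 c1 c2 c11 c12 c22) = quad c2 c12 (2 * c22) 0 0 0.
Proof. by apply/funext => y; rewrite partial_quad. Qed.

(* With [T = (1 - ka N) Gamma], these are the affine equations at [(a, b)] for
   the symmetry vanishing there. *)
Lemma solve_connection (de ka a b T111 T112 T122 T211 T212 T222 : R) : de ^+ 2 = 1 ->
  - T211 = - 2 * ka * b + 2 * de * T112 ->
  de * T111 = - 2 * a * ka * de + 2 * de * T212 ->
  - T212 = 2 * a * ka + de * T122 - T111 ->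
  de * T112 = - 2 * b * ka + de * T222 - T211 ->
  - T222 = 2 * ka * de * b - 2 * T112 ->
  de * T122 = 2 * a * ka - 2 * T212 ->
  [/\ T111 = 2 * ka * a, T112 = 2 * ka * de * b & T122 = - 2 * ka * de * a] /\
  [/\ T211 = - 2 * ka * b, T212 = 2 * ka * a & T222 = 2 * ka * de * b].
Proof.
move/eqP; rewrite -subr_eq0 subr_sqr_1 mulf_eq0 => /orP[/eqP d1|/eqP d1].
  have -> : de = 1 by lra.
  by move: (ka * a) (ka * b) => *; split; split; lra.
have -> : de = - 1 by lra.
by split; split; lra.
Qed.

End Quadratic.

(** Proves an equation from a known one [l = r] when the two agree up to a rearrangement that [ring]
    or [field] can check. *)
Lemma eq_transfer (V : zmodType) (l r x y : V) : l = r -> x - l = y - r -> x = y.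
Proof. by move=> -> /addIr. Qed.

(** * Connection and operator in stereographic coordinates *)

Section StereoChart.
Variables (R : realType) (rho de ka : R).
Let B : set 'rV[R]_2 := ball (0 : 'rV[R]_2) rho.
Let oB : open B. Proof. exact: ball_open. Qed.
Hypotheses (de2 : de ^+ 2 = 1).
Variable G : 'I_2 -> 'I_2 -> 'I_2 -> 'rV[R]_2 -> R.
Variable A : 'rV[R]_2 -> 'M[R]_2.
Hypothesis Gsym : forall j r s y, B y -> G j r s y = G j s r y.
Hypothesis pos : forall y, B y -> 0 < 1 + ka * qnorm de y /\ 0 < 1 - ka * qnorm de y.

(** The given polynomials are the components of [2 b x1 - 2 a x2 + k x3], the combination vanishing
    at [w = (a, b)]. Its derivative there is [F] times the rotation generator with entries [-1] and
    [de], so the affine equations are linear in [F * G], and the Lie equation says that the operator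
    commutes with this generator. *)
Lemma stereo_isotropy (eta : 'rV[R]_2 -> 'rV[R]_2) (w : 'rV[R]_2) (a := w ord0 i1) (b := w ord0 i2)
    (k := 1 + ka * qnorm de w) (F := 1 - ka * qnorm de w) : B w ->
  (forall y, B y -> eta y ord0 i1 = quad b 0 (- k) (- ka * b) (2 * ka * a) (ka * de * b) y) ->
  (forall y, B y -> eta y ord0 i2 =
     quad (- de * a) (k * de) 0 (- ka * de * a) (- 2 * ka * b) (ka * a) y) ->
  (forall i r s, infinitesimal_affine eta G i r s w) ->
  (forall i j, lie_derivative_operator eta A i j w = 0) ->
  [/\ [/\ F * G i1 i1 i1 w = 2 * ka * a, F * G i1 i1 i2 w = 2 * ka * de * b &
       F * G i1 i2 i2 w = - 2 * ka * de * a],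
      [/\ F * G i2 i1 i1 w = - 2 * ka * b, F * G i2 i1 i2 w = 2 * ka * a &
       F * G i2 i2 i2 w = 2 * ka * de * b] &
      A w i2 i2 = A w i1 i1 /\ A w i2 i1 = - de * A w i1 i2].
Proof.
move=> Bw e1 e2 aff lie.
have F0 : F != 0 by rewrite gt_eqF // (pos Bw).2.
have qE : ka * qnorm de w = ka * (a ^+ 2 + de * b ^+ 2) by [].
have v1 : eta w ord0 i1 = 0 by rewrite e1 // /quad -/a -/b /k qE; ring.
have v2 : eta w ord0 i2 = 0.
  rewrite e2 // /quad -/a -/b /k qE.
  by transitivity (ka * a * b ^+ 2 * (de ^+ 2 - 1)); [ring|rewrite de2 subrr mulr0].
have p1 j y : B y -> partial j (fun z => eta z ord0 i1) y =
    partial j (quad b 0 (- k) (- ka * b) (2 * ka * a) (ka * de * b)) y.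
  by move=> By; exact: (partial_ext j oB By e1).
have p2 j y : B y -> partial j (fun z => eta z ord0 i2) y =
    partial j (quad (- de * a) (k * de) 0 (- ka * de * a) (- 2 * ka * b) (ka * a)) y.
  by move=> By; exact: (partial_ext j oB By e2).
have pp1 l j : partial l (partial j (fun z => eta z ord0 i1)) w =
    partial l (partial j (quad b 0 (- k) (- ka * b) (2 * ka * a) (ka * de * b))) w.
  exact: (partial_ext l oB Bw (p1 j)).
have pp2 l j : partial l (partial j (fun z => eta z ord0 i2)) w =
    partial l (partial j (quad (- de * a) (k * de) 0 (- ka * de * a) (- 2 * ka * b) (ka * a))) w.
  exact: (partial_ext l oB Bw (p2 j)).
have d11 : partial i1 (fun z => eta z ord0 i1) w = 0.
  by rewrite p1 // partial_quad1 /quad -/a -/b; ring.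
have d21 : partial i2 (fun z => eta z ord0 i1) w = - F.
  by rewrite p1 // partial_quad2 /quad -/a -/b /F /k qE; ring.
have d12 : partial i1 (fun z => eta z ord0 i2) w = de * F.
  rewrite p2 // partial_quad1 /quad -/a -/b /F /k qE.
  by transitivity (de - de * ka * a ^+ 2 + ka * b ^+ 2 * (de ^+ 2) - 2 * ka * b ^+ 2);
    [ring|rewrite de2; transitivity (de - de * ka * a ^+ 2 - ka * b ^+ 2 * de ^+ 2);
       [rewrite de2|]; ring].
have d22 : partial i2 (fun z => eta z ord0 i2) w = 0.
  by rewrite p2 // partial_quad2 /quad -/a -/b; ring.
have h111 : partial i1 (partial i1 (fun z => eta z ord0 i1)) w = - 2 * ka * b.
  by rewrite pp1 !partial_quad1 /quad; ring.
have h112 : partial i1 (partial i2 (fun z => eta z ord0 i1)) w = 2 * a * ka.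
  by rewrite pp1 partial_quad2 partial_quad1 /quad; ring.
have h122 : partial i2 (partial i2 (fun z => eta z ord0 i1)) w = 2 * ka * de * b.
  by rewrite pp1 !partial_quad2 /quad; ring.
have h211 : partial i1 (partial i1 (fun z => eta z ord0 i2)) w = - 2 * a * ka * de.
  by rewrite pp2 !partial_quad1 /quad; ring.
have h212 : partial i1 (partial i2 (fun z => eta z ord0 i2)) w = - 2 * b * ka.
  by rewrite pp2 partial_quad2 partial_quad1 /quad; ring.
have h222 : partial i2 (partial i2 (fun z => eta z ord0 i2)) w = 2 * a * ka.
  by rewrite pp2 !partial_quad2 /quad; ring.
have GC j : G j i2 i1 w = G j i1 i2 w by exact: Gsym.
have v0 i : eta w ord0 i = 0 by move: i; apply: forall_ord2.
pose p i l := partial l (fun z => eta z ord0 i) w.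
pose h i l j := partial l (partial j (fun z => eta z ord0 i)) w.
(* Because [eta] vanishes at [w], the unknown derivatives of the connection and of the operator drop
   out. *)
have aff0 i l j : p i i1 * G i1 l j w + p i i2 * G i2 l j w = h i l j +
    (G i i1 j w * p i1 l + G i l i1 w * p i1 j + (G i i2 j w * p i2 l + G i l i2 w * p i2 j)).
  by have := aff i l j; rewrite /infinitesimal_affine !sum_ord2 !v0 !mulr0 !add0r.
have lie0 i j : - (A w i1 j * p i i1) + A w i i1 * p i1 j +
    (- (A w i2 j * p i i2) + A w i i2 * p i2 j) = 0.
  by have := lie i j; rewrite /lie_derivative_operator sum_ord2 !v0 !mul0r !sub0r.
have P11 : p i1 i1 = 0 := d11; have P12 : p i1 i2 = - F := d21.
have P21 : p i2 i1 = de * F := d12; have P22 : p i2 i2 = 0 := d22.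
have H111 : h i1 i1 i1 = - 2 * ka * b := h111; have H112 : h i1 i1 i2 = 2 * a * ka := h112.
have H122 : h i1 i2 i2 = 2 * ka * de * b := h122.
have H211 : h i2 i1 i1 = - 2 * a * ka * de := h211.
have H212 : h i2 i1 i2 = - 2 * b * ka := h212; have H222 : h i2 i2 i2 = 2 * a * ka := h222.
have := (aff0 i1 i1 i1, aff0 i1 i1 i2, aff0 i1 i2 i2, (aff0 i2 i1 i1, aff0 i2 i1 i2, aff0 i2 i2 i2)).
have := (lie0 i1 i1, lie0 i1 i2).
rewrite P11 P12 P21 P22 H111 H112 H122 H211 H212 H222 !GC.
clear -F0 de2.
move: (A w i1 i1) (A w i1 i2) (A w i2 i1) (A w i2 i2) => m11 m12 m21 m22.
move: (G i1 i1 i1 w) (G i1 i1 i2 w) (G i1 i2 i2 w) (G i2 i1 i1 w) (G i2 i1 i2 w) (G i2 i2 i2 w).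
move: F F0 => F' F0 g1 g2 g3 g4 g5 g6 [l1 l2] [[[q1 q2] q3] [[q4 q5] q6]].
have [||||||S1 S2] := @solve_connection R de ka a b (F' * g1) (F' * g2) (F' * g3)
    (F' * g4) (F' * g5) (F' * g6) de2.
- by apply: (eq_transfer q1); ring.
- by apply: (eq_transfer q4); ring.
- by apply: (eq_transfer q2); ring.
- by apply: (eq_transfer q5); ring.
- by apply: (eq_transfer q3); ring.
- by apply: (eq_transfer q6); ring.
split=> //; split; apply: (mulfI F0).
  by apply: (eq_transfer l2); ring.
by apply: (eq_transfer l1); ring.
Qed.

Hypothesis rho0 : 0 < rho.
Hypothesis sA : forall i j, smooth B (fun y => A y i j).
Hypothesis Aform : forall y, B y -> A y i2 i2 = A y i1 i1 /\ A y i2 i1 = - de * A y i1 i2.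

(** The derivative matrices of both fields have the shape described by [Aform], and matrices of that
    shape commute. So the Lie equations say that the entries are constant along two fields, whose
    determinant times [4 * de] is [(1 - ka * qnorm de y) * (1 + ka * qnorm de y)], which is
    nonzero. *)
Lemma stereo_operator_constant (E1 E2 : 'rV[R]_2 -> 'rV[R]_2) :
  (forall i y, B y -> E1 y ord0 i = stereo1 de ka i y) ->
  (forall i y, B y -> E2 y ord0 i = stereo2 de ka i y) ->
  (forall i j y, B y -> lie_derivative_operator E1 A i j y = 0) ->
  (forall i j y, B y -> lie_derivative_operator E2 A i j y = 0) ->
  forall j y, B y -> A y i1 j = A 0 i1 j.
Proof.
move=> e1 e2 l1 l2.
have dec : de = 1 \/ de = - 1.
  by move/eqP: de2; rewrite sqrf_eq1 => /orP[/eqP|/eqP]; [left|right].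
have s11 (y : 'rV[R]_2) : stereo1 de ka i1 y = quad 2^-1 0 0 (- ka / 2) 0 (ka * de / 2) y.
  by rewrite /stereo1 /quad /=; field.
have s12 (y : 'rV[R]_2) : stereo1 de ka i2 y = quad 0 0 0 0 (- ka) 0 y.
  by rewrite /stereo1 /quad /=; ring.
have s21 (y : 'rV[R]_2) : stereo2 de ka i1 y = quad 0 0 0 0 (- ka) 0 y.
  by rewrite /stereo2 /quad /=; ring.
have s22 (y : 'rV[R]_2) : stereo2 de ka i2 y = quad (de / 2) 0 0 (ka * de / 2) 0 (- ka / 2) y.
  by rewrite /stereo2 /quad /=; field.
have pE (E : 'rV[R]_2 -> 'rV[R]_2) f i k y : B y -> (forall z, B z -> E z ord0 i = f z) ->
    partial k (fun z => E z ord0 i) y = partial k f y.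
  by move=> By; exact: (partial_ext k oB By).
have dA0 k j y : B y -> partial k (fun z => A z i1 j) y = 0.
  move=> By; have [A22 A21] := Aform By; have [k1 k2] := pos By.
  have x11 z Bz := etrans (e1 i1 z Bz) (s11 z); have x12 z Bz := etrans (e1 i2 z Bz) (s12 z).
  have x21 z Bz := etrans (e2 i1 z Bz) (s21 z); have x22 z Bz := etrans (e2 i2 z Bz) (s22 z).
  have q1 := l1 i1 j y By; have q2 := l2 i1 j y By; rewrite /lie_derivative_operator !sum_ord2 in q1 q2.
  rewrite !(pE E1 _ i1 _ y By x11) !(pE E1 _ i2 _ y By x12) in q1.
  rewrite !(pE E2 _ i1 _ y By x21) !(pE E2 _ i2 _ y By x22) in q2.
  rewrite (x11 y By) (x12 y By) !partial_quad /= in q1.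
  rewrite (x21 y By) (x22 y By) !partial_quad /= in q2.
  have D0 : (1 - ka * qnorm de y) * (1 + ka * qnorm de y) != 0.
    by rewrite mulf_neq0 // gt_eqF.
  suff Q : forall P1 P2 : R, P1 = partial i1 (fun z => A z i1 j) y ->
      P2 = partial i2 (fun z => A z i1 j) y -> P1 = 0 /\ P2 = 0.
    by have [Q1 Q2] := Q _ _ erefl erefl; move: k; apply: forall_ord2.
  move=> P1 P2 P1E P2E; rewrite -P1E -P2E in q1 q2 => {P1E P2E}.
  rewrite /quad in q1 q2; rewrite /qnorm in D0.
  move: (y ord0 i1) (y ord0 i2) D0 q1 q2 => a b D0 q1 q2.
  have [r1 r2] : (1 - ka * a ^+ 2 + ka * de * b ^+ 2) / 2 * P1 + (- ka * a * b) * P2 = 0 /\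
     (- ka * a * b) * P1 + (de + ka * de * a ^+ 2 - ka * b ^+ 2) / 2 * P2 = 0.
    move: j q1 q2; apply: forall_ord2 => /=; rewrite ?A22 ?A21;
    move: (A y i1 i1) (A y i1 i2) => m n q1 q2;
    by split; [apply: (eq_transfer q1)|apply: (eq_transfer q2)]; case: dec => ->; field.
  apply: (cramer2 (a := (de + ka * de * a ^+ 2 - ka * b ^+ 2) / 2) (b := ka * a * b)
    (c := ka * a * b) (d := (1 - ka * a ^+ 2 + ka * de * b ^+ 2) / 2)).
  - apply/eqP => E; move/negP: D0; apply.
    have -> : (1 - ka * (a ^+ 2 + de * b ^+ 2)) * (1 + ka * (a ^+ 2 + de * b ^+ 2)) =
      4 * de * ((de + ka * de * a ^+ 2 - ka * b ^+ 2) / 2 *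
      ((1 - ka * a ^+ 2 + ka * de * b ^+ 2) / 2) - ka * a * b * (ka * a * b)).
      by case: dec => ->; field.
    by rewrite E mulr0.
  - by rewrite -r1; ring.
  - by rewrite -r2; ring.
move=> j y By.
have [z1 [z2 [b1 b2]]] := MVT_box (f := fun z => A z i1 j) By (ballxx 0 rho0)
  (fun k z Bz => ((sA i1 j 1%N).2 k).1 z Bz).
by rewrite !dA0 // !mulr0 addr0 => /eqP; rewrite subr_eq0 => /eqP.
Qed.

End StereoChart.

(** The signs are read off from [f = F / 2], which forces [- ka] and [- ka * de]. Then
    [b = - ka * m] because [ka ^+ 2 = 1] gives [b * e1 = m] and [- (b * e2) = - de * m], the
    off-diagonal entries of the operator. *)
Lemma normal_form_alg (R : realFieldType) (de ka a0 m y1 y2 p1 p2 q1 q2 F f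
    g111 g112 g122 g211 g212 g222 : R) :
  de = 1 \/ de = - 1 -> ka = 1 \/ ka = - 1 -> F != 0 -> f = F / 2 ->
  F * g111 = 2 * ka * y1 -> F * g112 = 2 * ka * de * y2 -> F * g122 = - 2 * ka * de * y1 ->
  F * g211 = - 2 * ka * y2 -> F * g212 = 2 * ka * y1 -> F * g222 = 2 * ka * de * y2 ->
  let e1 := - ka in let e2 := - ka * de in let b := m * - ka in
  let c1 := g111 * p1 * p1 + g112 * p1 * p2 + (g112 * p2 * p1 + g122 * p2 * p2) in
  let c2 := g211 * p1 * p1 + g212 * p1 * p2 + (g212 * p2 * p1 + g222 * p2 * p2) in
  a0 * (q1 + c1) + m * (q2 + c2) =
    a0 * q1 + (a0 * (e1 / f) * p1 * (y1 * p1 - 2 * y1 * p1) +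
               a0 * (e2 / f) * p2 * (y1 * p2 - 2 * y2 * p1)) + b * e1 * q2
    + (b * e1 * (e1 / f) * p1 * (y2 * p1 - 2 * y1 * p2) +
       b * e1 * (e2 / f) * p2 * (y2 * p2 - 2 * y2 * p2)) /\
  - de * m * (q1 + c1) + a0 * (q2 + c2) =
    a0 * q2 + (a0 * (e1 / f) * p1 * (y2 * p1 - 2 * y1 * p2) +
               a0 * (e2 / f) * p2 * (y2 * p2 - 2 * y2 * p2)) - b * e2 * q1
    - (b * e2 * (e1 / f) * p1 * (y1 * p1 - 2 * y1 * p1) +
       b * e2 * (e2 / f) * p2 * (y1 * p2 - 2 * y2 * p1)).
Proof.
move=> hd hk F0 -> E1 E2 E3 E4 E5 E6.
have D g t : F * g = t -> g = t / F by move=> <-; rewrite mulrC mulKf.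
rewrite (D _ _ E1) (D _ _ E2) (D _ _ E3) (D _ _ E4) (D _ _ E5) (D _ _ E6).
by case: hd => ->; case: hk => -> /=; split; field.
Qed.

Unset Implicit Arguments.

Theorem theorem22p3 (R : realType) (M : topologicalType)
  (atlas : set (chart R 2 M))
  (A : operator_components R 2 M) (Gamma : connection_components R 2 M)
  (M_manifold : smooth_manifold atlas)
  (M_connected : connected [set: M])
  (Gamma_connection : affine_connection atlas Gamma)
  (Gamma_symmetric : symmetric_connection atlas Gamma)
  (A_operator : operator_field atlas A)
  (A_nondegenerate : nondegenerate_operator atlas A)
  (gen_pos : general_position atlas Gamma)
  (dim_max : symmetry_algebra_dim atlas A Gamma 3) :
  forall m : M, exists d : chart R 2 M,
    [/\ atlas d, cdom d m
      & exists (a b : R) (eps : 'I_2 -> R),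
          (forall r, eps r = 1 \/ eps r = -1) /\
          (forall y, cimg d y ->
             conformal_factor eps y != 0 /\
             forall p q, system_rhs (A d) (Gamma d) y p q =
                         normal_form_rhs a b eps y p q)].
Proof.
move=> m; have [_ _ cover compat maxi] := M_manifold.
have [c ac cm] := cover m; set p := Defs.coord c m.
have cp : open_carrier (chart_set c) p by exists m.
have [r [r0 rU rP]] := jet_uniqueness (smooth_conn Gamma_connection ac) cp.
(* Local fields are kept tied to global symmetries, because the operator equation and the component
   change to the new chart are available only for the latter. *)
pose P f := exists2 xi, point_symmetry atlas A Gamma xi & f = local_field c xi.
have PA f : P f -> affine_field (smooth_conn Gamma_connection ac) f.
  by move=> [xi ps ->]; exact: (local_field_affine Gamma_connection ac ps).
have PJ v1 v2 t : exists f, [/\ P f, f i1 p = v1, f i2 p = v2 & twist (Gamma c) p f = t].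
  have [xi ps [h1 h2 h3]] := symmetry_jets Gamma_connection Gamma_symmetric M_manifold
    M_connected gen_pos dim_max ac cp v1 v2 t.
  by exists (local_field c xi); split=> //; exists xi.
have [x1 [x2 [x3 [de [ka [[xi1 ps1 x1E] [xi2 ps2 x2E] [xi3 ps3 x3E] [fr x3p] [de2 kk rel]]]]]]] :=
  normalized_structure (conn_sym Gamma_symmetric ac) cp r0 rU (gen_pos c p ac cp) rP PA PJ.
have sx (x : 'I_2 -> smooth_fun (chart_set c)) i : smooth (cimg c) (x i) by exact: (@sfunP R (chart_set c) (x i)).
have oc : open (cimg c) by exact: open_cimg.
pose D y := x1 i1 y * x2 i2 y - x2 i1 y * x1 i2 y.
have sD : smooth (cimg c) D.
  apply: (smoothD oc); first exact: (smoothM oc (sx x1 i1) (sx x2 i2)).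
  by apply: (smoothN oc); exact: (smoothM oc (sx x2 i1) (sx x1 i2)).
have Dp : 0 < `|D p| by rewrite normr_gt0.
(* Shrinks the ball so that [x1] and [x2] stay independent and the bracket relations hold. *)
have [s s0 sP] : exists2 s : R, 0 < s & ball p s `<=` ball p r `&` [set y | `|D p - D y| < `|D p|].
  apply: near_ball; apply: filterI; last exact: (near_dist ((sD 0%N).1 p cp) Dp).
  by apply: open_nbhs_nbhs; split; [exact: ball_open|exact: ballxx].
pose V := ball p s; have oV : open V by exact: ball_open.
have Vr y : V y -> ball p r y by move=> /sP[].
have VU : V `<=` cimg c by move=> y /Vr /rU.
have sV (x : 'I_2 -> smooth_fun (chart_set c)) i : smooth V (x i) := smooth_sub VU (sx x i).
have D0 y : V y -> D y != 0.
  by move=> /sP[_ /= h]; apply/eqP => Dy; move: h; rewrite Dy subr0 ltxx.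
have [Y [rho [W [Z]]]] := stereographic_coordinates oV de2 (sV x1) (sV x2) (sV x3)
  (fun i y Vy => let: And3 h _ _ := rel i y (Vr y Vy) in h)
  (fun i y Vy => let: And3 _ h _ := rel i y (Vr y Vy) in h)
  (fun i y Vy => let: And3 _ _ h := rel i y (Vr y Vy) in h) D0 (ballxx p s0) x3p.
set F := fun y => vec (Y i1 y) (Y i2 y).
move=> /= [rho0 oW Wp WV [sY FK ZK sZ tab]].
have FE i y : F y ord0 i = Y i y by move: i; apply: forall_ord2; rewrite vecE.
have sF i : smooth W (fun y => F y ord0 i).
  by move=> k; apply: (Ck_ext oW _ (sY i k)) => y _; rewrite FE.
have Wc : W `<=` cimg c by move=> y /WV /VU.
pose e := change_chart oW Wc sF sZ FK ZK.
have ae : atlas e by apply: maxi => e' ae'; exact: change_chart_compatible (compat c e' ac ae').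
have eB : cimg e = ball (0 : 'rV[R]_2) rho by exact: cimg_change_chart.
set B := ball (0 : 'rV[R]_2) rho in eB.
(* The components of a symmetry in the new chart are the derivatives of the new coordinates along
   it, which [tab] computes for the three frame fields. *)
have field_e xi i w : point_symmetry atlas A Gamma xi -> B w ->
    xi e w ord0 i = dir (fun i => local_field c xi i) (Y i) (Z w).
  move=> [vf _] Bw; have [WZ FZ] := ZK w Bw; have [m' cm' mZ] := Wc _ WZ.
  have em' : cdom e m' by split=> //=; rewrite mZ.
  have ew : Defs.coord e m' = w by rewrite coord_change_chart mZ.
  have := vf.2 c e m' ac ae cm' em' i; rewrite ew mZ => ->.
  rewrite /dir; apply: eq_bigr => k _; rewrite jac_change_chart // mZ mulrC.
  rewrite (local_fieldE k vf ac (Wc _ WZ)); congr (_ * _).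
  exact: (partial_ext k oW WZ (fun y _ => FE i y)).
have pos w : B w -> 0 < 1 + ka * qnorm de w /\ 0 < 1 - ka * qnorm de w.
  by move=> Bw; have [WZ FZ] := ZK w Bw; have [] := tab _ WZ; rewrite -/(F _) FZ.
have st w i : B w -> [/\ xi1 e w ord0 i = stereo1 de ka i w,
    xi2 e w ord0 i = stereo2 de ka i w & xi3 e w ord0 i = stereo3 de i w].
  move=> Bw; have [WZ FZ] := ZK w Bw; have [_ _ /(_ i)] := tab _ WZ.
  by rewrite -/(F _) FZ x1E x2E x3E !field_e.
have Gsym j k l y : B y -> Gamma e j k l y = Gamma e j l k y.
  by rewrite -eB => By; exact: Gamma_symmetric.
have iso w : B w -> [/\ [/\ (1 - ka * qnorm de w) * Gamma e i1 i1 i1 w = 2 * ka * w ord0 i1,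
       (1 - ka * qnorm de w) * Gamma e i1 i1 i2 w = 2 * ka * de * w ord0 i2 &
       (1 - ka * qnorm de w) * Gamma e i1 i2 i2 w = - 2 * ka * de * w ord0 i1],
      [/\ (1 - ka * qnorm de w) * Gamma e i2 i1 i1 w = - 2 * ka * w ord0 i2,
       (1 - ka * qnorm de w) * Gamma e i2 i1 i2 w = 2 * ka * w ord0 i1 &
       (1 - ka * qnorm de w) * Gamma e i2 i2 i2 w = 2 * ka * de * w ord0 i2] &
      A e w i2 i2 = A e w i1 i1 /\ A e w i2 i1 = - de * A e w i1 i2].
  (* The symmetry vanishing at [w]; the coefficient [1 + ka * qnorm de w] of [xi3] is split in two
     to match the shape [a xi + eta] of [point_symmetryZD]. *)
  move=> Bw; pose eta c' y := (2 * w ord0 i2) *: xi1 c' y + ((- 2 * w ord0 i1) *: xi2 c' y +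
     ((ka * qnorm de w) *: xi3 c' y + xi3 c' y)).
  have [_ det] : point_symmetry atlas A Gamma eta by do 3 apply: point_symmetryZD => //.
  have ew : cimg e w by rewrite eB.
  have [lie aff] := det e w ae ew.
  apply: (stereo_isotropy de2 Gsym pos Bw _ _ aff lie) => y By.
    have [h1 h2 h3] := st y i1 By.
    by rewrite /eta !mxE h1 h2 h3 /stereo1 /stereo2 /stereo3 /quad /=; field.
  have [h1 h2 h3] := st y i2 By.
  by rewrite /eta !mxE h1 h2 h3 /stereo1 /stereo2 /stereo3 /quad /=; field.
have Ac j y : B y -> A e y i1 j = A e 0 i1 j.
  move=> By.
  have K := stereo_operator_constant de2 pos rho0 (A := A e).
  apply: (K _ _ (xi1 e) (xi2 e)) By.
  - by move=> k l; rewrite -/B -eB; exact: (A_operator.1 e ae k l).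
  - by move=> z Bz; have [] := iso z Bz.
  - by move=> i z Bz; have [] := st z i Bz.
  - by move=> i z Bz; have [] := st z i Bz.
  - by move=> i k z Bz; apply: (ps1.2 e z ae _).1; rewrite eB.
  - by move=> i k z Bz; apply: (ps2.2 e z ae _).1; rewrite eB.
have B0 : B 0 by exact: ballxx.
have dec : de = 1 \/ de = - 1.
  by move/eqP: de2; rewrite sqrf_eq1 => /orP[/eqP|/eqP]; [left|right].
have F0 y : B y -> 1 - ka * qnorm de y != 0 by move=> By; rewrite gt_eqF // (pos y By).2.
have kac : ka = 1 \/ ka = - 1.
  case: kk => [k0|/eqP]; last by rewrite sqrf_eq1 => /orP[/eqP|/eqP]; [left|right].
  have G0 j k l y : B y -> Gamma e j k l y = 0.
    move=> By; apply: (mulfI (F0 y By)); rewrite mulr0.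
    have [[a1 a2 a3] [b1 b2 b3] _] := iso y By.
    move: j k l; do 3 apply: forall_ord2; rewrite ?(Gsym _ i2 i1 y By) ?a1 ?a2 ?a3 ?b1 ?b2 ?b3 k0;
    by rewrite !(mulr0, mul0r).
  have oB : open B by exact: ball_open.
  have C0 i k l n : curvature (Gamma e) i k l n 0 = 0.
    have dG h j' k' l' : partial h (Gamma e j' k' l') 0 = 0.
      by rewrite (partial_ext h oB B0 (G0 j' k' l')) partial_cst.
    by rewrite /curvature sum_ord2 !dG !G0 // !mul0r !subr0 !addr0.
  have g0 : ricci_sym (Gamma e) 0 = 0.
    apply/matrixP => i j; rewrite [LHS]mxE [RHS]mxE.
    by rewrite [ricci _ _ i j]mxE [ricci _ _ j i]mxE !sum_ord2 !C0 !addr0 mulr0.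
  have := gen_pos e 0 ae; rewrite eB g0 => /(_ B0).
  by rewrite unitmxE det0 unitr0.
exists e; split; [exact: ae|exact: (conj cm Wp)|].
(* The first row of the operator at the origin gives the constants; the factor [- ka] is the first
   sign, which the normal form multiplies back into [b]. *)
exists (A e 0 i1 i1), (A e 0 i1 i2 * - ka), (fun r => if r == i1 then - ka else - ka * de).
split.
  apply: forall_ord2 => /=; first by case: kac => ->; rewrite ?opprK; [right|left].
  by case: kac => ->; case: dec => ->; rewrite ?mulr1 ?mulrN1 ?opprK; [right|left|left|right].
move=> y; rewrite eB => By.
have fE : conformal_factor (fun r => if r == i1 then - ka else - ka * de) y =
    (1 - ka * qnorm de y) / 2.
  by rewrite /conformal_factor /qnorm /=; field.
split; first by rewrite fE mulf_neq0 ?invr_eq0 ?pnatr_eq0 // F0.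
move=> pp qq; have [[a1 a2 a3] [b1 b2 b3] [A22 A21]] := iso y By.
have [h1 h2] := normal_form_alg (A e 0 i1 i1) (A e 0 i1 i2) (pp ord0 i1) (pp ord0 i2)
  (qq ord0 i1) (qq ord0 i2) dec kac (F0 y By) fE a1 a2 a3 b1 b2 b3.
apply: rV2P; rewrite /system_rhs /normal_form_rhs [LHS]mxE [RHS]mxE /= !sum_ord2 !(Gsym _ i2 i1 y By).
  by rewrite !Ac //; exact: h1.
by rewrite A22 A21 !Ac //; exact: h2.
Qed.
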